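(* There exists a measurable set $X\subset\mathbb R$ of constant density such that no set $Y\subset\mathbb R$ similar to $X$ supports almost invariant functions.
   Context: Constant density: a measurable set $X\subset\mathbb R$ has constant density if there exist $N,c>0$ such that $\mu(X\cap[r,r+N])/N>c$ for all $r\in\mathbb R$, where $\mu$ is Lebesgue measure. Supporting almost invariant functions: a measurable set $X\subset\mathbb R$ supports almost invariant functions if there exist $L^2$ functions $f_i\colon X\to\mathbb C$, $i=1,2,\dots$, extended by zero to $\mathbb R$ and of norm $\|f_i\|_{L^2}=1$, such that $\|f_i-\widehat{f_i}\|_{L^2}\to0$ as $i\to\infty$. Here $\widehat{\ }$ denotes the unitary Fourier transform on $L^2(\mathbb R)$, $\widehat f(x)=\int_{\mathbb R}e^{-2\pi i xy}f(y)\,dy$. Similarity: $Y$ is similar to $X$ if $Y=r_1X+r_2$ for some $r_1\in\mathbb R\setminus\{0\}$ and $r_2\in\mathbb R$. *)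

(* Defs.v *)
From mathcomp Require Export all_boot all_order all_algebra.
From mathcomp Require Export complex.
From mathcomp Require Export all_classical all_reals all_analysis.
Export Order.TTheory GRing.Theory Num.Theory.
Export numFieldNormedType.Exports.

Set Implicit Arguments.
Unset Strict Implicit.
Unset Printing Implicit Defensive.

Local Open Scope classical_set_scope.
Local Open Scope ring_scope.
Local Open Scope complex_scope.

Definition constant_density (R : realType) (X : set R) : Prop :=
  exists N c : R, [/\ 0 < N, 0 < c &
    forall r : R,
      (c%:E < lebesgue_measure (X `&` [set` `[r, (r + N)%R]]) / N%:E)%E].

Definition similar (R : realType) (X Y : set R) : Prop :=
  exists r1 r2 : R, r1 != 0 /\ Y = [set r1 * x + r2 | x in X].

(* R[i] carries no sigma-algebra or integral in the libraries, so both notions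
   are taken componentwise. Measurability on R is Borel measurability: up to null
   sets, Lebesgue measurable sets and functions are Borel. *)
Definition measurable_cfun (R : realType) (f : R -> R[i]) : Prop :=
  measurable_fun setT (fun x => complex.Re (f x)) /\
  measurable_fun setT (fun x => complex.Im (f x)).

Definition cintegral (R : realType) (f : R -> R[i]) : R[i] :=
  (\int[lebesgue_measure]_y complex.Re (f y)) +i*
  (\int[lebesgue_measure]_y complex.Im (f y)).

Definition L2norm (R : realType) (f : R -> R[i]) : \bar R :=
  ('N[lebesgue_measure]_2%:E[EFin \o (fun x => ComplexField.Normc.normc (f x))])%E.

Definition L2fun (R : realType) (f : R -> R[i]) : Prop :=
  measurable_cfun f /\ (L2norm f < +oo)%E.

(* [expi t] is exp(i t). *)
Definition expi (R : realType) (t : R) : R[i] := cos t +i* sin t.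

Definition fourier_integral (R : realType) (f : R -> R[i]) (x : R) : R[i] :=
  cintegral (fun y => expi (- (2 * pi * x * y)) * f y).

Definition truncate (R : realType) (n : nat) (f : R -> R[i]) (y : R) : R[i] :=
  if `|y| <= n%:R then f y else 0.

(* The integral defining the Fourier transform need not converge for a square
   integrable f. By Plancherel's theorem, the unitary extension of the integral
   from L^1 /\ L^2 to L^2 sends f to the L^2 limit of the Fourier integrals of
   the truncations of f, which lie in L^1 /\ L^2 and converge to f in L^2.
   This determines g up to equality almost everywhere. *)
Definition is_fourier_transform (R : realType) (f g : R -> R[i]) : Prop :=
  L2fun g /\
  L2norm (fun x => g x - fourier_integral (truncate n f) x)
    @[n --> \oo] --> 0%E.

(* [f i] is the extension by zero to the line of a function on X, and [g i] is
   any representative of its Fourier transform. *)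
Definition supports_almost_invariant_functions (R : realType) (X : set R)
    : Prop :=
  exists f g : nat -> R -> R[i],
    [/\ forall i, L2fun (f i) /\ L2norm (f i) = 1%E,
        forall i x, ~ X x -> f i x = 0,
        forall i, is_fourier_transform (f i) (g i) &
        L2norm (fun x => f i x - g i x) @[i --> \oo] --> 0%E].

(* Main.v *)
(** On [[n, n + 1)] let X be a union of short intervals, of period [2 ^ - |n|]
    and of density eps, so that X is exponentially fine at infinity. Splitting
    functions into real and imaginary and then into even and odd parts, almost
    invariant functions on Y similar to X yield a real [u] of bounded support,
    living on Y and its reflection, with [C u] close to [u] for the cosine
    transform C.

    For any two functions [h], [k] living on such a fine set, replacing both by
    their restrictions to a core [[-r, r)] changes [<h, C k>] only by a small
    multiple of [|h| |k|]: on each shell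
    [4 ^ j <= |x| < 4 ^ (j + 1)] one may replace [k] by its masses in tiny cells,
    which have small squares because X is thin in each cell; the resulting
    trigonometric sums are orthogonal inside a shell by Parseval and almost
    orthogonal between distinct shells by Schur's test.

    In the core the uncertainty principle is used. Averaging over shifts by
    [+- d] corresponds to multiplication by [cos (2 pi d x)] on the transform
    side. Polynomials in this average produce from [u] an [h], still supported on
    a fine set, and a [k = p u] with [C h] close to [k] and [C k] close to [h],
    where inside the core [p] is concentrated near two points [+- y] around which
    [u] has a fair share of its mass. Since the core part of [k] is then
    concentrated on a set of measure much smaller than [1 / r], its pairing
    through C with the core part of [h] is small too. So
    [|h| ^ 2 + |k| ^ 2], which is close to [2 <h, C k>], is small,
    against the choice of [y]. *)

Require Import Defs.
From mathcomp Require Import measurable_realfun ring lra zify.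

Set Implicit Arguments.
Unset Strict Implicit.
Unset Printing Implicit Defensive.

Local Open Scope classical_set_scope.
Local Open Scope ring_scope.

(** * Square integrable functions and the cosine and sine transforms *)

Section L2.
Context {R : realType}.
Implicit Types (f g h : R -> R) (c : R) (A : set R).
Notation mu := (@lebesgue_measure R).

(** For a core of radius [r = 4 ^ j0] the trivial bound on the core part of the pairing is
    [2 * r * |h| * |k|], which says nothing as [r] is large; hence the concentration of one of the
    two functions to width about [1 / r]. What makes it affordable is the order of choices. First
    comes [j0]; then the number [m] of annuli and the degree of the polynomial, which depend on [r]
    alone; then the shift [d], a dyadic fraction of the scale of the similarity. Outside of the core
    the periods of the set are finer than this fraction and divide it, so shifting by multiples of
    [d] preserves the periodic pattern. Thus the enormous number of shifts does not make the support
    of [h] any less thin than two neighbouring patterns and their reflections. The norm of the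
    polynomial explodes as [d] tends to 0, but it is paid for by the tolerance [tau], which is
    chosen last. *)

Definition L1 f : Prop := mu.-integrable setT (EFin \o f).

Definition L2 f : Prop := measurable_fun setT f /\ L1 (fun x => f x ^+ 2).

Definition dot f g : R := \int[mu]_x (f x * g x).

Definition nrm f : R := Num.sqrt (dot f f).

Lemma L1_measurable f : L1 f -> measurable_fun setT f.
Proof. by move=> /measurable_int /measurable_EFinP. Qed.

Lemma L1_le f g : measurable_fun setT f -> L1 g ->
  (forall x, `|f x| <= `|g x|) -> L1 f.
Proof.
move=> mf ig fg; apply: le_integrable ig => //.
  exact/measurable_EFinP.
by move=> x _ /=; rewrite lee_fin.
Qed.

Lemma L1D f g : L1 f -> L1 g -> L1 (fun x => f x + g x).
Proof.
move=> If Ig; have := integrableD measurableT If Ig.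
by apply: eq_integrable => // x _ /=; rewrite EFinD.
Qed.

Lemma L1Z c f : L1 f -> L1 (fun x => c * f x).
Proof.
move=> If; have := integrableZl measurableT c If.
by apply: eq_integrable => // x _ /=; rewrite EFinM.
Qed.

Lemma L1N f : L1 f -> L1 (fun x => - f x).
Proof.
move=> If; have := L1Z (-1) If.
by congr (L1 _); apply/funext => x; rewrite mulN1r.
Qed.

Lemma L1B f g : L1 f -> L1 g -> L1 (fun x => f x - g x).
Proof. by move=> If Ig; apply: L1D => //; exact: L1N. Qed.

Lemma L1_norm f : L1 f -> L1 (fun x => `|f x|).
Proof.
move=> If; apply: (L1_le _ If).
  by apply: measurableT_comp => //; exact: L1_measurable.
by move=> x; rewrite normr_id.
Qed.

Lemma L1_sum (I : Type) (s : seq I) (P : pred I) (F : I -> R -> R) :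
  (forall i, P i -> L1 (F i)) -> L1 (fun x => \sum_(i <- s | P i) F i x).
Proof.
move=> IF; elim: s => [|i s IHs].
  have := integrable0 mu setT.
  by apply: eq_integrable => // x _ /=; rewrite big_nil.
have [Pi|nPi] := boolP (P i); last first.
  by move: IHs; congr (L1 _); apply/funext => x; rewrite big_cons (negPf nPi).
by have := L1D (IF i Pi) IHs; congr (L1 _); apply/funext => x; rewrite big_cons Pi.
Qed.

Lemma L1_indic A : measurable A -> (mu A < +oo)%E -> L1 \1_A.
Proof.
move=> mA Afin; apply/integrableP; split.
  by apply/measurable_EFinP; exact: measurable_indic.
apply: le_lt_trans Afin; have := integral_indic mu measurableT mA.
rewrite setIT => <-; rewrite le_eqVlt; apply/orP; left; apply/eqP.
by apply: eq_integral => t _; rewrite gee0_abs// lee_fin.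
Qed.

Lemma eq_int f g : (forall x, f x = g x) -> \int[mu]_x f x = \int[mu]_x g x.
Proof. by move=> fg; apply: eq_Rintegral => x _. Qed.

Lemma intD f g : L1 f -> L1 g ->
  \int[mu]_x (f x + g x) = \int[mu]_x f x + \int[mu]_x g x.
Proof. by move=> If Ig; exact: RintegralD. Qed.

Lemma intB f g : L1 f -> L1 g ->
  \int[mu]_x (f x - g x) = \int[mu]_x f x - \int[mu]_x g x.
Proof. by move=> If Ig; exact: RintegralB. Qed.

Lemma intZ c f : L1 f -> \int[mu]_x (c * f x) = c * \int[mu]_x f x.
Proof. by move=> If; exact: RintegralZl. Qed.

Lemma int0 : \int[mu]_x (0 : R) = 0.
Proof. by rewrite /Rintegral integral0. Qed.

Lemma int_sum (I : Type) (s : seq I) (P : pred I) (F : I -> R -> R) :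
  (forall i, P i -> L1 (F i)) ->
  \int[mu]_x (\sum_(i <- s | P i) F i x) = \sum_(i <- s | P i) \int[mu]_x F i x.
Proof.
move=> IF; elim: s => [|i s IHs].
  by rewrite big_nil -[RHS]int0; apply: eq_int => x; rewrite big_nil.
rewrite big_cons -IHs; case: ifP => Pi; last first.
  by apply: eq_int => x; rewrite big_cons Pi.
rewrite -intD; [|exact: IF|exact: L1_sum].
by apply: eq_int => x; rewrite big_cons Pi.
Qed.

Lemma le_int f g : L1 f -> L1 g -> (forall x, f x <= g x) ->
  \int[mu]_x f x <= \int[mu]_x g x.
Proof. by move=> If Ig fg; apply: le_Rintegral. Qed.

Lemma int_ge0 f : (forall x, 0 <= f x) -> 0 <= \int[mu]_x f x.
Proof. by move=> f0; exact: Rintegral_ge0. Qed.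

Lemma int_norm f : L1 f -> `|\int[mu]_x f x| <= \int[mu]_x `|f x|.
Proof. by move=> If; exact: le_normr_Rintegral. Qed.

Lemma int_indic A : measurable A -> \int[mu]_x (\1_A x : R) = fine (mu A).
Proof. by move=> mA; rewrite /Rintegral integral_indic// setIT. Qed.

Lemma L2M f g : L2 f -> L2 g -> L1 (fun x => f x * g x).
Proof.
move=> [mf f2] [mg g2]; apply: (L1_le _ (L1D f2 g2)).
  exact: measurable_funM.
move=> x; rewrite normrM [leRHS]ger0_norm ?addr_ge0 ?sqr_ge0//.
rewrite -(real_normK (num_real (f x))) -(real_normK (num_real (g x))).
by have := normr_ge0 (f x); have := normr_ge0 (g x); nra.
Qed.

Lemma L2Mb c f g : measurable_fun setT g -> (forall x, `|g x| <= c) -> L2 f ->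
  L2 (fun x => g x * f x).
Proof.
move=> mg gc [mf f2]; split; first exact: measurable_funM.
apply: (L1_le _ (L1Z (c ^+ 2) f2)).
  by apply: measurable_funX; exact: measurable_funM.
move=> x; rewrite exprMn [leLHS]normrM [leRHS]normrM ler_wpM2r// !normrX.
by rewrite lerXn2r ?nnegrE// (le_trans (gc x))// ler_norm.
Qed.

Lemma L2Z c f : L2 f -> L2 (fun x => c * f x).
Proof. by apply: (@L2Mb `|c| f (cst c)) => //; exact: measurable_cst. Qed.

Lemma L2D f g : L2 f -> L2 g -> L2 (fun x => f x + g x).
Proof.
move=> Lf Lg; have [[mf f2] [mg g2]] := (Lf, Lg).
split; first exact: measurable_funD.
have := L1D (L1D f2 g2) (L1Z 2 (L2M Lf Lg)).
by congr (L1 _); apply/funext => x; ring.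
Qed.

Lemma L2N f : L2 f -> L2 (fun x => - f x).
Proof.
move=> Lf; have := L2Z (-1) Lf.
by congr (L2 _); apply/funext => x; rewrite mulN1r.
Qed.

Lemma L2B f g : L2 f -> L2 g -> L2 (fun x => f x - g x).
Proof. by move=> Lf Lg; apply: L2D => //; exact: L2N. Qed.

Lemma L2_0 : L2 (fun=> 0).
Proof.
split; first exact: measurable_cst.
have := integrable0 mu setT.
by apply: eq_integrable => // x _ /=; rewrite expr0n.
Qed.

Lemma L2_sum (I : Type) (s : seq I) (P : pred I) (F : I -> R -> R) :
  (forall i, P i -> L2 (F i)) -> L2 (fun x => \sum_(i <- s | P i) F i x).
Proof.
move=> IF; elim: s => [|i s IHs].
  by have := L2_0; congr (L2 _); apply/funext => x; rewrite big_nil.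
have [Pi|nPi] := boolP (P i); last first.
  by move: IHs; congr (L2 _); apply/funext => x; rewrite big_cons (negPf nPi).
by have := L2D (IF i Pi) IHs; congr (L2 _); apply/funext => x; rewrite big_cons Pi.
Qed.

Lemma indic_norm A x : `|\1_A x : R| <= 1.
Proof. by rewrite indicE; case: (_ \in _); rewrite ?normr1 ?normr0. Qed.

Lemma indicM A (x y : R) : \1_A x * y = (if x \in A then y else 0).
Proof. by rewrite indicE; case: ifP; rewrite ?mul1r ?mul0r. Qed.

Lemma L2_restr A f : measurable A -> L2 f -> L2 (fun x => \1_A x * f x).
Proof.
move=> mA; apply: (@L2Mb 1); first exact: measurable_indic.
by move=> x; exact: indic_norm.
Qed.

Lemma L2_indic A : measurable A -> (mu A < +oo)%E -> L2 \1_A.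
Proof.
move=> mA Afin; split; first exact: measurable_indic.
have := L1_indic mA Afin; congr (L1 _); apply/funext => x.
by rewrite indicE; case: (_ \in _); rewrite ?expr1n ?expr0n.
Qed.

Lemma dotC f g : dot f g = dot g f.
Proof. by apply: eq_int => x; rewrite mulrC. Qed.

Lemma dotDl f g h : L2 f -> L2 g -> L2 h ->
  dot (fun x => f x + g x) h = dot f h + dot g h.
Proof.
move=> Lf Lg Lh; rewrite /dot -intD; [|exact: L2M..].
by apply: eq_int => x; rewrite mulrDl.
Qed.

Lemma dotZl c f g : L2 f -> L2 g -> dot (fun x => c * f x) g = c * dot f g.
Proof.
move=> Lf Lg; rewrite /dot -intZ; [|exact: L2M..].
by apply: eq_int => x; rewrite mulrA.
Qed.

Lemma dotBl f g h : L2 f -> L2 g -> L2 h ->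
  dot (fun x => f x - g x) h = dot f h - dot g h.
Proof.
move=> Lf Lg Lh; rewrite /dot -intB; [|exact: L2M..].
by apply: eq_int => x; rewrite mulrBl.
Qed.

Lemma dotDr f g h : L2 f -> L2 g -> L2 h ->
  dot h (fun x => f x + g x) = dot h f + dot h g.
Proof. by move=> *; rewrite dotC dotDl// dotC (dotC g). Qed.

Lemma dotBr f g h : L2 f -> L2 g -> L2 h ->
  dot h (fun x => f x - g x) = dot h f - dot h g.
Proof. by move=> *; rewrite dotC dotBl// dotC (dotC g). Qed.

Lemma dot_ge0 f : 0 <= dot f f.
Proof. by apply: int_ge0 => x; rewrite -expr2 sqr_ge0. Qed.

Lemma nrm_ge0 f : 0 <= nrm f.
Proof. exact: sqrtr_ge0. Qed.

Lemma nrm2 f : nrm f ^+ 2 = dot f f.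
Proof. by rewrite sqr_sqrtr// dot_ge0. Qed.

Lemma dot_sqr_le f g : L2 f -> L2 g -> dot f g ^+ 2 <= dot f f * dot g g.
Proof.
move=> Lf Lg.
have pos t : 0 <= dot f f + 2 * t * dot f g + t ^+ 2 * dot g g.
  have := dot_ge0 (fun x => f x + t * g x).
  have Lt := L2Z t Lg; have Lft := L2D Lf Lt.
  rewrite dotDl// (dotDr Lf Lt)// (dotDr Lf Lt)// !dotZl//.
  rewrite (dotC f (fun x => t * g x)) (dotC g (fun x => t * g x)) !dotZl// (dotC g f).
  by move=> /le_trans; apply; rewrite le_eqVlt; apply/orP; left; apply/eqP; ring.
have [g0|g0] := eqVneq (dot g g) 0.
  have [->|fg0] := eqVneq (dot f g) 0; first by rewrite expr0n mulr_ge0// dot_ge0.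
  have := pos (- (dot f f + 1) / (2 * dot f g)).
  rewrite g0 mulr0 addr0 -mulrA [2 * (_ * _)]mulrA.
  have -> : 2 * (- (dot f f + 1) / (2 * dot f g)) * dot f g = - (dot f f + 1).
    by field.
  by lra.
have gp : 0 < dot g g by rewrite lt_def g0 dot_ge0.
have := pos (- (dot f g / dot g g)).
have -> : dot f f + 2 * - (dot f g / dot g g) * dot f g
    + (- (dot f g / dot g g)) ^+ 2 * dot g g = dot f f - dot f g ^+ 2 / dot g g.
  by field.
by rewrite subr_ge0 ler_pdivrMr.
Qed.

Lemma dot_le f g : L2 f -> L2 g -> `|dot f g| <= nrm f * nrm g.
Proof.
move=> Lf Lg; rewrite -sqrtrM ?dot_ge0// -sqrtr_sqr ler_wsqrtr//.
exact: dot_sqr_le.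
Qed.

Lemma nrm_le c f g : L2 f -> L2 g -> 0 <= c -> (forall x, `|f x| <= c * `|g x|) ->
  nrm f <= c * nrm g.
Proof.
move=> Lf Lg c0 fg.
rewrite -(@ger0_norm _ c)// -sqrtr_sqr -sqrtrM ?sqr_ge0// ler_wsqrtr//.
rewrite /dot -intZ; last exact: L2M.
apply: le_int; [exact: L2M|exact/L1Z/L2M|move=> x].
rewrite -!expr2 -(real_normK (num_real (f x))) -(real_normK (num_real (g x))).
by rewrite -exprMn lerXn2r ?nnegrE// mulr_ge0.
Qed.

Lemma nrm_indic A : measurable A -> nrm \1_A = Num.sqrt (fine (mu A)).
Proof.
move=> mA; congr Num.sqrt; rewrite -int_indic//; apply: eq_int => x.
by rewrite indicM indicE; case: (_ \in _).
Qed.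

Lemma nrm_restr A f : measurable A -> L2 f -> nrm (fun x => \1_A x * f x) <= nrm f.
Proof.
move=> mA Lf; rewrite -[leRHS]mul1r; apply: nrm_le => //; first exact: L2_restr.
by move=> x; rewrite normrM ler_wpM2r// indic_norm.
Qed.

Lemma nrmD f g : L2 f -> L2 g -> nrm (fun x => f x + g x) <= nrm f + nrm g.
Proof.
move=> Lf Lg; rewrite -(@ler_pXn2r _ 2)// ?nnegrE ?addr_ge0 ?nrm_ge0//.
rewrite nrm2 dotDl// ?dotDr//; [|exact: L2D..].
rewrite (dotC g f) sqrrD !nrm2.
have := le_trans (ler_norm _) (dot_le Lf Lg); lra.
Qed.

Lemma nrmZ c f : L2 f -> nrm (fun x => c * f x) = `|c| * nrm f.
Proof.
move=> Lf; rewrite -sqrtr_sqr -sqrtrM ?sqr_ge0//; congr Num.sqrt.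
have Lc := L2Z c Lf; rewrite (dotZl c Lf Lc) (dotC f) (dotZl c Lf Lf).
by rewrite mulrA -expr2.
Qed.

Lemma nrmN f : nrm (fun x => - f x) = nrm f.
Proof. by congr Num.sqrt; apply: eq_int => x; rewrite mulrNN. Qed.

Lemma nrmB f g : L2 f -> L2 g -> nrm (fun x => f x - g x) <= nrm f + nrm g.
Proof. by move=> Lf Lg; rewrite -(nrmN g); apply: nrmD => //; exact: L2N. Qed.

Lemma L2_L1 A f : measurable A -> (mu A < +oo)%E -> L2 f ->
  (forall x, ~ A x -> f x = 0) -> L1 f.
Proof.
move=> mA Afin Lf fA; have := L2M (L2_indic mA Afin) Lf.
congr (L1 _); apply/funext => x; rewrite indicM; case: ifPn => // xA.
by rewrite fA//; move: xA; rewrite notin_setE.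
Qed.

Lemma int_norm_le A f : measurable A -> (mu A < +oo)%E -> L2 f ->
  (forall x, ~ A x -> f x = 0) ->
  \int[mu]_x `|f x| <= Num.sqrt (fine (mu A)) * nrm f.
Proof.
move=> mA Afin Lf fA.
have Lnf : L2 (fun x => `|f x|).
  case: Lf => mf f2; split; first exact: measurableT_comp.
  by move: f2; congr (L1 _); apply/funext => x; rewrite real_normK ?num_real.
have -> : nrm f = nrm (fun x => `|f x|).
  by congr Num.sqrt; apply: eq_int => x; rewrite -!expr2 real_normK ?num_real.
have -> : \int[mu]_x `|f x| = dot \1_A (fun x => `|f x|).
  apply: eq_int => x; rewrite indicM; case: ifPn => // xA.
  by rewrite fA ?normr0//; move: xA; rewrite notin_setE.
rewrite (le_trans (ler_norm _))// (le_trans (dot_le (L2_indic mA Afin) Lnf))//.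
by rewrite nrm_indic.
Qed.

End L2.

(** * Invariance of the integral under translations and reflection *)

Section Invariance.
Context {R : realType}.
Implicit Types (f g : R -> R) (t : R).
Notation mu := (@lebesgue_measure R).

Lemma intE f : L1 f -> (\int[mu]_x (f x)%:E = (\int[mu]_x f x)%:E)%E.
Proof. by move=> If; rewrite /Rintegral fineK//; exact: integrable_fin_num. Qed.

(** Half-open intervals determine Lebesgue measure, so [phi] pushes [mu] forward to itself, and the
    change of variables formula for image measures applies. *)
Lemma L1_int_comp (phi : R -> R) : measurable_fun setT phi ->
    (forall a b, mu (phi @^-1` [set` `]a, b]]) = mu [set` `]a, b]]) ->
  forall f, L1 f -> L1 (f \o phi) /\ \int[mu]_x f (phi x) = \int[mu]_x f x.
Proof.
move=> mphi phiE f If.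
pose phi' : measurableTypeR R -> measurableTypeR R := phi.
have mphi' : measurable_fun setT phi' by [].
have pE A : measurable A -> mu A = pushforward mu phi' A.
  move=> mA; apply: lebesgue_measure_unique => // X [[a b]] _ <-.
  by rewrite /pushforward -phiE.
have mf := L1_measurable If.
have If' : L1 (f \o phi).
  apply/integrableP; split.
    by apply/measurable_EFinP; exact: measurableT_comp.
  move/integrableP : If => [_]; apply: le_lt_trans.
  have := @ge0_integral_pushforward _ _ _ _ _ phi' mphi' mu setT
    (fun x => `|(f x)%:E|)%E measurableT.
  rewrite preimage_setT => <-//.
    rewrite le_eqVlt; apply/orP; left; apply/eqP.
    by apply: eq_measure_integral => A mA _; first [exact: pE|exact: (esym (pE _ _))].
  by do 2 apply: measurableT_comp => //.
split => //; rewrite /Rintegral; congr fine.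
have := @integral_pushforward _ _ _ _ _ phi' mphi' mu setT (EFin \o f).
rewrite preimage_setT => <-//; last exact/measurable_EFinP.
by apply: eq_measure_integral => A mA _; first [exact: pE|exact: (esym (pE _ _))].
Qed.

Lemma L1_int_shift t f : L1 f ->
  L1 (fun x => f (x + t)) /\ \int[mu]_x f (x + t) = \int[mu]_x f x.
Proof.
apply: L1_int_comp; first exact: measurable_funD.
move=> a b; have -> : (fun x => x + t) @^-1` [set` `]a, b]] = [set` `]a - t, b - t]].
  by apply/seteqP; split=> x /=; rewrite !in_itv /=; lra.
rewrite !lebesgue_measure_itv /= !lte_fin ltrD2r; case: ifP => // _.
by rewrite -!EFinB; congr (_%:E); ring.
Qed.

Lemma L1_int_opp f : L1 f ->
  L1 (fun x => f (- x)) /\ \int[mu]_x f (- x) = \int[mu]_x f x.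
Proof.
apply: L1_int_comp; first exact: oppr_measurable.
move=> a b; have -> : -%R @^-1` [set` `]a, b]] = [set` `[(- b), (- a)[].
  by apply/seteqP; split=> x /=; rewrite !in_itv /=; lra.
rewrite !lebesgue_measure_itv /= !lte_fin ltrN2; case: ifP => // _.
by rewrite -!EFinB; congr (_%:E); ring.
Qed.

Lemma L2_shift t f : L2 f -> L2 (fun x => f (x + t)).
Proof.
move=> [mf f2]; split; first by apply: (measurableT_comp mf); exact: measurable_funD.
exact: (L1_int_shift t f2).1.
Qed.

Lemma L2_opp f : L2 f -> L2 (fun x => f (- x)).
Proof.
move=> [mf f2]; split; first by apply: (measurableT_comp mf); exact: oppr_measurable.
exact: (L1_int_opp f2).1.
Qed.

Lemma dot_shift t f g : L2 f -> L2 g ->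
  dot (fun x => f (x + t)) (fun x => g (x + t)) = dot f g.
Proof. by move=> Lf Lg; have [_] := L1_int_shift t (L2M Lf Lg). Qed.

Lemma dot_opp f g : L2 f -> L2 g ->
  dot (fun x => f (- x)) (fun x => g (- x)) = dot f g.
Proof. by move=> Lf Lg; have [_] := L1_int_opp (L2M Lf Lg). Qed.

Lemma nrm_shift t f : L2 f -> nrm (fun x => f (x + t)) = nrm f.
Proof. by move=> Lf; rewrite /nrm dot_shift. Qed.

Lemma nrm_opp f : L2 f -> nrm (fun x => f (- x)) = nrm f.
Proof. by move=> Lf; rewrite /nrm dot_opp. Qed.

End Invariance.

(** * Functions of bounded support, on which the transforms converge absolutely *)

Section BoundedSupport.
Context {R : realType}.
Implicit Types (f g : R -> R) (r : R).
Notation mu := (@lebesgue_measure R).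

(** Half-open, so that boxes and shells are exact disjoint unions of the half-open cells used for
    sampling. *)
Definition box r : set R := [set` `[- r, r[].

Lemma boxE r x : box r x <-> - r <= x < r.
Proof. by rewrite /box /= in_itv /=. Qed.

Lemma in_box r x : (x \in box r) = (- r <= x < r).
Proof. by apply/idP/idP => [/set_mem/boxE|/boxE/mem_set]. Qed.

Lemma measurable_box r : measurable (box r).
Proof. exact: measurable_itv. Qed.

Lemma mu_itv (b0 b1 : bool) (a b : R) : a <= b ->
  mu [set` Interval (BSide b0 a) (BSide b1 b)] = (b - a)%:E.
Proof.
move=> ab; rewrite lebesgue_measure_itv /= lte_fin lt_neqAle ab andbT.
by case: eqVneq => [->|_]; rewrite ?subrr.
Qed.

Lemma mu_box r : 0 <= r -> mu (box r) = (2 * r)%:E.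
Proof. by move=> r0; rewrite mu_itv; [congr (_%:E); ring|lra]. Qed.

Lemma mu_box_lty r : (mu (box r) < +oo)%E.
Proof.
rewrite lebesgue_measure_itv /=; case: ifP => _; last exact: ltry.
by rewrite -EFinB ltry.
Qed.

Definition bsupp f := exists2 r, 0 <= r & forall x, ~ box r x -> f x = 0.

Definition bL2 f := L2 f /\ bsupp f.

Lemma bL2_L2 f : bL2 f -> L2 f. Proof. by case. Qed.

Lemma bL2_L1 f : bL2 f -> L1 f.
Proof.
by move=> [Lf [r _ fr]]; apply: L2_L1 Lf fr; [exact: measurable_box|exact: mu_box_lty].
Qed.

Lemma box_le r s x : r <= s -> box r x -> box s x.
Proof. by move=> rs /boxE rx; apply/boxE; lra. Qed.

Lemma bL2D f g : bL2 f -> bL2 g -> bL2 (fun x => f x + g x).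
Proof.
move=> [Lf [r r0 fr]] [Lg [s s0 gs]]; split; first exact: L2D.
exists (r + s); first exact: addr_ge0.
move=> x xrs; rewrite fr ?gs ?addr0//.
  by apply: contra_not xrs; apply: box_le; lra.
by apply: contra_not xrs; apply: box_le; lra.
Qed.

Lemma bL2Mb c f g : measurable_fun setT g -> (forall x, `|g x| <= c) -> bL2 f ->
  bL2 (fun x => g x * f x).
Proof.
move=> mg gc [Lf [r r0 fr]]; split; first exact: L2Mb gc Lf.
by exists r => // x xr; rewrite fr ?mulr0.
Qed.

Lemma bL2Z c f : bL2 f -> bL2 (fun x => c * f x).
Proof. by apply: (@bL2Mb `|c| f (cst c)) => //; exact: measurable_cst. Qed.

Lemma bL2_indicM (A : set R) f : measurable A -> bL2 f -> bL2 (fun x => \1_A x * f x).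
Proof.
move=> mA; apply: (@bL2Mb 1); first exact: measurable_indic.
by move=> x; exact: indic_norm.
Qed.

Lemma bL2_shift t f : bL2 f -> bL2 (fun x => f (x + t)).
Proof.
move=> [Lf [r r0 fr]]; split; first exact: L2_shift.
exists (r + `|t|); first by rewrite addr_ge0.
move=> x xrt; rewrite fr//; apply: contra_not xrt => /boxE rxt; apply/boxE.
have := ler_norm t; have := ler_norm (- t); rewrite normrN; lra.
Qed.

Lemma bL2_opp f : bL2 f -> bL2 (fun x => f (- x)).
Proof.
move=> [Lf [r r0 fr]]; split; first exact: L2_opp.
(* The reflection of a half-open box is closed at the other end, so [r] itself would miss the point
   [r]. *)
exists (r + 1); first by rewrite addr_ge0.
move=> x xr; rewrite fr//; apply: contra_not xr => /boxE rx; apply/boxE; lra.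
Qed.

End BoundedSupport.

(** * Cosine and sine transforms of integrable functions *)

Section Transform.
Context {R : realType}.
Implicit Types (phi f g : R -> R).
Notation mu := (@lebesgue_measure R).

(** For real [f], the choices [cos] and [sin] give the real part and the opposite of the imaginary
    part of the Fourier transform. *)
Definition trans phi f x : R := \int[mu]_y (phi (2 * pi * x * y) * f y).

Definition kern phi := continuous phi /\ forall x, `|phi x| <= 1 :> R.

Lemma kern_cos : kern cos.
Proof. by split; [exact: continuous_cos|exact: cos_max]. Qed.

Lemma kern_sin : kern sin.
Proof. by split; [exact: continuous_sin|exact: sin_max]. Qed.

Lemma kern_measurable phi x : kern phi ->
  measurable_fun setT (fun y => phi (2 * pi * x * y)).
Proof.
move=> [cphi _]; apply: measurableT_comp.
  exact: continuous_measurable_fun.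
exact: mulrl_measurable.
Qed.

Lemma kern_measurable2 phi : kern phi ->
  measurable_fun [set: R * R] (fun xy => phi (2 * pi * xy.1 * xy.2)).
Proof.
move=> [cphi _]; apply: (measurableT_comp (continuous_measurable_fun cphi)).
apply: measurable_funM => //; apply: measurable_funM => //.
Qed.

Lemma L1Mb f g : L1 f -> measurable_fun setT g -> (forall x, `|g x| <= 1) ->
  L1 (fun x => g x * f x).
Proof.
move=> If mg g1; apply: (L1_le _ If).
  by apply: measurable_funM => //; exact: L1_measurable.
by move=> x; rewrite normrM ler_piMl.
Qed.

Lemma L1Mbc c f g : L1 f -> measurable_fun setT g -> (forall x, `|g x| <= c) ->
  L1 (fun x => g x * f x).
Proof.
move=> If mg gc; apply: (L1_le _ (L1Z c If)).
  by apply: measurable_funM => //; exact: L1_measurable.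
by move=> x; rewrite !normrM ler_wpM2r// (le_trans (gc x))// ler_norm.
Qed.

Lemma trans_L1 phi f x : kern phi -> L1 f -> L1 (fun y => phi (2 * pi * x * y) * f y).
Proof.
move=> kphi If; apply: L1Mb => //; first exact: kern_measurable.
by move=> y; exact: kphi.2.
Qed.

Lemma trans_le phi f x : kern phi -> L1 f ->
  `|trans phi f x| <= \int[mu]_y `|f y|.
Proof.
move=> kphi If; have Ik := trans_L1 x kphi If.
rewrite (le_trans (int_norm Ik))//; apply: le_int => [||y]; [exact: L1_norm..|].
by rewrite normrM ler_piMl// kphi.2.
Qed.

Lemma transD phi f g x : kern phi -> L1 f -> L1 g ->
  trans phi (fun y => f y + g y) x = trans phi f x + trans phi g x.
Proof.
move=> kphi If Ig; rewrite /trans -intD; [|exact: trans_L1..].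
by apply: eq_int => y; rewrite mulrDr.
Qed.

Lemma transZ phi c f x : kern phi -> L1 f ->
  trans phi (fun y => c * f y) x = c * trans phi f x.
Proof.
move=> kphi If; rewrite /trans -intZ; last exact: trans_L1.
by apply: eq_int => y; rewrite mulrCA.
Qed.

Lemma transB phi f g x : kern phi -> L1 f -> L1 g ->
  trans phi (fun y => f y - g y) x = trans phi f x - trans phi g x.
Proof.
move=> kphi If Ig; rewrite /trans -intB; [|exact: trans_L1..].
by apply: eq_int => y; rewrite mulrBr.
Qed.

Lemma trans_measurable phi f : kern phi -> measurable_fun setT f ->
  measurable_fun setT (trans phi f).
Proof.
move=> kphi mf; rewrite /trans /Rintegral.
pose F (xy : R * R) := (phi (2 * pi * xy.1 * xy.2) * f xy.2)%:E.
have mF : measurable_fun setT F.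
  apply/measurable_EFinP; apply: measurable_funM; first exact: kern_measurable2.
  exact: measurableT_comp.
(* Tonelli gives measurability in the parameter only for nonnegative integrands, hence the split
   into positive and negative parts. *)
have -> : (fun x => fine (\int[mu]_y (phi (2 * pi * x * y) * f y)%:E)%E) =
    fine \o ((fun x => \int[mu]_y F^\+ (x, y)) \- (fun x => \int[mu]_y F^\- (x, y)))%E.
  apply/funext => x /=; rewrite integralE; congr fine.
  by congr (_ - _)%E; apply: eq_integral => y _; rewrite ?funeposE ?funenegE.
apply: measurableT_comp => //; apply: emeasurable_funB.
  by apply: (@measurable_fun_fubini_tonelli_F _ _ _ _ _ mu _) => //; exact: measurable_funepos.
by apply: (@measurable_fun_fubini_tonelli_F _ _ _ _ _ mu _) => //; exact: measurable_funeneg.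
Qed.

Lemma L1_trans phi f g : kern phi -> L1 f -> L1 g -> L1 (fun x => trans phi f x * g x).
Proof.
move=> kphi If Ig; apply: L1Mbc Ig _ _; last by move=> x; exact: trans_le.
by apply: trans_measurable => //; exact: L1_measurable.
Qed.

(** The kernel is symmetric in its two variables, and Fubini applies since [|f y| * |g x|] is an
    integrable majorant on the plane. *)
Lemma trans_sym phi f g : kern phi -> L1 f -> L1 g ->
  dot (trans phi f) g = dot f (trans phi g).
Proof.
move=> kphi If Ig.
pose F (xy : R * R) := (phi (2 * pi * xy.1 * xy.2) * f xy.2 * g xy.1)%:E.
have mF : measurable_fun setT F.
  have [mf mg] := (L1_measurable If, L1_measurable Ig).
  apply/measurable_EFinP; apply: measurable_funM.
    apply: measurable_funM; first exact: kern_measurable2.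
    exact: measurableT_comp.
  exact: measurableT_comp.
have Fx x : (\int[mu]_y F (x, y) = (trans phi f x * g x)%:E)%E.
  rewrite mulrC -intZ; last exact: trans_L1.
  rewrite -intE; last exact/L1Z/trans_L1.
  by apply: eq_integral => y _; rewrite /F /= mulrC.
have Fy y : (\int[mu]_x F (x, y) = (f y * trans phi g y)%:E)%E.
  rewrite -intZ; last exact: trans_L1.
  rewrite -intE; last exact/L1Z/trans_L1.
  apply: eq_integral => x _; rewrite /F /=; congr (_%:E).
  by rewrite (_ : 2 * pi * x * y = 2 * pi * y * x); ring.
have IF : (mu \x mu)%E.-integrable setT F.
  apply/integrable12ltyP => //.
  apply: (@le_lt_trans _ _ (\int[mu]_x (\int[mu]_y `|f y| * `|g x|)%:E)%E); last first.
    by rewrite intE ?ltry//; apply/L1Z/L1_norm.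
  apply: ge0_le_integral => //.
  - by move=> x _; exact: integral_ge0.
  - apply: (@measurable_fun_fubini_tonelli_F _ _ _ _ _ mu (fun z => `|F z|%E)) => //.
    exact: measurableT_comp.
  - apply/measurable_EFinP; apply: measurable_funM => //.
    by apply: measurableT_comp => //; exact: L1_measurable.
  - move=> x _; rewrite mulrC -intZ; last exact: L1_norm.
    rewrite -intE; last by apply/L1Z/L1_norm.
    apply: ge0_le_integral => //.
    + apply: measurableT_comp => //; apply: (measurableT_comp mF).
      exact: measurable_pair1.
    + apply/measurable_EFinP; apply: measurable_funM => //.
      by apply: measurableT_comp => //; exact: L1_measurable.
    + move=> y _; rewrite /F /= lee_fin !normrM mulrC ler_wpM2l//.
      by rewrite ler_piMl// kphi.2.
rewrite /dot /Rintegral; congr fine.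
under eq_integral do rewrite -Fx.
under [RHS]eq_integral do rewrite -Fy.
exact: Fubini.
Qed.

End Transform.

(** * Cosine polynomials *)

Section Trig.
Context {R : realType}.
Implicit Types (r t a b c d : R).
Notation mu := (@lebesgue_measure R).

Lemma is_derive_sin_scaled c (y : R) : c != 0 ->
  is_derive y 1 (fun y : R => sin (c * y) / c) (cos (c * y)).
Proof.
move=> c0.
have d1 : is_derive y 1 (fun y : R => c * y) c.
  have := is_deriveM (is_derive_cst c y 1) (is_derive_id y 1).
  by move=> /is_derive_eq; apply; rewrite /GRing.scale /= mulr1 mulr0 addr0.
have d2 : is_derive y 1 (fun y => sin (c * y)) (cos (c * y) * c).
  exact: (@is_derive1_comp _ sin (fun y => c * y) y _ _ _ d1).
have := is_deriveM d2 (is_derive_cst c^-1 y 1).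
by move=> /is_derive_eq; apply; rewrite /GRing.scale /= mulr0 add0r; field.
Qed.

Lemma int_cos_box c r : c != 0 -> 0 < r ->
  \int[mu]_y (\1_(box r) y * cos (c * y)) = 2 * sin (c * r) / c.
Proof.
move=> c0 r0.
pose F (y : R) := sin (c * y) / c.
have dF (y : R) : is_derive y 1 F (cos (c * y)) by exact: is_derive_sin_scaled.
have cF : continuous F.
  move=> y; apply: differentiable_continuous; apply/derivable1_diffP.
  exact: (@ex_derive _ _ _ _ _ _ _ (dF y)).
have cc : continuous (fun y : R => cos (c * y)).
  move=> y; apply: (@continuous_comp _ _ _ (fun y => c * y) cos).
    exact: mulrl_continuous.
  exact: continuous_cos.
have rr : - r < r by lra.
have FTC : (\int[mu]_(y in [set` `[(- r)%R, r%R]]) (cos (c * y))%:E = (F r)%:E - (F (- r)%R)%:E)%E.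
  apply: continuous_FTC2 => //.
  - by apply: continuous_in_subspaceT => y _; exact: cc.
  - split.
    + by move=> y _; exact: (@ex_derive _ _ _ _ _ _ _ (dF y)).
    + by apply: cvg_at_right_filter; exact: cF.
    + by apply: cvg_at_left_filter; exact: cF.
  - by move=> y _; rewrite derive1E; exact: (@derive_val _ _ _ _ _ _ _ (dF y)).
have -> : 2 * sin (c * r) / c = F r - F (- r).
  by rewrite /F mulrN sinN; field.
have -> : \int[mu]_y (\1_(box r) y * cos (c * y)) =
    \int[mu]_(y in [set` `[(- r), r[]) cos (c * y).
  by rewrite [RHS]Rintegral_mkcond; apply: eq_Rintegral => y _; rewrite indicM patchE.
rewrite Rintegral_itv_bndo_bndc; first by rewrite /Rintegral FTC.
have : mu.-integrable [set` `[(- r), r]] (EFin \o (fun x : R => cos (c * x))).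
  apply: continuous_compact_integrable; first exact: segment_compact.
  by apply: continuous_in_subspaceT => y _; exact: cc.
apply: integrableS; [exact: measurable_itv|exact: measurable_itv|].
by apply: subset_itvl; rewrite bnd_simp.
Qed.

Lemma sin_pi_nat (n : nat) : sin (n%:R * pi) = 0 :> R.
Proof.
elim: n => [|n IHn]; first by rewrite mul0r sin0.
by rewrite -natr1 mulrDl mul1r sinDpi IHn oppr0.
Qed.

Lemma sin_pi_int (k : int) : sin (k%:~R * pi) = 0 :> R.
Proof.
case: k => n; first exact: sin_pi_nat.
by rewrite NegzE mulrNz mulNr sinN sin_pi_nat oppr0.
Qed.

Lemma cos_scaled_measurable c : measurable_fun setT (fun y : R => cos (c * y)).
Proof.
apply: measurableT_comp; first by apply: continuous_measurable_fun; exact: continuous_cos.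
exact: mulrl_measurable.
Qed.

Definition cosint r c : R := \int[mu]_y (\1_(box r) y * cos (c * y)).

Lemma cosint0 r : 0 <= r -> cosint r 0 = 2 * r.
Proof.
move=> r0; rewrite /cosint.
transitivity (\int[mu]_y (\1_(box r) y : R)).
  by apply: eq_int => y; rewrite mul0r cos0 mulr1.
by rewrite int_indic ?mu_box//; exact: measurable_box.
Qed.

Lemma cosint_le r c : c != 0 -> 0 < r -> `|cosint r c| <= 2 / `|c|.
Proof.
move=> c0 r0; rewrite /cosint int_cos_box// normrM normfV ler_wpM2r ?invr_ge0//.
by rewrite normrM ger0_norm// ler_piMr// sin_max.
Qed.

Lemma cosint_mesh d (k : int) : 0 < d ->
  cosint (1 / (2 * d)) (2 * pi * (k%:~R * d)) = (if k == 0 then 1 / d else 0).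
Proof.
move=> d0; have d2 : 0 < 1 / (2 * d) by rewrite divr_gt0 ?mulr_gt0.
case: eqVneq => [->|k0].
  by rewrite mul0r mulr0 cosint0 ?(ltW d2)//; field; rewrite gt_eqF.
rewrite /cosint int_cos_box//; last first.
  by rewrite !mulf_neq0// ?intr_eq0// lt0r_neq0// pi_gt0.
have -> : 2 * pi * (k%:~R * d) * (1 / (2 * d)) = k%:~R * pi.
  by field; rewrite gt_eqF.
by rewrite sin_pi_int mulr0 mul0r.
Qed.

Definition gram r a b : R :=
  \int[mu]_y (\1_(box r) y * (cos (2 * pi * a * y) * cos (2 * pi * b * y))).

Lemma L1_box_bounded r (f : R -> R) c : measurable_fun setT f ->
  (forall x, `|f x| <= c) -> L1 (fun y => \1_(box r) y * f y).
Proof.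
move=> mf fc; have : L1 (\1_(box r) : R -> R).
  by apply: L1_indic; [exact: measurable_box|exact: mu_box_lty].
move=> /L1Mbc => /(_ c f mf fc); congr (L1 _); apply/funext => y.
by rewrite mulrC.
Qed.

Lemma gramE r a b :
  gram r a b = (cosint r (2 * pi * (a - b)) + cosint r (2 * pi * (a + b))) / 2.
Proof.
have Ic c : L1 (fun y => \1_(box r) y * cos (c * y)).
  by apply: (@L1_box_bounded _ _ 1); [exact: cos_scaled_measurable|move=> x; exact: cos_max].
rewrite /cosint -intD// mulrC -intZ; last exact: L1D.
apply: eq_int => y; rewrite -mulrDr [RHS]mulrCA; congr (_ * _).
have -> : 2 * pi * (a - b) * y = 2 * pi * a * y - 2 * pi * b * y by ring.
have -> : 2 * pi * (a + b) * y = 2 * pi * a * y + 2 * pi * b * y by ring.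
by rewrite cosB cosD; field.
Qed.

Lemma gram_mesh d (m n : int) : 0 < d ->
  gram (1 / (2 * d)) (m%:~R * d) (n%:~R * d) = ((m == n)%:R + (m == - n)%:R) / (2 * d).
Proof.
move=> d0; rewrite gramE -mulrBl -mulrDl -intrB -intrD !cosint_mesh//.
rewrite subr_eq0 addr_eq0.
by case: (m == n); case: (m == - n); rewrite /= ?mulr1n ?mulr0n; field; rewrite gt_eqF.
Qed.

(** The product formula leaves the frequencies [a - b] and [a + b], both at least [D] in absolute
    value; integrating a cosine of such a frequency gives a bound that does not depend on [r]. *)
Lemma gram_far r a b D : 0 < r -> 0 < D -> `|a| + D <= `|b| -> `|gram r a b| <= 1 / D.
Proof.
move=> r0 D0 abD; rewrite gramE normrM [`|2^-1|]ger0_norm ?invr_ge0//.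
have I t : D <= `|t| -> `|cosint r (2 * pi * t)| <= 1 / D.
  move=> Dt; have t0 : t != 0 by rewrite -normr_gt0; lra.
  have c0 : 2 * pi * t != 0 by rewrite !mulf_neq0// gt_eqF// pi_gt0.
  rewrite (le_trans (cosint_le c0 r0))//.
  have -> : `|2 * pi * t| = 2 * pi * `|t|.
    by rewrite !normrM (ger0_norm (@pi_ge0 R)) ger0_norm.
  have p2 := @pi_ge2 R; rewrite ler_pdivrMr; last by nra.
  by rewrite mulrAC ler_pdivlMr// mul1r; nra.
have h1 := I (a - b); have h2 := I (a + b).
have := lerB_dist b a; have := lerB_dist b (- a); rewrite normrN opprK distrC (addrC b).
move=> n1 n2; have {}h1 := h1 ltac:(lra); have {}h2 := h2 ltac:(lra).
by have := ler_normD (cosint r (2 * pi * (a - b))) (cosint r (2 * pi * (a + b))); lra.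
Qed.

Definition cospoly (I : finType) (k x : I -> R) (y : R) : R :=
  \sum_i k i * cos (2 * pi * x i * y).

Lemma cospoly_measurable (I : finType) (k x : I -> R) :
  measurable_fun setT (cospoly k x).
Proof.
apply: measurable_sum => i; apply: measurable_funM; first exact: measurable_cst.
exact: cos_scaled_measurable.
Qed.

Lemma cospoly_le (I : finType) (k x : I -> R) y :
  `|cospoly k x y| <= \sum_i `|k i|.
Proof.
rewrite (le_trans (ler_norm_sum _ _ _))//; apply: ler_sum => i _.
by rewrite normrM ler_piMr// cos_max.
Qed.

Lemma int_cospolyM (I J : finType) (k x : I -> R) (l z : J -> R) r :
  \int[mu]_y (\1_(box r) y * (cospoly k x y * cospoly l z y)) =
  \sum_i \sum_j k i * l j * gram r (x i) (z j).
Proof.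
have Ic i j : L1 (fun y => \1_(box r) y *
    (cos (2 * pi * x i * y) * cos (2 * pi * z j * y))).
  apply: (@L1_box_bounded _ _ 1).
    by apply: measurable_funM; exact: cos_scaled_measurable.
  by move=> y; rewrite normrM mulr_ile1 ?cos_max.
transitivity (\int[mu]_y (\sum_i \sum_j k i * l j * (\1_(box r) y *
    (cos (2 * pi * x i * y) * cos (2 * pi * z j * y))))).
  apply: eq_int => y; rewrite /cospoly mulr_suml mulr_sumr; apply: eq_bigr => i _.
  by rewrite !mulr_sumr; apply: eq_bigr => j _; ring.
rewrite int_sum; last by move=> i _; apply: L1_sum => j _; exact: L1Z.
apply: eq_bigr => i _; rewrite int_sum; last by move=> j _; exact: L1Z.
by apply: eq_bigr => j _; rewrite intZ.
Qed.

(** Schur's test: [|x i| * |x j|] is at most the mean of the two squares, and each half is summed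
    along a row or a column of [k]. *)
Lemma schur (I : finType) (K k : I -> I -> R) (x : I -> R) M :
    (forall i j, `|K i j| <= k i j * `|x i| * `|x j|) ->
    (forall i j, 0 <= k i j) ->
    (forall i, \sum_j k i j <= M) -> (forall j, \sum_i k i j <= M) ->
  \sum_i \sum_j K i j <= M * \sum_i x i ^+ 2.
Proof.
move=> Kk k0 M1 M2.
have le1 i j : K i j <= (k i j * x i ^+ 2 + k i j * x j ^+ 2) / 2.
  rewrite (le_trans (ler_norm _))// (le_trans (Kk i j))//.
  rewrite -(real_normK (num_real (x i))) -(real_normK (num_real (x j))).
  by have := k0 i j; have := sqr_ge0 (`|x i| - `|x j|); nra.
apply: (@le_trans _ _ (\sum_i \sum_j (k i j * x i ^+ 2 + k i j * x j ^+ 2) / 2)).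
  by apply: ler_sum => i _; apply: ler_sum => j _.
under eq_bigr do rewrite -mulr_suml big_split /= -mulr_suml.
rewrite -mulr_suml big_split /= [X in _ + X]exchange_big /=.
under [X in _ + X]eq_bigr do rewrite -mulr_suml.
have : \sum_i (\sum_j k i j) * x i ^+ 2 <= M * \sum_i x i ^+ 2.
  by rewrite mulr_sumr; apply: ler_sum => i _; rewrite ler_wpM2r ?sqr_ge0.
have : \sum_i (\sum_j k j i) * x i ^+ 2 <= M * \sum_i x i ^+ 2.
  by rewrite mulr_sumr; apply: ler_sum => i _; rewrite ler_wpM2r ?sqr_ge0.
by lra.
Qed.

Lemma sum_eq_le1 (I : finType) (T : eqType) (f : I -> T) (t : T) : injective f ->
  \sum_i ((t == f i)%:R : R) <= 1.
Proof.
move=> f_inj; have [/existsP[i /eqP ti]|/existsPn nt] := boolP [exists i, t == f i].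
  rewrite (bigD1 i)//= ti eqxx big1 ?addr0// => j ji.
  by rewrite (inj_eq f_inj) eq_sym (negPf ji).
by rewrite big1 ?ler01// => i _; rewrite (negPf (nt i)).
Qed.

(* Orthogonality of the characters of the period [1 / d]. *)
Lemma cospoly_parseval (I : finType) (k : I -> R) (m : I -> int) d :
    injective m -> 0 < d ->
  \int[mu]_y (\1_(box (1 / (2 * d))) y * cospoly k (fun i => (m i)%:~R * d) y ^+ 2)
  <= 1 / d * \sum_i k i ^+ 2.
Proof.
move=> m_inj d0.
rewrite [leLHS](int_cospolyM k _ k).
(* A cosine only meets its own frequency and the opposite one. As [m] is injective, each occurs at
   most once, so row and column sums are at most [2 / (2 * d)]. *)
apply: (@schur _ _ (fun i j => ((m i == m j)%:R + (m i == - m j)%:R) / (2 * d))).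
- move=> i j; rewrite gram_mesh// normrM normrM [X in _ * X <= _]ger0_norm.
    by rewrite mulrC mulrA.
  by rewrite divr_ge0 ?addr_ge0// mulr_ge0// ltW.
- by move=> i j; rewrite divr_ge0 ?addr_ge0// mulr_ge0// ltW.
- move=> i; rewrite -mulr_suml big_split /= ler_pdivrMr ?mulr_gt0//.
  have := sum_eq_le1 (m i) m_inj.
  have := @sum_eq_le1 _ _ (fun j => - m j) (m i) (inj_comp (@oppr_inj _) m_inj).
  have -> : 1 / d * (2 * d) = 2 by field; rewrite gt_eqF.
  by lra.
- move=> j; rewrite -mulr_suml; under eq_bigr => i _.
    rewrite (eq_sym (m i) (m j)) (eq_sym (m i)) eqr_oppLR.
    over.
  rewrite big_split /= ler_pdivrMr ?mulr_gt0//.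
  have := sum_eq_le1 (m j) m_inj.
  have := @sum_eq_le1 _ _ (fun j => - m j) (m j) (inj_comp (@oppr_inj _) m_inj).
  have -> : 1 / d * (2 * d) = 2 by field; rewrite gt_eqF.
  by lra.
Qed.

(** One of the two truncated subtractions vanishes, so the exponent is the distance of [i] and [j].
    The sum is followed up to [i] ([small]) and beyond ([large]). *)
Lemma sum_half_dist (i n : nat) :
  \sum_(j < n) (2 ^- (i - j + (j - i)) : R) <= 3.
Proof.
pose f n := \sum_(j < n) (2 ^- (i - j + (j - i)) : R).
have fS m : f m.+1 = f m + 2 ^- (i - m + (m - i)) by rewrite /f big_ord_recr.
have p2 m : 2 ^- m = 2 * 2 ^- m.+1 :> R by rewrite exprS; field; rewrite expf_neq0.
have small m : (m <= i.+1)%N -> f m <= 2 * 2 ^- (i.+1 - m).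
  elim: m => [_|m IH mi]; first by rewrite /f big_ord0 mulr_ge0.
  rewrite fS; have := IH (ltnW mi); rewrite subSS subSn// (_ : m - i = 0)%N ?addn0; last lia.
  by have := p2 (i - m)%N; lra.
have large m : f (i.+1 + m)%N <= 3 - 2 ^- m.
  elim: m => [|m IH]; first by rewrite addn0 (le_trans (small _ _))// subnn; lra.
  rewrite addnS fS (_ : i - _ + _ = m.+1)%N; last lia.
  by have := p2 m; lra.
case: (leqP n i.+1) => ni.
  rewrite (le_trans (small _ ni))//; have : 2 ^- (i.+1 - n) <= 1 :> R.
    by rewrite invf_le1 ?exprn_gt0// exprn_ege1// ler1n.
  by lra.
have := large (n - i.+1)%N; rewrite subnKC; last lia.
by have : 0 <= 2 ^- (n - i.+1) :> R by []; rewrite /f; lra.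
Qed.

End Trig.

(** * Two-sided estimates for differences of cosines *)

Section TrigIneq.
Context {R : realType}.
Implicit Types (x a b : R).

Lemma sin_MVT x : 0 < x -> exists2 c, 0 < c < x & sin x = cos c * x :> R.
Proof.
move=> x0.
have cs : {within [set` `[0, x]], continuous (@sin R)}.
  by apply: continuous_in_subspaceT => y _; exact: continuous_sin.
have [c] := @MVT R sin cos 0 x x0 (fun y _ => is_derive_sin y) cs.
by rewrite in_itv /= sin0 !subr0 => c0x sE; exists c.
Qed.

Lemma norm_sin_le x : `|sin x| <= `|x|.
Proof.
have pos (y : R) : 0 < y -> `|sin y| <= y.
  move=> y0; have [c _ ->] := sin_MVT y0.
  by rewrite normrM (gtr0_norm y0) ler_piMl ?(ltW y0)// cos_max.
have [x0|x0|->] := ltgtP x 0; last by rewrite sin0.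
  have nx : 0 < - x by rewrite oppr_gt0.
  by rewrite -(normrN x) (gtr0_norm nx) -(normrN (sin x)) -sinN pos.
by rewrite (gtr0_norm x0) pos.
Qed.

Lemma sin_ge_half x : 0 <= x <= 1 -> x / 2 <= sin x.
Proof.
case/andP; rewrite le_eqVlt => /predU1P[<-|x0] x1; first by rewrite mul0r sin0.
have [c /andP[c0 cx] ->] := sin_MVT x0.
have -> : cos c = 1 - sin (c / 2) ^+ 2 *+ 2.
  by rewrite sin2cos2 [in LHS](_ : c = (c / 2) *+ 2) ?cos_mulr2n; [ring|rewrite -mulr_natr; field].
have c2 : 0 <= c / 2 by lra.
have := norm_sin_le (c / 2); rewrite (ger0_norm c2) ler_norml => /andP[].
by nra.
Qed.

Lemma cosB_sin a b : cos a - cos b = 2 * sin ((a + b) / 2) * sin ((b - a) / 2).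
Proof.
have {1}-> : a = (a + b) / 2 - (b - a) / 2 by field.
have {3}-> : b = (a + b) / 2 + (b - a) / 2 by field.
by rewrite cosB cosD; ring.
Qed.

Lemma norm_cosB_le a b : `|cos a - cos b| <= `|a - b|.
Proof.
rewrite cosB_sin distrC !normrM (ger0_norm (ler0n _ 2)).
have := norm_sin_le ((b - a) / 2); rewrite normrM [`|2^-1|]ger0_norm ?invr_ge0//.
by have := sin_max ((a + b) / 2); have := normr_ge0 (sin ((b - a) / 2)); nra.
Qed.

(** Bounding by squares makes the estimate scale like [d ^ 2] when [a] and [b] carry a factor [d];
    this cancels against the width [w] in [zfun_close], which becomes independent of [d]. *)
Lemma norm_cosB_le_sqr a b : `|cos a - cos b| <= `|a ^+ 2 - b ^+ 2| / 2.
Proof.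
rewrite cosB_sin !normrM (ger0_norm (ler0n _ 2)).
have := norm_sin_le ((b - a) / 2); have := norm_sin_le ((a + b) / 2).
rewrite !normrM [`|2^-1|]ger0_norm ?invr_ge0// => h1 h2.
rewrite subr_sqr (distrC b) in h2 *; rewrite normrM.
have := normr_ge0 (sin ((b - a) / 2)); have := normr_ge0 (sin ((a + b) / 2)).
move: h1 h2; move: `|sin _| `|sin _| `|_ + _| `|_ - _| => s t u v; nra.
Qed.

Lemma norm_cosB_ge a b : 0 <= a <= 1 -> 0 <= b <= 1 ->
  (a - b) ^+ 2 / 8 <= `|cos a - cos b|.
Proof.
move=> a01 b01.
wlog ab : a b a01 b01 / a <= b.
  move=> H; have [|/ltW ba] := leP a b; first exact: H.
  by rewrite distrC -sqrrN opprB; exact: H.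
have := @sin_ge_half ((a + b) / 2) ltac:(lra).
have := @sin_ge_half ((b - a) / 2) ltac:(lra).
rewrite cosB_sin => h1 h2; rewrite (le_trans _ (ler_norm _))//.
by move: h1 h2; move: (sin _) (sin _) => s t; nra.
Qed.

End TrigIneq.

(** * Functions living on thin sets *)

Section Thin.
Context {R : realType}.
Implicit Types (h k : R -> R) (S : set R) (kap : R) (j : nat) (m : int).
Notation mu := (@lebesgue_measure R).

Definition quad j : R := 4 ^+ j.

(** The sampling error on a shell is of order [quad j.+1 ^ 2 * mesh j], which this rate makes
    summable over [j]. Moreover both radii of the shell are integral multiples of the mesh. *)
Definition mesh j : R := (4 ^+ (4 * j))^-1.

Definition shell j : set R := box (quad j.+1) `\` box (quad j).

Definition cell (d : R) m : set R := [set` `[m%:~R * d, (m + 1)%:~R * d[].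

(* [W] bounds the outer measure of [S] in the cell: [S] need not be measurable. *)
Definition thin kap (j0 : nat) S := forall j m, (j0 <= j)%N ->
  cell (mesh j) m `<=` shell j ->
  exists W : set R, [/\ measurable W, S `&` cell (mesh j) m `<=` W &
    (mu W <= (kap * mesh j)%:E)%E].

Lemma quad_gt0 j : 0 < quad j. Proof. by rewrite exprn_gt0. Qed.

Lemma quad_ge1 j : 1 <= quad j. Proof. by rewrite exprn_ege1// ler1n. Qed.

Lemma quad_le i j : (i <= j)%N -> quad i <= quad j.
Proof. by move=> ij; rewrite ler_weXn2l// ler1n. Qed.

Lemma mesh_gt0 j : 0 < mesh j. Proof. by rewrite invr_gt0 exprn_gt0. Qed.

Lemma quad_mesh j : quad j = (4 ^ (5 * j))%N%:R * mesh j.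
Proof.
by rewrite /quad /mesh natrX (_ : 5 * j = j + 4 * j)%N ?exprD ?mulfK ?expf_neq0//; lia.
Qed.

Lemma cellE (d : R) m x : cell d m x <-> m%:~R * d <= x < m%:~R * d + d.
Proof. by rewrite /cell /= in_itv /= intrD mulrDl mul1r. Qed.

Lemma measurable_cell (d : R) m : measurable (cell d m).
Proof. exact: measurable_itv. Qed.

Lemma in_cell (d : R) m x : (x \in cell d m) = (m%:~R * d <= x < m%:~R * d + d).
Proof. by apply/idP/idP => [/set_mem/cellE|/cellE/mem_set]. Qed.

Lemma indic_cell_sum (d : R) (n : nat) x : 0 < d ->
  \sum_(i < n.*2) (\1_(cell d (i%:Z - n%:Z)) x : R) = \1_(box (n%:R * d)) x.
Proof.
move=> d0.
(* The indicator of a half-open cell is the difference of the indicators of two half-lines, so the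
   sum telescopes. *)
pose f (i : nat) : R := ((i%:R - n%:R) * d <= x)%R%:R.
transitivity (\sum_(0 <= i < n.*2) (f i - f i.+1)).
  rewrite big_mkord; apply: eq_bigr => i _.
  rewrite indicE in_cell /f intrB -natr1 /=.
  have -> : (i%:R + 1 - n%:R) * d = (i%:R - n%:R) * d + d by ring.
  rewrite /= -!pmulrn; have [h1|h1] := leP (((i : nat)%:R - n%:R) * d) x.
    by have [h2|h2] := leP ((i%:R - n%:R) * d + d) x; rewrite ?subrr ?subr0.
  rewrite (_ : (_ + d <= x) = false) ?subrr//; apply/negbTE; rewrite -ltNge; lra.
rewrite -[LHS]opprK -sumrN; under eq_bigr do rewrite opprB.
rewrite telescope_sumr// opprB indicE in_box /f sub0r mulNr.
have -> : (n.*2%:R - n%:R) * d = n%:R * d by rewrite -addnn natrD; ring.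
have nd : 0 <= n%:R * d by rewrite mulr_ge0// ltW.
have [h1|h1] := leP (- (n%:R * d)) x; have [h2|h2] := leP (n%:R * d) x => //=.
- by rewrite subrr.
- by rewrite subr0.
- lra.
- by rewrite subr0.
Qed.

Lemma quadS_mesh j : quad j.+1 = (4 ^ (5 * j).+1)%N%:R * mesh j.
Proof. by rewrite /quad exprS expnS natrM -mulrA -quad_mesh. Qed.

(** Both radii are integral multiples of the mesh, so no cell straddles the inner boundary of the
    shell. *)
Lemma cell_cases j m : - (4 ^ (5 * j).+1)%N%:Z <= m < (4 ^ (5 * j).+1)%N%:Z ->
  cell (mesh j) m `<=` box (quad j) \/
  cell (mesh j) m `<=` shell j /\ quad j <= `|m%:~R * mesh j| <= quad j.+1.
Proof.
set n := (4 ^ (5 * j).+1)%N; set a := (4 ^ (5 * j))%N => /andP[nm mn].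
have d0 := mesh_gt0 j.
have le_mesh (s t : int) : s <= t -> s%:~R * mesh j <= t%:~R * mesh j.
  by move=> st; rewrite ler_pM2r// ler_int.
have qE : quad j = a%:Z%:~R * mesh j by rewrite quad_mesh.
have QE : quad j.+1 = n%:Z%:~R * mesh j by rewrite quadS_mesh.
have m1E : m%:~R * mesh j + mesh j = (m + 1)%:~R * mesh j.
  by rewrite intrD mulrDl mul1r.
have qN : - quad j = (- a%:Z)%:~R * mesh j by rewrite qE mulrNz mulNr.
have QN : - quad j.+1 = (- n%:Z)%:~R * mesh j by rewrite QE mulrNz mulNr.
have := le_mesh _ _ nm; rewrite -QN => QNm.
have /le_mesh : m + 1 <= n%:Z by rewrite lezD1.
rewrite -QE -m1E => mQ.
have [ma|am] := ltP m a%:Z; last first.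
  have := le_mesh _ _ am; rewrite -qE => qm.
  have q0 := quad_gt0 j.
  right; split; last by rewrite ger0_norm; lra.
  move=> x /cellE mx; split; first by apply/boxE; lra.
  by move=> /boxE; lra.
have [am|ma'] := leP (- a%:Z) m.
  left => x /cellE mx; apply/boxE.
  have := le_mesh _ _ am; rewrite -qN => qm.
  have /le_mesh : m + 1 <= a%:Z by rewrite lezD1.
  by rewrite -qE -m1E; lra.
have /le_mesh : m + 1 <= - a%:Z by rewrite lezD1.
rewrite -qN -m1E => mq; have q0 := quad_gt0 j.
right; split; last by rewrite ler0_norm; lra.
move=> x /cellE mx; split; first by apply/boxE; lra.
by move=> /boxE; lra.
Qed.

Definition ncell j : nat := 4 ^ (5 * j).+1.

Definition cellnum j (i : 'I_(ncell j).*2) : int := i%:Z - (ncell j)%:Z.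

Lemma cellnum_inj j : injective (@cellnum j).
Proof. by move=> a b /addIr [] /val_inj. Qed.

Definition samples j k (i : 'I_(ncell j).*2) : R :=
  \int[mu]_x (\1_(cell (mesh j) (cellnum i)) x * k x).

Definition on_shell S j k := forall x, ~ (S x /\ shell j x) -> k x = 0.

Lemma on_shell_cells S j k x : on_shell S j k ->
  \sum_i \1_(cell (mesh j) (@cellnum j i)) x * k x = k x.
Proof.
move=> kS; rewrite -mulr_suml (indic_cell_sum _ _ (mesh_gt0 j)) -quadS_mesh.
rewrite indicM; case: ifPn => // /negP xq; rewrite kS// => -[_ [/boxE xq' _]].
by apply: xq; rewrite in_box.
Qed.

Lemma samples_neq0 S j k i : on_shell S j k -> samples k i != 0 ->
  cell (mesh j) (cellnum i) `<=` shell j /\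
  quad j <= `|(@cellnum j i)%:~R * mesh j| <= quad j.+1.
Proof.
move=> kS; have ib : - (ncell j)%:Z <= cellnum i < (ncell j)%:Z.
  by rewrite /cellnum; have := ltn_ord i; move: (nat_of_ord i) => a; rewrite -addnn; lia.
have [cb|//] := cell_cases ib.
rewrite /samples (_ : \int[mu]_x _ = 0) ?eqxx//.
rewrite -[RHS]int0; apply: eq_int => x; rewrite indicM; case: ifPn => // /set_mem /cb bx.
by apply: kS => -[_ []].
Qed.

(** This is where thinness enters: in each cell [k] lives on a set [W] of measure at most
    [kap * mesh j], so Cauchy-Schwarz against the indicator of [W] gains the factor [kap] over the
    bound for a general [k]. *)
Lemma sum_sqr_samples kap j0 S j k : 0 <= kap -> thin kap j0 S -> (j0 <= j)%N ->
    L2 k -> on_shell S j k ->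
  \sum_i (@samples j k i) ^+ 2 <= kap * mesh j * dot k k.
Proof.
move=> kap0 tS j0j Lk kS; have d0 := mesh_gt0 j.
have mcell i := measurable_cell (mesh j) (@cellnum j i).
have Lcell i : L2 (fun x => \1_(cell (mesh j) (@cellnum j i)) x * k x).
  exact: L2_restr.
have -> : dot k k = \sum_i dot (fun x => \1_(cell (mesh j) (@cellnum j i)) x * k x) k.
  rewrite -int_sum; last by move=> i _; exact: L2M.
  by apply: eq_int => x; rewrite -mulr_suml (on_shell_cells _ kS).
rewrite mulr_sumr; apply: ler_sum => i _.
(* Cells inside the inner box have zero sample; thinness speaks only of cells contained in the
   shell. *)
have [->|nz] := eqVneq (samples k i) 0.
  rewrite expr0n mulr_ge0//; first by rewrite mulr_ge0// ltW.
  apply: int_ge0 => x.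
  by rewrite -mulrA mulr_ge0// -?expr2 ?sqr_ge0// indicE.
have [cs _] := samples_neq0 kS nz.
have [W [mW SW muW]] := tS _ _ j0j cs.
have Wlty : (mu W < +oo)%E by apply: le_lt_trans muW (ltry _).
have -> : samples k i = dot \1_W (fun x => \1_(cell (mesh j) (cellnum i)) x * k x).
  apply: eq_int => x; rewrite !indicM; case: ifPn => [/set_mem xc|]; last by case: ifP.
  case: ifPn => // /negP xW; apply: kS => -[Sx _]; apply: xW; apply/mem_set/SW; split => //.
have := dot_sqr_le (L2_indic mW Wlty) (Lcell i).
move=> /le_trans; apply; rewrite -nrm2 nrm_indic// sqr_sqrtr ?fine_ge0//.
have -> : dot (fun x => \1_(cell (mesh j) (cellnum i)) x * k x)
    (fun x => \1_(cell (mesh j) (cellnum i)) x * k x) =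
    dot (fun x => \1_(cell (mesh j) (cellnum i)) x * k x) k.
  by apply: eq_int => x; rewrite !indicM; case: ifPn; rewrite ?mul0r.
rewrite ler_wpM2r//.
  apply: int_ge0 => x; by rewrite -mulrA mulr_ge0// -?expr2 ?sqr_ge0// indicE.
by rewrite -lee_fin fineK// ge0_fin_numE.
Qed.

(** Over one cell the cosine of frequency [y] varies by at most [2 * pi * |y| * mesh j]. *)
Lemma samples_approx S j k y : L1 k -> on_shell S j k ->
  `|trans cos k y - cospoly (@samples j k) (fun i => (cellnum i)%:~R * mesh j) y|
  <= 2 * pi * `|y| * mesh j * \int[mu]_x `|k x|.
Proof.
move=> Ik kS; have d0 := mesh_gt0 j.
have Icell i : L1 (fun x => \1_(cell (mesh j) (@cellnum j i)) x * k x).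
  apply: L1Mb => //; first exact: measurable_indic (measurable_cell _ _).
  by move=> x; exact: indic_norm.
have Ic i : L1 (fun x => cos (2 * pi * ((@cellnum j i)%:~R * mesh j) * y) *
    (\1_(cell (mesh j) (cellnum i)) x * k x)) by exact: L1Z.
have -> : cospoly (@samples j k) (fun i => (cellnum i)%:~R * mesh j) y =
    \int[mu]_x (\sum_i cos (2 * pi * ((@cellnum j i)%:~R * mesh j) * y) *
    (\1_(cell (mesh j) (cellnum i)) x * k x)).
  rewrite int_sum//; apply: eq_bigr => i _; rewrite intZ// mulrC//.
rewrite -intB; [|exact: trans_L1 kern_cos Ik|exact: L1_sum].
rewrite (le_trans (int_norm _))//.
  by apply: L1B; [exact: trans_L1 kern_cos Ik|exact: L1_sum].
rewrite -intZ; last exact: L1_norm.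
apply: le_int.
- by apply: L1_norm; apply: L1B; [exact: trans_L1 kern_cos Ik|exact: L1_sum].
- exact/L1Z/L1_norm.
move=> x; have [kx|kx] := eqVneq (k x) 0.
  by rewrite kx !mulr0 normr0 mulr0 big1 ?subrr ?normr0// => i _; rewrite !mulr0.
have p0 := @pi_ge0 R.
rewrite -{1}(on_shell_cells x kS) mulr_sumr -sumrB (le_trans (ler_norm_sum _ _ _))//.
(* Where [k x] is nonzero it can be cancelled from [on_shell_cells], so that [x] has total cell
   weight 1. *)
have s1 : \sum_i (\1_(cell (mesh j) (@cellnum j i)) x : R) = 1.
  by apply: (mulIf kx); rewrite mul1r mulr_suml (on_shell_cells x kS).
apply: (@le_trans _ _ (\sum_i 2 * pi * `|y| * mesh j *
   (\1_(cell (mesh j) (@cellnum j i)) x * `|k x|))); last first.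
  by rewrite -mulr_sumr -mulr_suml s1 mul1r.
apply: ler_sum => i _; rewrite -mulrBl normrM !indicM; case: ifPn => [|_]; last first.
  by rewrite normr0 !mulr0.
rewrite in_cell => xc; rewrite ler_wpM2r// (le_trans (norm_cosB_le _ _))//.
have -> : 2 * pi * y * x - 2 * pi * ((cellnum i)%:~R * mesh j) * y =
  2 * pi * y * (x - (cellnum i)%:~R * mesh j) by ring.
rewrite !normrM (ger0_norm p0) (ger0_norm (ler0n _ 2)) ler_wpM2l//.
  by rewrite !mulr_ge0.
by rewrite ger0_norm; lra.
Qed.

End Thin.

(** * Almost orthogonality of the sampled transforms *)

Section ThinBound.
Context {R : realType}.
Implicit Types (h k : R -> R) (S : set R) (kap : R) (j e : nat).

Definition poly j k : R -> R :=
  cospoly (@samples R j k) (fun i => (cellnum i)%:~R * mesh j).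

(* The cutoff lies at the inner ([e = 0]) or outer ([e = 1]) end of the shell of
   [k], according to whether [h] is taken below or up to that shell. *)
Definition spoly e j k (y : R) : R := \1_(box (quad (j + e))) y * poly j k y.

(** The Parseval norm of the polynomial over its full period. It bounds the norm of [spoly], and
    under thinness its square is at most [kap * nrm k ^+ 2]. *)
Definition sizes j k : R := Num.sqrt ((mesh j)^-1 * \sum_i (@samples R j k i) ^+ 2).

Lemma sizes2 j k : sizes j k ^+ 2 = (mesh j)^-1 * \sum_i (@samples R j k i) ^+ 2.
Proof.
rewrite sqr_sqrtr// mulr_ge0 ?invr_ge0 ?(ltW (mesh_gt0 _))//.
by apply: sumr_ge0 => i _; exact: sqr_ge0.
Qed.

Lemma spoly_L2 e j k : L2 (spoly e j k).
Proof.
have L : L2 (\1_(box (quad (j + e))) : R -> R).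
  by apply: L2_indic; [exact: measurable_box|exact: mu_box_lty].
have := L2Mb (cospoly_measurable _ _) (cospoly_le _ _) L.
move=> /(_ _ (@samples R j k) (fun i => (cellnum i)%:~R * mesh j)).
by congr (L2 _); apply/funext => y; rewrite mulrC.
Qed.

(** The cutoff stays within one period of the sampled polynomial, so that Parseval over the full
    period applies. *)
Lemma quad_le_half_mesh e j : (0 < j)%N -> (e <= 1)%N ->
  quad (j + e) <= 1 / (2 * mesh j) :> R.
Proof.
move=> j0 e1; have := @quad_le R (j + e) j.+1; move/(_ ltac:(lia)) => /le_trans; apply.
rewrite invfM mul1r /mesh invrK.
have : quad j.+2 <= 4 ^+ (4 * j) :> R by apply: quad_le; lia.
by rewrite /quad exprS => h; rewrite -ler_pdivrMl ?invr_gt0// invrK; have := @quad_gt0 R j.+1; rewrite /quad; lra.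
Qed.

Lemma dot_spoly_le e j k : (0 < j)%N -> (e <= 1)%N ->
  dot (spoly e j k) (spoly e j k) <= sizes j k ^+ 2.
Proof.
move=> j0 e1; rewrite sizes2 -[(mesh j)^-1]mul1r.
apply: le_trans (cospoly_parseval _ (@cellnum_inj j) (@mesh_gt0 R j)).
apply: le_int; first by apply: L2M; exact: spoly_L2.
  apply: (@L1_box_bounded _ _ (fun y => cospoly (@samples R j k) _ y ^+ 2)
      ((\sum_i `|@samples R j k i|) ^+ 2)).
    by apply: measurable_funX; exact: cospoly_measurable.
  by move=> y; rewrite normrX ler_pXn2r ?nnegrE//; [exact: cospoly_le|exact: sumr_ge0].
move=> y; rewrite /spoly -expr2 exprMn ler_wpM2r ?sqr_ge0//.
rewrite !indicE !in_box.
case: (boolP (- quad (j + e) <= y < quad (j + e))) => [yb|]; last by rewrite expr0n ler0n.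
rewrite expr1n; have := quad_le_half_mesh j0 e1.
by move: yb => /andP[yb1 yb2] ?; rewrite (_ : (_ <= _ < _) = true)//; apply/andP; split; lra.
Qed.

Lemma nrm_spoly_le e j k : (0 < j)%N -> (e <= 1)%N ->
  nrm (spoly e j k) <= sizes j k.
Proof.
move=> j0 e1; rewrite -(@ger0_norm _ (sizes j k)) ?sqrtr_ge0// -sqrtr_sqr.
by rewrite ler_wsqrtr// dot_spoly_le.
Qed.

Lemma sum_norm_sqr_le (I : finType) (x : I -> R) :
  (\sum_i `|x i|) ^+ 2 <= #|I|%:R * \sum_i x i ^+ 2.
Proof.
rewrite expr2 mulr_suml; under eq_bigr do rewrite mulr_sumr.
apply: (@schur _ _ _ (fun _ _ => 1)) => //.
- by move=> i j; rewrite mul1r normrM !normr_id.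
- by move=> i; rewrite sumr_const.
- by move=> i; rewrite sumr_const.
Qed.

(** Cauchy-Schwarz over the [8 * quad j / mesh j] cells; [2 ^+ j] is the root of [quad j], and the
    root of 8 is rounded up to 3. *)
Lemma sum_norm_samples j k :
  \sum_i `|@samples R j k i| <= 3 * 2 ^+ j * sizes j k.
Proof.
have s0 : 0 <= sizes j k by exact: sqrtr_ge0.
rewrite -(@ler_pXn2r _ 2)// ?nnegrE ?sumr_ge0 ?mulr_ge0//.
rewrite (le_trans (sum_norm_sqr_le _))// exprMn sizes2 card_ord.
have -> : (ncell j).*2%:R = 8 * quad j * (mesh j)^-1 :> R.
  rewrite -addnn natrD; have := @quadS_mesh R j; rewrite /quad exprS.
  by move=> h; apply: (mulIf (lt0r_neq0 (@mesh_gt0 R j))); rewrite mulfVK ?lt0r_neq0 ?mesh_gt0//; rewrite /ncell; lra.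
rewrite -mulrA ler_wpM2r//.
  rewrite mulr_ge0 ?invr_ge0 ?(ltW (mesh_gt0 _))//.
  by apply: sumr_ge0 => i _; exact: sqr_ge0.
have -> : (3 * 2 ^+ j) ^+ 2 = 9 * quad j :> R.
  rewrite exprMn -exprM mulnC exprM /quad; congr (_ * _ ^+ _); ring.
by have := @quad_gt0 R j; lra.
Qed.

(** The product of the two cutoffs is the smaller one. As [quad j.+1] is at most a quarter of
    [quad j'], the frequencies differ by at least [3 / 4 * quad j']; [gram_far] and two sums of size
    [3 * 2 ^+ j] and [3 * 2 ^+ j'] give the constant [9 * 4 / 3 = 12]. *)
Lemma dot_spoly_far e j j' k k' S : (e <= 1)%N -> (j.+2 <= j')%N ->
    on_shell S j k -> on_shell S j' k' ->
  `|dot (spoly e j k) (spoly e j' k')| <=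
  12 * 2 ^- (j' - j) * sizes j k * sizes j' k'.
Proof.
move=> e1 jj' kS kS'.
have -> : dot (spoly e j k) (spoly e j' k') =
    \sum_i \sum_i' @samples R j k i * @samples R j' k' i' * gram (quad (j + e))
      ((cellnum i)%:~R * mesh j) ((cellnum i')%:~R * mesh j').
  rewrite -int_cospolyM; apply: eq_int => y; rewrite /spoly /poly.
  have : quad (j + e) <= quad (j' + e) :> R by apply: quad_le; lia.
  rewrite [LHS]mulrACA => q; congr (_ * _); move: q; rewrite !indicE !in_box => q.
  case: (boolP (- quad (j + e) <= y < quad (j + e))) => [/andP[? ?]|]; last by rewrite mul0r.
  by rewrite mul1r (_ : (_ <= _ < _) = true)//; apply/andP; split; lra.
pose D : R := 3 / 4 * quad j'.
have q0 := @quad_gt0 R j'; have D0 : 0 < D by rewrite /D; lra.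
rewrite (le_trans (ler_norm_sum _ _ _))//.
apply: (@le_trans _ _ (\sum_i \sum_i' `|@samples R j k i| * `|@samples R j' k' i'| * (1 / D))).
  apply: ler_sum => i _; rewrite (le_trans (ler_norm_sum _ _ _))//.
  apply: ler_sum => i' _; rewrite !normrM.
  have [->|n] := eqVneq (samples k i) 0; first by rewrite normr0 !mul0r.
  have [->|n'] := eqVneq (samples k' i') 0; first by rewrite normr0 mulr0 !mul0r.
  have [_ /andP[_ u]] := samples_neq0 kS n.
  have [_ /andP[u' _]] := samples_neq0 kS' n'.
  rewrite ler_wpM2l ?mulr_ge0//; apply: gram_far => //; first exact: quad_gt0.
  have : quad j.+1 * 4 <= quad j' :> R.
    by have := @quad_le R _ _ jj'; rewrite /quad [4 ^+ j.+2]exprSr.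
  by rewrite /D; lra.
under eq_bigr do rewrite -mulr_suml -mulr_sumr.
rewrite -mulr_suml -mulr_suml.
have h := sum_norm_samples j k; have h' := sum_norm_samples j' k'.
have s0 : 0 <= sizes j k by exact: sqrtr_ge0.
have s0' : 0 <= sizes j' k' by exact: sqrtr_ge0.
have g : 0 <= \sum_i `|@samples R j k i| by exact: sumr_ge0.
have g' : 0 <= \sum_i `|@samples R j' k' i| by exact: sumr_ge0.
apply: (@le_trans _ _ (3 * 2 ^+ j * sizes j k * (3 * 2 ^+ j' * sizes j' k') * (1 / D))).
  by rewrite ler_wpM2r ?divr_ge0 ?(ltW D0)// ler_pM.
rewrite le_eqVlt; apply/orP; left; apply/eqP.
have Dq : D = 3 / 4 * (2 ^+ j * 2 ^+ (j' - j)) * 2 ^+ j'.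
  rewrite /D -exprD subnKC; last lia.
  have -> : quad j' = 2 ^+ j' * 2 ^+ j' :> R by rewrite /quad -exprMn; congr (_ ^+ _); ring.
  ring.
by rewrite Dq; field; rewrite !expf_neq0.
Qed.

Lemma dot_spoly e j j' k k' S : (0 < j)%N -> (0 < j')%N -> (e <= 1)%N ->
    on_shell S j k -> on_shell S j' k' ->
  `|dot (spoly e j k) (spoly e j' k')| <=
  12 * 2 ^- (j - j' + (j' - j)) * sizes j k * sizes j' k'.
Proof.
move=> + + e1; wlog jj' : j j' k k' / (j <= j')%N.
  move=> H j0 j'0 kS kS'; have [|/ltnW j'j] := leqP j j'; first by move=> ?; exact: H.
  by rewrite dotC mulrAC [(j - j' + _)%N]addnC; exact: H.
move=> j0 j'0 kS kS'; rewrite (_ : j - j' + (j' - j) = j' - j)%N; last lia.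
have [far|near] := leqP j.+2 j'; first exact: dot_spoly_far kS kS'.
(* For equal or adjacent shells Cauchy-Schwarz is enough, since [12 / 2] is still at least 1. *)
rewrite (le_trans (dot_le (spoly_L2 _ _ _) (spoly_L2 _ _ _)))//.
apply: (@le_trans _ _ (sizes j k * sizes j' k')).
  by rewrite ler_pM ?nrm_ge0// nrm_spoly_le.
rewrite -mulrA ler_peMl ?mulr_ge0 ?sqrtr_ge0//.
have : (j' - j = 0 \/ j' - j = 1)%N by lia.
by case=> ->; rewrite ?expr0 ?expr1; lra.
Qed.

End ThinBound.

(** * Comparison of the full pairing with its core part *)

Section ThinHalf.
Context {R : realType}.
Implicit Types (h k : R -> R) (S : set R) (kap : R) (j e : nat).
Notation mu := (@lebesgue_measure R).

Definition restr (A : set R) (f : R -> R) : R -> R := fun x => \1_A x * f x.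

Lemma measurable_shell j : measurable (shell j : set R).
Proof. by apply: measurableD; exact: measurable_box. Qed.

Lemma indic_shell j (x : R) :
  \1_(shell j) x = \1_(box (quad j.+1)) x - \1_(box (quad j)) x :> R.
Proof.
have : quad j <= quad j.+1 :> R by exact: quad_le.
rewrite !indicE /shell in_setD !in_box => q.
have [/andP[a b]|_] := boolP (- quad j <= x < quad j); last by rewrite andbT subr0.
by rewrite andbF (_ : (_ <= _ < _) = true) ?subrr//; apply/andP; split; lra.
Qed.

Lemma sum_indic_shell j0 n (x : R) : \sum_(i < n) \1_(shell (j0 + i)) x =
  \1_(box (quad (j0 + n))) x - \1_(box (quad j0)) x :> R.
Proof.
elim: n => [|n IHn]; first by rewrite big_ord0 addn0 subrr.
by rewrite big_ord_recr /= IHn indic_shell addnS; ring.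
Qed.

Lemma on_shell_restr S j k : (forall x, ~ S x -> k x = 0) ->
  on_shell S j (restr (shell j) k).
Proof.
move=> kS x; rewrite not_andE /restr => -[/kS ->|xs]; first by rewrite mulr0.
by rewrite indicM memNset.
Qed.

Lemma sum_dot_shell j0 n k : L2 k ->
  \sum_(i < n) dot (restr (shell (j0 + i)) k) (restr (shell (j0 + i)) k) <= dot k k.
Proof.
move=> Lk; have Ls i : L2 (restr (shell (j0 + i)) k).
  exact: L2_restr (measurable_shell _) Lk.
rewrite -int_sum; last by move=> i _; exact: L2M.
apply: le_int; [by apply: L1_sum => i _; exact: L2M|exact: L2M|move=> x].
have -> : \sum_(i < n) restr (shell (j0 + i)) k x * restr (shell (j0 + i)) k x =
    (\sum_(i < n) \1_(shell (j0 + i)) x) * (k x * k x).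
  by rewrite mulr_suml; apply: eq_bigr => i _; rewrite /restr !indicM; case: ifP; rewrite ?mul0r.
rewrite sum_indic_shell ler_piMl//; first by rewrite -expr2 sqr_ge0.
Qed.

Lemma sum_half_pow n : \sum_(i < n) 2 ^- i.+1 <= 1 :> R.
Proof.
suff -> : \sum_(i < n) 2 ^- i.+1 = 1 - 2 ^- n :> R.
  by have : 0 <= 2 ^- n :> R by []; lra.
elim: n => [|n IHn]; first by rewrite big_ord0 expr0 invr1 subrr.
by rewrite big_ord_recr /= IHn exprS; field; rewrite expf_neq0.
Qed.

Lemma int_norm_restr_box r h : 0 <= r -> L2 h ->
  \int[mu]_x `|restr (box r) h x| <= Num.sqrt (2 * r) * nrm h.
Proof.
move=> r0 Lh; have Lr := L2_restr (measurable_box r) Lh.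
have := int_norm_le (measurable_box r) (mu_box_lty r) Lr.
rewrite (mu_box r0) => /(_ _)/le_trans; apply.
  by move=> x xr; rewrite /restr indicM memNset.
by rewrite ler_wpM2l ?sqrtr_ge0// nrm_restr//; exact: measurable_box.
Qed.

Lemma pi_lt4 : pi < 4 :> R.
Proof. by have := @pihalf_lt2 R; lra. Qed.

(** With [q = quad j.+1], the frequency bound contributes [2 * pi * q * mesh j] and passing from L1
    to L2 norms twice contributes [2 * q]. The product decays like [4 ^ (- 2 j)], and [4 <= j0]
    makes it small enough for the errors to add up to at most [1 / 32]. *)
Lemma sampling_error e j0 j i S h k : (4 <= j0)%N -> (e <= 1)%N -> j = (j0 + i)%N ->
    bL2 h -> bL2 k -> (forall x, ~ S x -> k x = 0) ->
  `|dot (restr (box (quad (j + e))) h) (trans cos (restr (shell j) k))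
    - dot h (spoly e j (restr (shell j) k))| <=
  1 / 32 * 2 ^- i.+1 * nrm h * nrm k.
Proof.
move=> j04 e1 jE bh bk kS; set kj := restr (shell j) k.
have bkj : bL2 kj by exact: bL2_indicM (measurable_shell _) bk.
have bhr : bL2 (restr (box (quad (j + e))) h) by exact: bL2_indicM (measurable_box _) bh.
have [Lh Lk] := (bL2_L2 bh, bL2_L2 bk).
have q0 := @quad_gt0 R j.+1; have d0 := @mesh_gt0 R j.
have qe : quad (j + e) <= quad j.+1 :> R by apply: quad_le; lia.
have kjS : on_shell S j kj by exact: on_shell_restr.
pose M : R := 2 * pi * quad j.+1 * mesh j * (Num.sqrt (2 * quad j.+1) * nrm k).
have M0 : 0 <= M.
  by rewrite !mulr_ge0 ?sqrtr_ge0 ?nrm_ge0 ?pi_ge0// ltW.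
have ik : \int[mu]_x `|kj x| <= Num.sqrt (2 * quad j.+1) * nrm k.
  have Lkj := bL2_L2 bkj.
  have := int_norm_le (measurable_box (quad j.+1)) (mu_box_lty _) Lkj.
  rewrite mu_box; last exact: ltW.
  move=> /(_ _)/le_trans; apply.
    by move=> x xr; rewrite /kj /restr indicM memNset// => -[].
  by rewrite ler_wpM2l ?sqrtr_ge0// nrm_restr//; exact: measurable_shell.
pose g y := restr (box (quad (j + e))) h y * (trans cos kj y - poly j kj y).
have Ig1 : L1 (fun y => restr (box (quad (j + e))) h y * trans cos kj y).
  have := L1_trans kern_cos (bL2_L1 bkj) (bL2_L1 bhr).
  by congr (L1 _); apply/funext => y; rewrite mulrC.
have Ig2 : L1 (fun y => h y * spoly e j kj y) by apply: L2M => //; exact: spoly_L2.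
have gE y : g y = restr (box (quad (j + e))) h y * trans cos kj y - h y * spoly e j kj y.
  by rewrite /g /restr /spoly; ring.
have Ig : L1 g by have := L1B Ig1 Ig2; congr (L1 _); apply/funext => y; rewrite gE.
have -> : dot (restr (box (quad (j + e))) h) (trans cos kj) - dot h (spoly e j kj) =
    \int[mu]_y g y.
  by rewrite /dot -intB//; apply: eq_int => y; rewrite gE.
rewrite (le_trans (int_norm Ig))//.
have : \int[mu]_y `|g y| <= M * \int[mu]_y `|restr (box (quad (j + e))) h y|.
  rewrite -intZ; last by apply: L1_norm; exact: bL2_L1.
  apply: le_int; [exact: L1_norm|by apply/L1Z/L1_norm; exact: bL2_L1|move=> y].
  rewrite /g /restr normrM mulrC indicM; case: ifPn => [|_]; last by rewrite normr0 !mulr0.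
  rewrite in_box => yb; rewrite ler_wpM2r//.
  rewrite (le_trans (samples_approx _ (bL2_L1 bkj) kjS))//.
  have yq : `|y| <= quad j.+1 by rewrite ler_norml; apply/andP; split; lra.
  rewrite ler_pM//.
  - by rewrite !mulr_ge0// ?pi_ge0// ltW.
  - by apply: int_ge0 => x.
  - by rewrite ler_wpM2r ?(ltW d0)// ler_wpM2l// mulr_ge0// pi_ge0.
move=> /le_trans; apply.
have := int_norm_restr_box (ltW (@quad_gt0 R (j + e))) Lh.
move=> /(ler_wpM2l M0)/le_trans; apply.
have sq : Num.sqrt (2 * quad (j + e)) <= Num.sqrt (2 * quad j.+1) :> R.
  by rewrite ler_wsqrtr// ler_pM2l.
apply: (@le_trans _ _ (M * (Num.sqrt (2 * quad j.+1) * nrm h))).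
  by rewrite ler_wpM2l// ler_wpM2r// nrm_ge0.
have s2 : Num.sqrt (2 * quad j.+1) * Num.sqrt (2 * quad j.+1) = 2 * quad j.+1 :> R.
  by rewrite -expr2 sqr_sqrtr// mulr_ge0// ltW.
rewrite /M (_ : _ * _ = (2 * pi * quad j.+1 * mesh j) *
  (Num.sqrt (2 * quad j.+1) * Num.sqrt (2 * quad j.+1)) * (nrm h * nrm k)); last by ring.
rewrite s2 -[leRHS]mulrA ler_wpM2r ?mulr_ge0 ?nrm_ge0//.
have qm : quad j.+1 * quad j.+1 * mesh j <= 2 ^- 10 * 2 ^- i.+1 :> R.
  rewrite /quad /mesh -exprD ler_pdivrMr ?exprn_gt0//.
  rewrite -invfM -exprD -[leLHS]mul1r -[leRHS]mulrC ler_pdivlMr ?exprn_gt0//.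
  rewrite mul1r (_ : 4 = 2 ^+ 2) -?exprM -?exprD; last by rewrite expr2; ring.
  by rewrite ler_weXn2l ?ler1n//; lia.
have := @pi_lt4; have := @pi_ge0 R; clear -qm d0 q0.
have : 0 <= 2 ^- i.+1 :> R by [].
move: qm; rewrite (_ : 2 ^- 10 = 1 / 1024 :> R); last by rewrite div1r -natrX.
have : 0 <= quad j.+1 * quad j.+1 * mesh j :> R.
  by rewrite mulr_ge0 ?(ltW d0)// mulr_ge0 ?(ltW q0).
set a := quad j.+1; set b := mesh j; set c := 2 ^- _.
have -> : 2 * pi * a * b * (2 * a) = 4 * pi * (a * a * b) by ring.
move: (a * a * b) c => u c; nra.
Qed.

(** Since the cutoff has been moved from [h] into [spoly], all shells pair with the same [h], and
    one Cauchy-Schwarz reduces the claim to the norm of the sum of the [spoly]. Schur's test with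
    row sums [12 * 3] then produces the factor [36 * kap]. Main part and sampling error contribute
    [1 / 32] each. *)
Lemma thin_half e kap j0 n S h k : (4 <= j0)%N -> (e <= 1)%N ->
    0 <= kap -> 36 * kap <= (1 / 32) ^+ 2 -> thin kap j0 S ->
    bL2 h -> bL2 k -> (forall x, ~ S x -> k x = 0) ->
  `|\sum_(i < n) dot (restr (box (quad (j0 + i + e))) h)
      (trans cos (restr (shell (j0 + i)) k))| <= 1 / 16 * nrm h * nrm k.
Proof.
move=> j04 e1 kap0 kap36 tS bh bk kS.
have [Lh Lk] := (bL2_L2 bh, bL2_L2 bk).
pose kj i := restr (shell (j0 + i)) k.
pose V i := spoly e (j0 + i) (kj i).
have LV i : L2 (V i) by exact: spoly_L2.
have Lkj i : L2 (kj i) by exact: L2_restr (measurable_shell _) Lk.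
have kjS i : on_shell S (j0 + i) (kj i) by exact: on_shell_restr.
have nV : nrm (fun y => \sum_(i < n) V i y) <= 1 / 32 * nrm k.
  rewrite -(@ler_pXn2r _ 2)// ?nnegrE ?mulr_ge0 ?nrm_ge0//.
  rewrite exprMn !nrm2.
  have -> : dot (fun y => \sum_(i < n) V i y) (fun y => \sum_(i < n) V i y) =
      \sum_(i < n) \sum_(i' < n) dot (V i) (V i').
    rewrite {1}/dot; transitivity (\int[mu]_y \sum_(i < n) \sum_(i' < n) V i y * V i' y).
      by apply: eq_int => y; rewrite mulr_suml; apply: eq_bigr => i _; rewrite mulr_sumr.
    rewrite int_sum; last by move=> i _; apply: L1_sum => i' _; exact: L2M.
    by apply: eq_bigr => i _; rewrite int_sum// => i' _; exact: L2M.
  apply: (@le_trans _ _ (36 * \sum_(i < n) sizes (j0 + i) (kj i) ^+ 2)).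
    apply: (@schur _ _ _ (fun i i' : 'I_n => 12 * 2 ^- (i - i' + (i' - i)))).
    - move=> i i'; rewrite !(ger0_norm (sqrtr_ge0 _)) /V.
      have := @dot_spoly _ e (j0 + i) (j0 + i') (kj i) (kj i') S.
      by rewrite !subnDl; apply => //; lia.
    - by move=> i i'; rewrite mulr_ge0.
    - by move=> i; rewrite -mulr_sumr; have := @sum_half_dist R i n; lra.
    - move=> i; rewrite -mulr_sumr; under eq_bigr do rewrite addnC.
      by have := @sum_half_dist R i n; lra.
  have szb (i : nat) : sizes (j0 + i) (kj i) ^+ 2 <= kap * dot (kj i) (kj i).
    have := sum_sqr_samples kap0 tS (leq_addr i j0) (Lkj i) (kjS i).
    by rewrite sizes2 mulrAC -ler_pdivrMr ?mesh_gt0// [X in X <= _ -> _]mulrC.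
  apply: (@le_trans _ _ (36 * kap * dot k k)); last by rewrite ler_wpM2r ?dot_ge0.
  rewrite -mulrA ler_wpM2l//.
  apply: (@le_trans _ _ (\sum_(i < n) kap * dot (kj i) (kj i))).
    by apply: ler_sum => i _.
  by rewrite -mulr_sumr ler_wpM2l// sum_dot_shell.
have main : `|\sum_(i < n) dot h (V i)| <= nrm h * (1 / 32 * nrm k).
  have -> : \sum_(i < n) dot h (V i) = dot h (fun y => \sum_(i < n) V i y).
    rewrite /dot -int_sum; last by move=> i _; exact: L2M.
    by apply: eq_int => y; rewrite mulr_sumr.
  rewrite (le_trans (dot_le Lh _))//; first by apply: L2_sum => i _.
  by rewrite ler_wpM2l// nrm_ge0.
have err : `|\sum_(i < n) (dot (restr (box (quad (j0 + i + e))) h)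
    (trans cos (kj i)) - dot h (V i))| <= 1 / 32 * nrm h * nrm k.
  rewrite (le_trans (ler_norm_sum _ _ _))//.
  apply: (@le_trans _ _ (\sum_(i < n) 2 ^- i.+1 * (1 / 32 * nrm h * nrm k))).
    apply: ler_sum => i _; rewrite (le_trans (sampling_error j04 e1 erefl bh bk kS))//.
    by rewrite le_eqVlt; apply/orP; left; apply/eqP; ring.
  by rewrite -mulr_suml ler_piMl ?mulr_ge0 ?nrm_ge0// sum_half_pow.
have -> : \sum_(i < n) dot (restr (box (quad (j0 + i + e))) h) (trans cos (kj i)) =
  \sum_(i < n) (dot (restr (box (quad (j0 + i + e))) h) (trans cos (kj i)) - dot h (V i))
  + \sum_(i < n) dot h (V i).
  by rewrite sumrB subrK.
rewrite (le_trans (ler_normD _ _))//.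
by move: err main; move: `|_| `|_| => a b; move: (nrm h) (nrm k) => c d; nra.
Qed.

Lemma restr_shell j k x :
  restr (shell j) k x = restr (box (quad j.+1)) k x - restr (box (quad j)) k x.
Proof. by rewrite /restr indic_shell mulrBl. Qed.

Lemma telescope2 (u a b : nat -> R) n : (forall i, u i.+1 - u i = a i + b i) ->
  u n - u 0 = \sum_(i < n) a i + \sum_(i < n) b i.
Proof.
move=> uE; rewrite -big_split -(big_mkord xpredT (fun i => a i + b i)).
by under eq_bigr do rewrite -uE; rewrite telescope_sumr.
Qed.

(* [dot h (trans cos k)] is a symmetric form; outside of the core its part with
   the frequencies below the position is controlled by the thinness of the
   support of [k], the other part by the thinness of the support of [h]. *)
Lemma thin_bound kap j0 S h k : (4 <= j0)%N ->
    0 <= kap -> 36 * kap <= (1 / 32) ^+ 2 -> thin kap j0 S ->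
    bL2 h -> bL2 k ->
    (forall x, ~ S x -> h x = 0) -> (forall x, ~ S x -> k x = 0) ->
  `|dot h (trans cos k) -
    dot (restr (box (quad j0)) h) (trans cos (restr (box (quad j0)) k))|
  <= 1 / 8 * nrm h * nrm k.
Proof.
move=> j04 kap0 kap36 tS bh bk hS kS.
have bB j f : bL2 f -> bL2 (restr (box (quad j)) f).
  exact: bL2_indicM (measurable_box _).
have bS j f : bL2 f -> bL2 (restr (shell j) f).
  exact: bL2_indicM (measurable_shell _).
pose H j := restr (box (quad j)) h; pose K j := restr (box (quad j)) k.
have tL (f g : R -> R) : bL2 f -> bL2 g -> dot f (trans cos g) = dot g (trans cos f).
  by move=> bf bg; rewrite [LHS]dotC; exact: trans_sym kern_cos (bL2_L1 bg) (bL2_L1 bf).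
(* Enlarging the core by one shell adds [<H j, C (shell of k)>] and [<shell of h, C (K j.+1)>]; this
   asymmetry is the reason for the two cutoffs [e = 0] and [e = 1]. *)
have step j : dot (H j.+1) (trans cos (K j.+1)) - dot (H j) (trans cos (K j)) =
    dot (restr (box (quad (j + 0))) h) (trans cos (restr (shell j) k)) +
    dot (restr (box (quad (j + 1))) k) (trans cos (restr (shell j) h)).
  rewrite addn0 addn1 (tL (restr (box (quad j.+1)) k) (restr (shell j) h)); [|exact: bB|exact: bS].
  have Ld (f g : R -> R) : bL2 f -> bL2 g -> L1 (fun x => f x * trans cos g x).
    move=> bf bg; have := L1_trans kern_cos (bL2_L1 bg) (bL2_L1 bf).
    by congr (L1 _); apply/funext => x; rewrite mulrC.
  have E1 := intB (Ld _ _ (bB j.+1 _ bh) (bB j.+1 _ bk)) (Ld _ _ (bB j _ bh) (bB j _ bk)).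
  have E2 := intD (Ld _ _ (bB j _ bh) (bS j _ bk)) (Ld _ _ (bS j _ bh) (bB j.+1 _ bk)).
  apply: etrans (esym E1) (etrans _ E2); apply: eq_int => x.
  have -> : restr (shell j) k = (fun y => K j.+1 y - K j y).
    by apply/funext => y; rewrite restr_shell.
  rewrite (transB _ kern_cos); [|exact: bL2_L1 (bB _ _ bk)..].
  by rewrite restr_shell /H /K; ring.
have tele n := @telescope2 (fun i => dot (H (j0 + i)%N) (trans cos (K (j0 + i)%N)))
  (fun i => dot (restr (box (quad (j0 + i + 0))) h) (trans cos (restr (shell (j0 + i)) k)))
  (fun i => dot (restr (box (quad (j0 + i + 1))) k) (trans cos (restr (shell (j0 + i)) h)))
  n (fun i => etrans (congr1 (fun l => dot (H l) (trans cos (K l)) -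
     dot (H (j0 + i)%N) (trans cos (K (j0 + i)%N))) (addnS j0 i)) (step (j0 + i)%N)).
(* By boundedness of the supports the telescoping sum reaches [h] and [k] themselves after finitely
   many shells. *)
have [n [HKn1 HKn2]] : exists n, H (j0 + n)%N = h /\ K (j0 + n)%N = k.
  have [_ [r r0 hr]] := bh; have [_ [s s0 ks]] := bk.
  pose n := (Num.truncn (r + s)).+1.
  have nrs : r + s <= quad (j0 + n)%N.
    have : r + s < n%:R by exact: truncnS_gt.
    have : n%:R <= quad (j0 + n)%N :> R.
      rewrite /quad -natrX ler_nat (leq_trans (ltnW (ltn_expl n (isT : 1 < 4)%N)))//.
      by rewrite leq_exp2l// leq_addl.
    by lra.
  exists n; split; apply/funext => x; rewrite /H /K /restr indicM; case: ifPn => //.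
    move=> /negP xq; rewrite hr// => /boxE xr; apply: xq; rewrite in_box; lra.
  move=> /negP xq; rewrite ks// => /boxE xr; apply: xq; rewrite in_box; lra.
have := tele n; rewrite /= addn0 HKn1 HKn2 => ->; rewrite (le_trans (ler_normD _ _))//.
have h0 := thin_half n j04 (leqnSn 0) kap0 kap36 tS bh bk kS.
have h1 := thin_half n j04 (leqnn 1) kap0 kap36 tS bk bh hS.
by rewrite [_ * nrm k * nrm h]mulrAC in h1; move: h0 h1; clear; lra.
Qed.

End ThinHalf.

(** * Averages of shifts *)

Section Multipliers.
Context {R : realType}.
Implicit Types (f g u v p : R -> R) (L : (R -> R) -> R -> R) (S : set R).
Notation mu := (@lebesgue_measure R).
Variable d : R.

(* [L] is a polynomial of degree at most [s] in the operator [avg] below, and [p]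
   the same polynomial in [cos (2 * pi * d * x)]. *)
Record multiplier (s : nat) (c : R) L p := Multiplier {
  mult_ge0 : 0 <= c;
  mult_measurable : measurable_fun setT p;
  mult_le : forall x, `|p x| <= c;
  mult_bL2 : forall v, bL2 v -> bL2 (L v);
  mult_trans : forall v, bL2 v -> trans cos (L v) = (fun x => p x * trans cos v x);
  trans_mult : forall v, bL2 v -> L (trans cos v) = trans cos (fun x => p x * v x);
  mult_L2 : forall v, L2 v -> L2 (L v);
  mult_nrm : forall v, L2 v -> nrm (L v) <= c * nrm v;
  multB : forall f g, L (fun x => f x - g x) = (fun x => L f x - L g x);
  mult_supp : forall v S, (forall x, ~ S x -> v x = 0) ->
    forall x, (forall i : int, `|i| <= s%:Z -> ~ S (x + i%:~R * d)) -> L v x = 0 }.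

Definition avg v x := (v (x + d) + v (x - d)) / 2.

Lemma cosM a b : cos a * cos b = (cos (a + b) + cos (a - b)) / 2 :> R.
Proof. by rewrite cosD cosB; field. Qed.

(** Both intertwining relations are the product formula [cosM], with the shift falling on the
    variable of integration in [mult_trans] and on the variable of the transform in [trans_mult]. *)
Lemma mult_avg : multiplier 1 1 avg (fun x => cos (2 * pi * d * x)).
Proof.
have avgE v : avg v = (fun x => 2^-1 * (v (x + d) + v (x + - d))).
  by apply/funext => x; rewrite /avg mulrC.
split.
- by [].
- exact: cos_scaled_measurable.
- by move=> x; exact: cos_max.
- by move=> v bv; rewrite avgE; apply/bL2Z/bL2D; exact: bL2_shift.
- move=> v bv; apply/funext => x; have [Lv _] := bv.
  have b1 := bL2_shift d bv; have b2 := bL2_shift (- d) bv.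
  rewrite avgE (transZ _ _ kern_cos (bL2_L1 (bL2D b1 b2))).
  rewrite (transD _ kern_cos (bL2_L1 b1) (bL2_L1 b2)).
  have sh t : trans cos (fun y => v (y + t)) x =
      \int[mu]_y (cos (2 * pi * x * (y - t)) * v y).
    pose g y := cos (2 * pi * x * (y - t)) * v y.
    have Ig : L1 g.
      apply: L1Mb (bL2_L1 bv) _ _; last by move=> y; exact: cos_max.
      apply: measurableT_comp; first by apply: continuous_measurable_fun; exact: continuous_cos.
      by apply: measurable_funM => //; exact: measurable_funB.
    rewrite -(L1_int_shift t Ig).2; apply: eq_int => y.
    by rewrite /g addrK.
  have Ic t : L1 (fun y => cos (2 * pi * x * (y - t)) * v y).
    apply: L1Mb (bL2_L1 bv) _ _; last by move=> y; exact: cos_max.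
    apply: measurableT_comp; first by apply: continuous_measurable_fun; exact: continuous_cos.
    by apply: measurable_funM => //; exact: measurable_funB.
  rewrite !sh -(intD (Ic _) (Ic _)) /trans -!intZ.
  + apply: eq_int => y; rewrite -mulrDl [LHS]mulrA [RHS]mulrA; congr (_ * _).
    rewrite cosM mulrC addrC -(cosN (2 * pi * x * (y - d))).
    by congr ((_ + _) * _); congr cos; ring.
  + exact: trans_L1 kern_cos (bL2_L1 bv).
  + exact: L1D.
- move=> v bv; apply/funext => x.
  have If := bL2_L1 bv.
  have T1 := trans_L1 (x + d) kern_cos If; have T2 := trans_L1 (x - d) kern_cos If.
  rewrite /avg /trans -(intD T1 T2) mulrC -(intZ _ (L1D T1 T2)).
  apply: eq_int => y; rewrite -mulrDl !mulrA; congr (_ * _).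
  by rewrite cosM mulrC; congr ((_ + _) * _); congr cos; ring.
- by move=> v Lv; rewrite avgE; apply/L2Z/L2D; exact: L2_shift.
- move=> v Lv; have [L1v L2v] := (L2_shift d Lv, L2_shift (- d) Lv).
  rewrite avgE nrmZ; last exact: L2D.
  have := nrmD L1v L2v; rewrite !nrm_shift// [`|2^-1|]ger0_norm ?invr_ge0//; lra.
- by move=> f g; apply/funext => x; rewrite /avg; field.
- move=> v S vS x nS; rewrite /avg !vS ?addr0 ?mul0r//.
    by have := nS (-1) isT; rewrite mulrN1z mulN1r.
  by have := nS 1 isT; rewrite mul1r.
Qed.

Lemma mult_id : multiplier 0 1 id (fun=> 1).
Proof.
split => //.
- by move=> x; rewrite normr1.
- by move=> v _; apply/funext => x; rewrite mul1r.
- by move=> v _; congr trans; apply/funext => x; rewrite mul1r.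
- by move=> v _; rewrite mul1r.
- by move=> v S vS x /(_ 0 isT); rewrite mul0r addr0 => /vS.
Qed.

Lemma mult_comp s c L p s' c' L' p' : multiplier s c L p -> multiplier s' c' L' p' ->
  multiplier (s + s') (c * c') (L \o L') (fun x => p x * p' x).
Proof.
move=> m m'; have [c0 c0'] := (mult_ge0 m, mult_ge0 m').
split.
- exact: mulr_ge0.
- exact: measurable_funM (mult_measurable m) (mult_measurable m').
- by move=> x; rewrite normrM ler_pM//; [exact: (mult_le m)|exact: (mult_le m')].
- by move=> v bv; apply: (mult_bL2 m); exact: (mult_bL2 m').
- move=> v bv; rewrite /= (mult_trans m (mult_bL2 m' bv)) (mult_trans m' bv).
  by apply/funext => x /=; rewrite mulrA.
- move=> v bv; rewrite /= (trans_mult m' bv) (trans_mult m).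
    by congr trans; apply/funext => x /=; rewrite mulrA.
  exact: bL2Mb (mult_measurable m') (mult_le m') bv.
- by move=> v Lv; apply: (mult_L2 m); exact: (mult_L2 m').
- move=> v Lv; rewrite (le_trans (mult_nrm m (mult_L2 m' Lv)))// -mulrA.
  by rewrite ler_wpM2l// (mult_nrm m').
- by move=> f g; rewrite /= (multB m') (multB m).
- move=> v S vS x nS.
  (* The outer operator is applied to the set of points that reach [S] within [s'] shifts. *)
  apply: (mult_supp m (S := fun x => exists2 i : int, `|i| <= s'%:Z & S (x + i%:~R * d))).
    by move=> y nSy; apply: (mult_supp m' vS) => i si Syi; apply: nSy; exists i.
  move=> i si [i' si']; rewrite -addrA -mulrDl -intrD; apply: nS.
  by rewrite (le_trans (ler_normD _ _))// PoszD lerD.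
Qed.

Lemma mult_comb a b s c L p c' L' p' :
    multiplier s c L p -> multiplier s c' L' p' ->
  multiplier s (`|a| * c + `|b| * c') (fun v x => a * L v x + b * L' v x)
    (fun x => a * p x + b * p' x).
Proof.
move=> m m'; have [c0 c0'] := (mult_ge0 m, mult_ge0 m').
split.
- by rewrite addr_ge0// mulr_ge0.
- by apply: measurable_funD; apply: measurable_funM => //;
    [exact: (mult_measurable m)|exact: (mult_measurable m')].
- move=> x; rewrite (le_trans (ler_normD _ _))// !normrM lerD// ler_wpM2l//.
    exact: (mult_le m).
  exact: (mult_le m').
- by move=> v bv; apply: bL2D; apply: bL2Z; [exact: (mult_bL2 m)|exact: (mult_bL2 m')].
- move=> v bv; have [b1 b2] := (mult_bL2 m bv, mult_bL2 m' bv).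
  apply/funext => x.
  rewrite (transD _ kern_cos (bL2_L1 (bL2Z a b1)) (bL2_L1 (bL2Z b b2))).
  rewrite !(transZ _ _ kern_cos); [|exact: bL2_L1..].
  by rewrite (mult_trans m bv) (mult_trans m' bv); ring.
- move=> v bv; have b1 := bL2Mb (mult_measurable m) (mult_le m) bv.
  have b2 := bL2Mb (mult_measurable m') (mult_le m') bv.
  rewrite (trans_mult m bv) (trans_mult m' bv); apply/funext => x.
  rewrite -!(transZ _ _ kern_cos); [|exact: bL2_L1..].
  rewrite -(transD _ kern_cos (bL2_L1 (bL2Z a b1)) (bL2_L1 (bL2Z b b2))).
  by congr (trans _ _ _); apply/funext => y; ring.
- by move=> v Lv; apply: L2D; apply: L2Z; [exact: (mult_L2 m)|exact: (mult_L2 m')].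
- move=> v Lv; have [b1 b2] := (mult_L2 m Lv, mult_L2 m' Lv).
  rewrite (le_trans (nrmD (L2Z a b1) (L2Z b b2)))// !nrmZ// mulrDl -!mulrA.
  by rewrite lerD// ler_wpM2l//; [exact: (mult_nrm m)|exact: (mult_nrm m')].
- by move=> f g; rewrite (multB m) (multB m'); apply/funext => x; ring.
- by move=> v S vS x nS; rewrite (mult_supp m vS nS) (mult_supp m' vS nS) !mulr0 addr0.
Qed.

Lemma mult_weaken s c L p s' c' : (s <= s')%N -> c <= c' ->
  multiplier s c L p -> multiplier s' c' L p.
Proof.
move=> ss' cc' m; split; try by case: m.
- exact: le_trans (mult_ge0 m) cc'.
- by move=> x; exact: le_trans (mult_le m x) cc'.
- by move=> v Lv; rewrite (le_trans (mult_nrm m Lv))// ler_wpM2r// nrm_ge0.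
- move=> v S vS x nS; apply: (mult_supp m vS) => i si; apply: nS.
  by rewrite (le_trans si)// lez_nat.
Qed.

Lemma mult_iter n s c L p : multiplier s c L p ->
  multiplier (n * s) (c ^+ n) (iter n L) (fun x => p x ^+ n).
Proof.
move=> m; elim: n => [|n IHn].
  have := mult_id; congr multiplier.
have := mult_comp m IHn; rewrite -mulSn -exprS.
by congr multiplier; apply/funext => x; rewrite exprS.
Qed.

(* With [z] close to [(x / r) ^ 2] for [|x| <= r], where [w] is
   [2 (pi d r) ^ 2], this multiplier is close to [1 - (z - z0) ^ 2]. *)
Definition bump (w z0 x : R) : R := 1 - ((1 - cos (2 * pi * d * x)) / w - z0) ^+ 2.

Lemma mult_bump w z0 : 0 < w -> `|z0| <= 1 ->
  exists L, multiplier 2 (1 + (2 / w + 1) ^+ 2) L (bump w z0).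
Proof.
move=> w0 z01.
have m0 := mult_weaken (leq0n 1) (lexx 1) mult_id.
(* The affine function of the cosine whose square is subtracted from 1 in [bump]. *)
have m1 := mult_comb (w^-1 - z0) (- w^-1) m0 mult_avg.
have {m1}m1 := mult_weaken (c' := 2 / w + 1) (leqnn 1) _ m1.
have le1 : `|w^-1 - z0| * 1 + `|- w^-1| * 1 <= 2 / w + 1.
  rewrite !mulr1 normrN; have := ler_normB w^-1 z0.
  by rewrite [`|w^-1|]ger0_norm ?invr_ge0 ?(ltW w0)//; lra.
have {m1}m1 := m1 le1.
have m2 := mult_comp m1 m1.
have m3 := mult_comb 1 (-1) (mult_weaken (leq0n 2) (lexx 1) mult_id) m2.
eexists; move: m3; rewrite normrN normr1 !mul1r -expr2.
congr multiplier; apply/funext => x; rewrite /bump; field.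
by rewrite gt_eqF.
Qed.

End Multipliers.

(** * Powers of the bump: large on one annulus, small away from it *)

Section Bump.
Context {R : realType}.
Implicit Types (x y t : R).

Lemma bernoulli_ge t n : 0 <= t <= 1 -> 1 - n%:R * t <= (1 - t) ^+ n.
Proof.
move=> t01; elim: n => [|n IHn]; first by rewrite mul0r subr0 expr0.
rewrite exprS -natr1; have p0 : 0 <= (1 - t) ^+ n by rewrite exprn_ge0//; lra.
have n0 : 0 <= n%:R :> R by [].
move: IHn p0; move: ((1 - t) ^+ n) => P IHn p0; nra.
Qed.

Lemma bernoulli_le t n : 0 <= t <= 1 -> (1 - t) ^+ n * (n%:R * t) <= 1.
Proof.
(* The stronger left-hand side is nonincreasing in [n], which makes the induction work. *)
move=> t01; suff : (1 - t) ^+ n * (1 + n%:R * t) <= 1.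
  have p0 : 0 <= (1 - t) ^+ n by rewrite exprn_ge0//; lra.
  by rewrite mulrDr mulr1; lra.
elim: n => [|n IHn]; first by rewrite mul0r addr0 expr0 mulr1.
apply: le_trans IHn; rewrite exprS -natr1.
have p0 : 0 <= (1 - t) ^+ n by rewrite exprn_ge0//; lra.
have n0 : 0 <= n%:R :> R by [].
have -> : (1 - t) * (1 - t) ^+ n * (1 + (n%:R + 1) * t) =
  (1 - t) ^+ n * ((1 - t) * (1 + (n%:R + 1) * t)) by ring.
by rewrite ler_wpM2l//; nra.
Qed.

Variables d r : R.
Hypotheses (d0 : 0 < d) (r0 : 0 < r) (dr : 2 * pi * d * r <= 1).

Let w : R := 2 * (pi * d * r) ^+ 2.

Definition zfun x : R := (1 - cos (2 * pi * d * x)) / w.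

Let pid0 : 0 < pi * d. Proof. by rewrite mulr_gt0 ?pi_gt0. Qed.

Lemma bump_width_gt0 : 0 < w.
Proof. by rewrite /w mulr_gt0// exprn_gt0// !mulr_gt0 ?pi_gt0. Qed.

Lemma zfunB x y : `|zfun x - zfun y| =
  `|cos (2 * pi * d * x) - cos (2 * pi * d * y)| / w.
Proof.
have w0 := bump_width_gt0.
rewrite /zfun -mulrBl normrM normfV (ger0_norm (ltW w0)) distrC.
by congr (`|_| / _); ring.
Qed.

Lemma zfun_close x y : `|zfun x - zfun y| <= `|x ^+ 2 - y ^+ 2| / r ^+ 2.
Proof.
have w0 := bump_width_gt0; rewrite zfunB ler_pdivrMr//.
rewrite (le_trans (norm_cosB_le_sqr _ _))// !exprMn -mulrBr normrM.
rewrite [`|2 ^+ 2 * _ * _|]ger0_norm; last by rewrite mulr_ge0 ?sqr_ge0// mulr_ge0 ?sqr_ge0.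
rewrite le_eqVlt; apply/orP; left; apply/eqP; rewrite /w; field.
by rewrite gt_eqF.
Qed.

(** By [dr] the arguments of the cosine stay in [[0, 1]]. The bound is quadratic because the cosine
    is flat at 0. *)
Lemma zfun_far x y : 0 <= x <= r -> 0 <= y <= r ->
  (x - y) ^+ 2 / (4 * r ^+ 2) <= `|zfun x - zfun y|.
Proof.
move=> xr yr; have w0 := bump_width_gt0; rewrite zfunB ler_pdivlMr//.
have b t : 0 <= t <= r -> 0 <= 2 * pi * d * t <= 1.
  move=> tr; have p2 : 0 < 2 * pi * d by rewrite !mulr_gt0 ?pi_gt0.
  apply/andP; split; first by rewrite mulr_ge0 ?(ltW p2)//; lra.
  by apply: le_trans dr; rewrite ler_wpM2l ?(ltW p2)//; lra.
apply: le_trans (norm_cosB_ge (b _ xr) (b _ yr)).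
rewrite le_eqVlt; apply/orP; left; apply/eqP; rewrite /w; field.
by rewrite gt_eqF.
Qed.

Lemma zfun_norm x : zfun `|x| = zfun x.
Proof.
rewrite /zfun -(cos_norm (2 * pi * d * x)) normrM (ger0_norm (_ : 0 <= 2 * pi * d))//.
by rewrite !mulr_ge0 ?pi_ge0// ltW.
Qed.

Lemma zfun0 : zfun 0 = 0.
Proof. by rewrite /zfun mulr0 cos0 subrr mul0r. Qed.

Lemma zfun_dist_le1 x y : `|x| <= r -> `|y| <= r -> `|zfun x - zfun y| <= 1.
Proof.
move=> xr yr; rewrite (le_trans (zfun_close _ _))// ler_pdivrMr ?exprn_gt0// mul1r.
rewrite -(real_normK (num_real x)) -(real_normK (num_real y)).
move: xr yr (normr_ge0 x) (normr_ge0 y); move: `|x| `|y| => a b *.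
by rewrite ler_norml; apply/andP; split; nra.
Qed.

Lemma bumpE y x : bump d w (zfun y) x = 1 - `|zfun x - zfun y| ^+ 2.
Proof. by rewrite real_normK ?num_real. Qed.

Lemma bump01 y x : `|x| <= r -> `|y| <= r -> 0 <= bump d w (zfun y) x <= 1.
Proof.
move=> xr yr; rewrite bumpE; have := zfun_dist_le1 xr yr.
by move: (normr_ge0 (zfun x - zfun y)); move: `|_ - _| => t; nra.
Qed.

(** On an annulus of width [r / m] the variable [zfun] moves by at most [2 / m]; with
    [8 * N = m ^ 2], Bernoulli's inequality loses exactly [N * (2 / m) ^ 2 = 1 / 2]. *)
Lemma bump_near (m N : nat) y x : (0 < m)%N -> (8 * N = m ^ 2)%N ->
  `|x| <= r -> 0 <= y <= r -> 0 <= `|x| - y <= r / m%:R ->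
  1 / 2 <= bump d w (zfun y) x ^+ N.
Proof.
move=> m0 NE xr yr xy.
have mR : 0 < m%:R :> R by rewrite ltr0n.
have yr' : `|y| <= r by rewrite ger0_norm; lra.
have h1 := zfun_dist_le1 xr yr'.
have h2 : `|zfun x - zfun y| <= 2 / m%:R.
  rewrite (le_trans (zfun_close _ _))// ler_pdivrMr ?exprn_gt0//.
  have -> : 2 / m%:R * r ^+ 2 = 2 * r * (r / m%:R) by ring.
  have x0 := normr_ge0 x.
  rewrite -(real_normK (num_real x)) subr_sqr normrM [`|_ - y|]ger0_norm; last lra.
  rewrite [`|_ + y|]ger0_norm; last lra.
  case/andP: xy => xy1 xy2; apply: (@le_trans _ _ ((`|x| - y) * (2 * r))).
    by rewrite ler_wpM2l//; lra.
  by rewrite mulrC ler_wpM2l//; lra.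
have n0 := normr_ge0 (zfun x - zfun y).
rewrite bumpE; have tt : 0 <= `|zfun x - zfun y| ^+ 2 <= 1.
  by rewrite sqr_ge0 expr_le1.
apply: le_trans (bernoulli_ge N tt).
have : `|zfun x - zfun y| ^+ 2 <= (2 / m%:R) ^+ 2 by rewrite ler_pXn2r ?nnegrE ?divr_ge0.
move=> /(ler_wpM2l (ler0n R N)).
have -> : N%:R * (2 / m%:R) ^+ 2 = 1 / 2 :> R.
  have : 8 * N%:R = m%:R ^+ 2 :> R by rewrite -natrX -NE natrM.
  move=> e; rewrite exprMn exprVn -e; field.
  have : 0 < m%:R ^+ 2 :> R by rewrite exprn_gt0.
  by rewrite -e => ?; apply/eqP; lra.
lra.
Qed.

(** By [bernoulli_le] the power [(1 - T) ^+ N] is at most [1 / (N * T)], where [T] is the square of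
    the gap in [zfun_far]. *)
Lemma bump_far (N : nat) rho y x : (0 < N)%N -> 0 < rho ->
  `|x| <= r -> 0 <= y <= r -> rho <= `| `|x| - y | ->
  bump d w (zfun y) x ^+ N <= 16 * r ^+ 4 / (N%:R * rho ^+ 4).
Proof.
move=> N0 rho0 xr yr xy.
have yr' : `|y| <= r by rewrite ger0_norm; lra.
have h1 := zfun_dist_le1 xr yr'.
have h2 : rho ^+ 2 / (4 * r ^+ 2) <= `|zfun x - zfun y|.
  rewrite -(zfun_norm x); apply: le_trans (zfun_far _ yr); last by rewrite normr_ge0.
  rewrite ler_wpM2r//.
    by rewrite invr_ge0 mulr_ge0// sqr_ge0.
  by rewrite -(real_normK (num_real (`|x| - y))) ler_pXn2r ?nnegrE// ltW.
have n0 := normr_ge0 (zfun x - zfun y).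
have tt : 0 <= `|zfun x - zfun y| ^+ 2 <= 1 by rewrite sqr_ge0 expr_le1.
have := bernoulli_le N tt; rewrite bumpE.
have p0 : 0 <= (1 - `|zfun x - zfun y| ^+ 2) ^+ N by rewrite exprn_ge0//; lra.
have NR : 0 < N%:R :> R by rewrite ltr0n.
have h3 : rho ^+ 4 / (16 * r ^+ 4) <= `|zfun x - zfun y| ^+ 2.
  have -> : rho ^+ 4 / (16 * r ^+ 4) = (rho ^+ 2 / (4 * r ^+ 2)) ^+ 2.
    by field; rewrite gt_eqF.
  rewrite ler_pXn2r ?nnegrE// divr_ge0 ?sqr_ge0// mulr_ge0// sqr_ge0//.
set T := `|_| ^+ 2 in tt p0 h3 *; move: p0; set P := (1 - T) ^+ N => p0 hP.
rewrite ler_pdivlMr ?mulr_gt0 ?exprn_gt0//.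
have -> : P * (N%:R * rho ^+ 4) = 16 * r ^+ 4 * (P * (N%:R * (rho ^+ 4 / (16 * r ^+ 4)))).
  by field; rewrite gt_eqF.
rewrite -[leRHS]mulr1 ler_wpM2l ?mulr_ge0// ?exprn_ge0 ?(ltW r0)//.
apply: le_trans hP; rewrite ler_wpM2l// ler_wpM2l// ltW.
Qed.

End Bump.

(** * The uncertainty argument in the core *)

Section Core.
Context {R : realType}.
Implicit Types (f g h k u : R -> R) (S Z : set R) (kap d : R) (j : nat).
Notation mu := (@lebesgue_measure R).

Lemma dot_trans_le f g : L1 f -> L1 g ->
  `|dot f (trans cos g)| <= (\int[mu]_x `|f x|) * \int[mu]_x `|g x|.
Proof.
move=> If Ig.
have I1 : L1 (fun x => f x * trans cos g x).
  have := L1_trans kern_cos Ig If.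
  by congr (L1 _); apply/funext => x; rewrite mulrC.
rewrite (le_trans (int_norm I1))// mulrC -intZ; last exact: L1_norm.
apply: le_int; [exact: L1_norm|by apply/L1Z/L1_norm|move=> x].
by rewrite normrM mulrC ler_wpM2r// trans_le//; exact: kern_cos.
Qed.

Lemma bL2_restr (A : set R) f : measurable A -> bL2 f -> bL2 (restr A f).
Proof. exact: bL2_indicM. Qed.

Lemma restr_out (A : set R) f x : ~ A x -> restr A f x = 0.
Proof. by move=> nA; rewrite /restr indicM memNset. Qed.

Lemma norm_restr_le (A : set R) f x : `|restr A f x| <= `|f x|.
Proof. by rewrite /restr normrM ler_piMl// indic_norm. Qed.

Lemma int_restr_box r f : 0 <= r -> L2 f ->
  \int[mu]_x `|restr (box r) f x| <= Num.sqrt (2 * r) * nrm (restr (box r) f).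
Proof.
move=> r0 Lf; have Lr := L2_restr (measurable_box r) Lf.
have := int_norm_le (measurable_box r) (mu_box_lty r) Lr.
by rewrite (mu_box r0) => /(_ (fun x => @restr_out _ _ x)).
Qed.

Definition annulus (a b : R) : set R := [set x | a <= `|x| <= b].

Lemma measurable_annulus a b : measurable (annulus a b).
Proof.
have mn : measurable_fun setT (fun x : R => `|x|) by exact: measurableT_comp.
have := mn measurableT [set` `[a, b]] (measurable_itv _); rewrite setTI.
by congr measurable; apply/seteqP; split => x /=; rewrite in_itv.
Qed.

Lemma annulus_cover (m : nat) r x : (0 < m)%N -> 0 < r -> box r x ->
  exists i : 'I_m, annulus (i%:R * (r / m%:R)) (i.+1%:R * (r / m%:R)) x.
Proof.
move=> m0 r0 /boxE rx.
have xr : `|x| <= r by rewrite ler_norml; lra.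
have mR : 0 < m%:R :> R by rewrite ltr0n.
have q0 : 0 < r / m%:R by rewrite divr_gt0.
pose t := `|x| / (r / m%:R).
have t0 : 0 <= t by rewrite divr_ge0// ltW.
have tm : t <= m%:R.
  by rewrite ler_pdivrMr// mulrC divfK ?gt_eqF.
have [tm'|mt] := ltnP (Num.truncn t) m.
  exists (Ordinal tm'); rewrite /annulus /= -ler_pdivlMr// -[X in _ && X]ler_pdivrMr// -/t.
  by have /andP[-> /ltW ->] := truncn_itv t0.
(* The value [|x| = r] does occur, at the closed end [- r] of the box, and is put into the last
   annulus. *)
have tE : t = m%:R.
  have h1 : (Num.truncn t)%:R <= t by rewrite truncn_le.
  have h2 : m%:R <= (Num.truncn t)%:R :> R by rewrite ler_nat.
  by apply/eqP; rewrite eq_le tm (le_trans h2 h1).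
have m1 : (m.-1 < m)%N by rewrite prednK.
exists (Ordinal m1); rewrite /annulus /= -ler_pdivlMr// -[X in _ && X]ler_pdivrMr// -/t tE.
by rewrite !ler_nat prednK// leqnn leq_pred.
Qed.

Lemma pigeonhole_annulus (m : nat) r f : (0 < m)%N -> 0 < r -> L2 f ->
    (forall x, ~ box r x -> f x = 0) ->
  exists i : 'I_m, nrm f ^+ 2 <=
    m%:R * nrm (restr (annulus (i%:R * (r / m%:R)) (i.+1%:R * (r / m%:R))) f) ^+ 2.
Proof.
move=> m0 r0 Lf fr.
pose E (i : 'I_m) := annulus (i%:R * (r / m%:R)) (i.+1%:R * (r / m%:R)).
pose a i := nrm (restr (E i) f) ^+ 2.
have LE i : L2 (restr (E i) f) by exact: L2_restr (measurable_annulus _ _) Lf.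
have sum_ge : nrm f ^+ 2 <= \sum_i a i.
  rewrite nrm2; under eq_bigr do rewrite /a nrm2 /dot.
  rewrite -int_sum; last by move=> i _; exact: L2M.
  apply: le_int; [exact: L2M|by apply: L1_sum => i _; exact: L2M|move=> x].
  have [bx|nbx] := pselect (box r x); last first.
    by rewrite (fr _ nbx) mul0r sumr_ge0// => i _; rewrite -expr2 sqr_ge0.
  have [i Eix] := annulus_cover m0 r0 bx.
  rewrite (bigD1 i)//= /restr [X in _ <= X * X + _]indicM mem_set//.
  by rewrite lerDl sumr_ge0// => j _; rewrite -expr2 sqr_ge0.
have [i _ ai] := @Order.TotalTheory.arg_maxP _ _ _ (Ordinal m0) xpredT a isT.
exists i; rewrite (le_trans sum_ge)//.
apply: (@le_trans _ _ (\sum_(l < m) a i)); first by apply: ler_sum => l _; exact: ai.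
by rewrite sumr_const card_ord mulr_natl.
Qed.

(** The pairing of [u] with its transform is nearly [nrm u ^+ 2], and the part outside of the core
    accounts for at most [1 / 8] of it. With [tau <= 3 / 8] half of it is left to the core, where it
    is at most [2 * quad j0] times the squared core norm. *)
Lemma core_mass kap j0 S u tau : (4 <= j0)%N ->
    0 <= kap -> 36 * kap <= (1 / 32) ^+ 2 -> thin kap j0 S ->
    tau <= 3 / 8 -> bL2 u -> (forall x, ~ S x -> u x = 0) ->
    L2 (fun x => trans cos u x - u x) ->
    nrm (fun x => trans cos u x - u x) <= tau * nrm u ->
  nrm u ^+ 2 <= 4 * quad j0 * nrm (restr (box (quad j0)) u) ^+ 2.
Proof.
move=> j04 kap0 kap36 tS tau38 bu uS LD nD.
have Lu := bL2_L2 bu; have q0 := @quad_gt0 R j0.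
have := thin_bound j04 kap0 kap36 tS bu bu uS uS.
set B := dot u _; set Bc := dot (restr _ u) _ => tb.
have hB : nrm u ^+ 2 <= B + tau * nrm u ^+ 2.
  have LC : L2 (trans cos u).
    by have := L2D LD Lu; congr (L2 _); apply/funext => x; rewrite subrK.
  have : B = dot u u + dot u (fun x => trans cos u x - u x).
    by rewrite -dotDr//; congr dot; apply/funext => x; rewrite addrC subrK.
  move=> ->; rewrite -nrm2; have := dot_le Lu LD; rewrite ler_norml => /andP[+ _].
  by have := nrm_ge0 u; nra.
have hBc : `|Bc| <= 2 * quad j0 * nrm (restr (box (quad j0)) u) ^+ 2.
  have bc := bL2_restr (measurable_box (quad j0)) bu.
  rewrite (le_trans (dot_trans_le (bL2_L1 bc) (bL2_L1 bc)))//.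
  have := int_restr_box (ltW q0) Lu; have : 0 <= \int[mu]_x `|restr (box (quad j0)) u x|.
    by apply: int_ge0.
  set I := \int[mu]_x _ => I0 Ile.
  rewrite (le_trans (ler_pM I0 I0 Ile Ile))// mulrACA -!expr2 sqr_sqrtr//.
  by rewrite mulr_ge0// ltW.
have := ler_norm (B - Bc); have := ler_norm Bc.
by have := nrm_ge0 u; nra.
Qed.

End Core.

(** * Vanishing of approximate fixed points with fine support *)

Section CoreArgument.
Context {R : realType}.
Implicit Types (f g h k u : R -> R) (S Z : set R) (kap d : R) (j : nat).
Notation mu := (@lebesgue_measure R).

Lemma restr_in (A : set R) f x : A x -> restr A f x = f x.
Proof. by move=> Ax; rewrite /restr indicM mem_set. Qed.

Definition two_intervals (y rho : R) : set R :=
  [set` `[y - rho, y + rho]] `|` [set` `[- y - rho, - y + rho]].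

Lemma measurable_two_intervals y rho : measurable (two_intervals y rho).
Proof. by apply: measurableU; exact: measurable_itv. Qed.

Lemma mu_two_intervals y rho : 0 <= rho ->
  (mu (two_intervals y rho) <= (4 * rho)%:E)%E.
Proof.
move=> rho0.
have : (mu (two_intervals y rho) <=
    mu [set` `[(y - rho)%R, (y + rho)%R]] +
    mu [set` `[(- y - rho)%R, (- y + rho)%R]])%E.
  by apply: measureU2; exact: measurable_itv.
rewrite !mu_itv; [|lra..] => /le_trans; apply.
by rewrite -EFinD lee_fin; lra.
Qed.

Lemma two_intervals_out y rho x : ~ two_intervals y rho x -> rho <= `| `|x| - y |.
Proof.
move=> nx; rewrite leNgt; apply/negP; rewrite ltr_norml => /andP[h1 h2].
apply: nx; case: (ler0P x) h1 h2 => _ h1 h2; [right|left]; rewrite /= in_itv /=;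
  by apply/andP; split; lra.
Qed.

(** Both factors are measured in L1. The core has length [2 * r] and the two intervals have total
    length [4 * rho], so the part of [k] on the intervals costs the root of [8 * r * rho]; the rest
    of [k] is small by hypothesis. *)
Lemma core_form_le r rho eta U y h k : 0 <= r -> 0 <= rho -> 0 <= eta -> 0 <= U ->
    8 * r * rho <= 1 / 64 -> bL2 h -> bL2 k ->
    nrm (restr (~` two_intervals y rho) (restr (box r) k)) <= eta * U ->
  `|dot (restr (box r) h) (trans cos (restr (box r) k))| <=
  1 / 8 * nrm h * nrm k + 2 * r * eta * nrm h * U.
Proof.
move=> r0 rho0 eta0 U0 rrho bh bk kW.
have mW := measurable_two_intervals y rho.
have mb := @measurable_box R r.
have [Lh Lk] := (bL2_L2 bh, bL2_L2 bk).
have [bhc bkc] := (bL2_restr mb bh, bL2_restr mb bk).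
have bW := bL2_restr mW bkc; have bN := bL2_restr (measurableC mW) bkc.
rewrite (le_trans (dot_trans_le (bL2_L1 bhc) (bL2_L1 bkc)))//.
have H := int_norm_restr_box r0 Lh.
have Wlty : (mu (two_intervals y rho) < +oo)%E.
  by apply: le_lt_trans (mu_two_intervals y rho0) (ltry _).
have KW : \int[mu]_x `|restr (two_intervals y rho) (restr (box r) k) x| <=
    Num.sqrt (4 * rho) * nrm k.
  have := int_norm_le mW Wlty (bL2_L2 bW) (fun x => @restr_out _ _ _ x).
  move=> /le_trans; apply; rewrite ler_pM ?sqrtr_ge0 ?nrm_ge0//.
    rewrite ler_wsqrtr// -lee_fin fineK ?mu_two_intervals//.
    by rewrite ge0_fin_numE.
  by rewrite (le_trans (nrm_restr mW (bL2_L2 bkc)))// nrm_restr.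
have KN : \int[mu]_x `|restr (~` two_intervals y rho) (restr (box r) k) x| <=
    Num.sqrt (2 * r) * (eta * U).
  have out x : ~ box r x -> restr (~` two_intervals y rho) (restr (box r) k) x = 0.
    by move=> xr; rewrite /restr !indicM (memNset xr); case: ifP.
  have := int_norm_le mb (mu_box_lty r) (bL2_L2 bN) out.
  by rewrite (mu_box r0) => /le_trans; apply; rewrite ler_wpM2l// sqrtr_ge0.
have K : \int[mu]_x `|restr (box r) k x| <=
    Num.sqrt (4 * rho) * nrm k + Num.sqrt (2 * r) * (eta * U).
  apply: le_trans (lerD KW KN).
  rewrite -intD; [|by apply: L1_norm; exact: bL2_L1..].
  apply: le_int; [by apply: L1_norm; exact: bL2_L1| |move=> x].
    by apply: L1D; apply: L1_norm; exact: bL2_L1.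
  have [Wx|nWx] := pselect (two_intervals y rho x).
    by rewrite (restr_in _ Wx) lerDl.
  by rewrite (restr_in _ (nWx : (~` two_intervals y rho) x)) lerDr.
have I0 f : 0 <= \int[mu]_x `|f x| by exact: int_ge0.
rewrite (le_trans (ler_pM (I0 _) (I0 _) H K))//.
have s1 : Num.sqrt (2 * r) * Num.sqrt (4 * rho) <= 1 / 8 :> R.
  rewrite -sqrtrM ?mulr_ge0// -(@ger0_norm _ (1 / 8 : R))// -sqrtr_sqr ler_wsqrtr//.
  by lra.
have s2 : Num.sqrt (2 * r) * Num.sqrt (2 * r) = 2 * r :> R.
  by rewrite -expr2 sqr_sqrtr// mulr_ge0.
rewrite mulrDr lerD//.
  rewrite mulrACA -[leRHS]mulrA ler_wpM2r// mulr_ge0// nrm_ge0//.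
rewrite mulrACA s2 le_eqVlt; apply/orP; left; apply/eqP; ring.
Qed.

(* The number of annuli in the core [box (quad j)], and the power to which the
   bump is raised, as required by [core_constants] and [bump_near]. *)
Definition ncells (j : nat) : nat := 2 ^ (33 + 14 * j).
Definition npow (j : nat) : nat := 2 ^ (63 + 28 * j).

Lemma ncells_npow j : (8 * npow j = ncells j ^ 2)%N.
Proof. by rewrite /npow /ncells -expnM (_ : 8 = 2 ^ 3)%N// -expnD; congr (2 ^ _)%N; lia. Qed.

(* The numerical conclusion of the argument: [a], [b], [U] are the norms of [h],
   [k] and [u], [e] bounds the error of [u] being an approximate fixed point and
   [16 * r * m * b ^+ 2] bounds the mass of [u]. *)
Lemma norms_vanish (a b U r m e eta : R) : 0 <= a -> 0 <= b -> 0 <= U ->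
    a ^+ 2 + b ^+ 2 <= 2 * e * U ^+ 2 + 1 / 2 * a * b + 4 * r * eta * a * U ->
    U ^+ 2 <= 16 * r * m * b ^+ 2 ->
    0 <= r -> 0 <= m -> 0 <= e -> 0 <= eta ->
    256 * r * m * (r * eta) ^+ 2 <= 1 / 4 -> 32 * r * m * e <= 1 / 4 ->
  U = 0.
Proof.
move=> a0 b0 U0 h1 h2 r0 m0 e0 eta0 c1 c2.
(* The two squares absorb [a * b] and [a * U] into the left-hand side, which eliminates [a]. *)
have h3 : 3 / 4 * b ^+ 2 <= 2 * e * U ^+ 2 + 16 * (r * eta) ^+ 2 * U ^+ 2.
  have := sqr_ge0 (a - b); have := sqr_ge0 (a / 2 - 4 * r * eta * U); nra.
have h4 : 3 / 4 * U ^+ 2 <= 16 * r * m * (2 * e * U ^+ 2 + 16 * (r * eta) ^+ 2 * U ^+ 2).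
  have rm : 0 <= 16 * r * m by rewrite !mulr_ge0.
  have := ler_wpM2l rm h3; lra.
have U2 := sqr_ge0 U.
have := ler_wpM2r U2 c1; have := ler_wpM2r U2 c2.
move=> t1 t2; have : U ^+ 2 <= 0 by lra.
by move=> U2'; apply/eqP; rewrite -sqrf_eq0 eq_le U2' U2.
Qed.

Lemma ncells_quad j : (ncells j)%:R = 2 ^+ 33 * quad j ^+ 7 :> R.
Proof.
rewrite /ncells natrX exprD /quad -exprM (_ : 4 = 2 ^+ 2); last by rewrite expr2; ring.
by rewrite -exprM; congr (_ * _ ^+ _); lia.
Qed.

(** The width [rho = 1 / (2 ^ 9 * r)] attains equality in the second condition. Then
    [r * eta = 2 ^ 43 * r ^ 9 / m ^ 2], and the last condition becomes [m ^ 3 >= 2 ^ 96 * r ^ 19],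
    which explains the size of [m]. *)
Lemma core_constants (r : R) (m N : nat) : 1 <= r -> m%:R = 2 ^+ 33 * r ^+ 7 ->
    (8 * N = m ^ 2)%N ->
  exists rho eta : R, [/\ 0 < rho, 8 * r * rho <= 1 / 64, 0 <= eta,
    16 * r ^+ 4 / (N%:R * rho ^+ 4) = eta &
    256 * r * m%:R * (r * eta) ^+ 2 <= 1 / 4].
Proof.
move=> r1 mE mN; have r0 : 0 < r := lt_le_trans ltr01 r1.
have rn0 := lt0r_neq0 r0.
have NE : N%:R = m%:R ^+ 2 / 8 :> R by rewrite -natrX -mN natrM mulrC mulKf.
have rho0 : 0 < (2 ^+ 9 * r)^-1 by rewrite invr_gt0 pmulr_rgt0 ?exprn_gt0.
exists (2 ^+ 9 * r)^-1, (16 * r ^+ 4 / (N%:R * (2 ^+ 9 * r)^-1 ^+ 4)); split => //.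
- by rewrite le_eqVlt; apply/orP; left; apply/eqP; field; rewrite ?rn0.
- apply: divr_ge0; apply: mulr_ge0 => //; first exact: exprn_ge0 (ltW r0).
  exact: exprn_ge0 (ltW rho0).
have mn0 : m%:R != 0 :> R by rewrite mE mulf_neq0// ?expf_neq0.
have -> : r * (16 * r ^+ 4 / (N%:R * (2 ^+ 9 * r)^-1 ^+ 4)) =
    2 ^+ 43 * r ^+ 9 / m%:R ^+ 2 by rewrite NE; field; rewrite ?rn0 ?mn0.
rewrite mE.
have -> : 256 * r * (2 ^+ 33 * r ^+ 7) * (2 ^+ 43 * r ^+ 9 / (2 ^+ 33 * r ^+ 7) ^+ 2) ^+ 2 =
    (2 ^+ 5 * r ^+ 2)^-1 :> R by field; rewrite ?rn0.
have : 1 <= r ^+ 2 by rewrite exprn_ege1.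
by move=> ?; rewrite -div1r ler_pdivrMr; lra.
Qed.

Lemma core_tau (r m c : R) : 1 <= r -> 1 <= m -> 1 <= c ->
  exists tau : R, [/\ 0 < tau, tau <= 3 / 8 & 32 * r * m * (c ^+ 2 * tau) <= 1 / 4].
Proof.
move=> r1 m1 c1.
have rm1 : 1 <= r * m * c ^+ 2 by rewrite !mulr_ege1// exprn_ege1.
exists ((r * m * c ^+ 2)^-1 / 128); split.
- by rewrite divr_gt0// invr_gt0; lra.
- have : (r * m * c ^+ 2)^-1 <= 1 by rewrite invf_le1; lra.
  by lra.
rewrite le_eqVlt; apply/orP; left; apply/eqP; field.
by rewrite !gt_eqF//; lra.
Qed.

(* [h] is obtained from [u] by finitely many shifts by multiples of [d] that
   concentrate its transform [k] (within the core) near [+- y], in a set too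
   small for a function supported in the core to have a large transform there. *)
Lemma core_step kap j0 S Z d (m N : nat) (rho eta : R) : (4 <= j0)%N ->
    0 <= kap -> 36 * kap <= (1 / 32) ^+ 2 -> thin kap j0 S ->
    0 < d -> 2 * pi * d * quad j0 <= 1 -> (0 < m)%N -> (8 * N = m ^ 2)%N ->
    0 < rho -> 8 * quad j0 * rho <= 1 / 64 -> 0 <= eta ->
    16 * quad j0 ^+ 4 / (N%:R * rho ^+ 4) = eta ->
    256 * quad j0 * m%:R * (quad j0 * eta) ^+ 2 <= 1 / 4 ->
    (forall x (i : int), `|i| <= (N * 2)%N%:Z -> Z (x + i%:~R * d) -> S x) ->
  exists2 tau, 0 < tau & forall u, bL2 u -> (forall x, ~ Z x -> u x = 0) ->
    L2 (fun x => trans cos u x - u x) ->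
    nrm (fun x => trans cos u x - u x) <= tau * nrm u -> nrm u = 0.
Proof.
move=> j04 kap0 kap36 tS d0 dr m0 mN rho0 rrho eta0 etaD etale ZS.
have r1 : 1 <= quad j0 :> R by exact: quad_ge1.
have cm u tau := @core_mass R kap j0 S u tau j04 kap0 kap36 tS.
have tb h k := @thin_bound R kap j0 S h k j04 kap0 kap36 tS.
move: (@quad R j0) r1 dr rrho etaD etale cm tb => r r1 dr rrho etaD etale cm tb.
have r0 : 0 < r := lt_le_trans ltr01 r1.
have N0 : (0 < N)%N.
  by rewrite lt0n; apply: contraTneq m0 => N0; move: mN; rewrite N0 muln0 => /esym/eqP; rewrite expn_eq0 => /andP[/eqP ->].
have mR : 0 < m%:R :> R by rewrite ltr0n.
have mR1 : 1 <= m%:R :> R by rewrite ler1n.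
have rn0 := lt0r_neq0 r0; have mn0 := lt0r_neq0 mR.
pose w : R := 2 * (pi * d * r) ^+ 2.
have w0 : 0 < w by exact: bump_width_gt0.
pose c : R := (1 + (2 / w + 1) ^+ 2) ^+ N.
have c1 : 1 <= c by rewrite exprn_ege1// lerDl sqr_ge0.
have [tau [tau0 tau38 taule]] := core_tau r1 mR1 c1.
exists tau => // u bu uZ LD nD.
have Lu := bL2_L2 bu.
have uS x : ~ S x -> u x = 0.
  by move=> nS; apply: uZ => Zx; apply: nS; apply: (ZS x 0) => //; rewrite mul0r addr0.
have mass := cm u tau tau38 bu uS LD nD.
have buc := bL2_restr (measurable_box r) bu.
have [i Ei] := pigeonhole_annulus m0 r0 (bL2_L2 buc) (fun x => @restr_out _ _ _ x).
set y := i%:R * (r / m%:R) in Ei; set E := annulus y _ in Ei.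
have q0 : 0 < r / m%:R by rewrite divr_gt0.
have yr : 0 <= y <= r.
  rewrite /y mulr_ge0 ?(ltW q0)//= mulrCA ger_pMr// ler_pdivrMr// mul1r ler_nat.
  exact: ltnW.
have yr' : `|y| <= r by case/andP: (yr) => y0 y1; rewrite ger0_norm.
have z1 : `|zfun d r y| <= 1.
  have := zfun_dist_le1 d0 r0 yr' (_ : `|0| <= r); rewrite zfun0 subr0; apply.
  by rewrite normr0 ltW.
have [L0 M0] := mult_bump d w0 z1.
have M := mult_iter N M0; move: M.
set L := iter N L0; set p := fun x => _ => M.
pose h := L u; pose k x := p x * u x.
have bh : bL2 h := mult_bL2 M bu.
have bk : bL2 k := bL2Mb (mult_measurable M) (mult_le M) bu.
have [Lh Lk] := (bL2_L2 bh, bL2_L2 bk).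
have hS x : ~ S x -> h x = 0.
  by move=> nS; apply: (mult_supp M uZ) => l ls Zx; apply: nS; exact: ZS Zx.
have kS x : ~ S x -> k x = 0 by move=> nS; rewrite /k (uS _ nS) mulr0.
have c0 : 0 <= c := le_trans ler01 c1.
have nu0 := nrm_ge0 u.
have nh : nrm h <= c * nrm u := mult_nrm M Lu.
have nk : nrm k <= c * nrm u.
  apply: nrm_le => // x; rewrite /k normrM ler_wpM2r//; exact: (mult_le M).
set B := dot h (trans cos k).
have e0 : 0 <= c ^+ 2 * tau by rewrite mulr_ge0 ?sqr_ge0// ltW.
(* Here [C k - h = L (C u - u)], and for [Bk] below [C h - k = p * (C u - u)]; either error is at
   most [c * tau * nrm u], while [nrm h] and [nrm k] are at most [c * nrm u]. *)
have Bh : nrm h ^+ 2 <= B + c ^+ 2 * tau * nrm u ^+ 2.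
  have LLD := mult_L2 M LD.
  have := mult_nrm M LD; move: LLD; rewrite (multB M) (trans_mult M bu) -/k -/h => LLD nLD.
  have LC : L2 (trans cos k).
    by have := L2D LLD Lh; congr (L2 _); apply/funext => x; rewrite subrK.
  have -> : B = dot h h + dot h (fun x => trans cos k x - h x).
    by rewrite -dotDr//; congr dot; apply/funext => x; rewrite addrC subrK.
  rewrite -nrm2; have := dot_le Lh LLD; rewrite ler_norml => /andP[+ _].
  have : nrm h * nrm (fun x => trans cos k x - h x) <= (c * nrm u) * (c * (tau * nrm u)).
    by rewrite ler_pM ?nrm_ge0// (le_trans nLD)// ler_wpM2l.
  by clear; nra.
have Bk : nrm k ^+ 2 <= B + c ^+ 2 * tau * nrm u ^+ 2.
  have LpD := L2Mb (mult_measurable M) (mult_le M) LD.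
  have npD : nrm (fun x => p x * (trans cos u x - u x)) <= c * (tau * nrm u).
    apply: (@le_trans _ _ (c * nrm (fun x => trans cos u x - u x))).
      by apply: nrm_le => // x; rewrite normrM ler_wpM2r//; exact: (mult_le M).
    by rewrite ler_wpM2l.
  have LC : L2 (trans cos h).
    rewrite (mult_trans M bu); have := L2D LpD Lk; congr (L2 _); apply/funext => x.
    by rewrite /k; ring.
  have -> : B = dot k k + dot k (fun x => p x * (trans cos u x - u x)).
    rewrite -dotDr//; rewrite /B dotC (trans_sym kern_cos (bL2_L1 bk) (bL2_L1 bh)).
    rewrite (mult_trans M bu); congr dot; apply/funext => x; rewrite /k; ring.
  rewrite -nrm2; have := dot_le Lk LpD; rewrite ler_norml => /andP[+ _].
  have : nrm k * nrm (fun x => p x * (trans cos u x - u x)) <= (c * nrm u) * (c * (tau * nrm u)).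
    by rewrite ler_pM ?nrm_ge0.
  by clear; nra.
have kW : nrm (restr (~` two_intervals y rho) (restr (box r) k)) <= eta * nrm u.
  have bkc := bL2_restr (measurable_box r) bk.
  apply: nrm_le => //.
    exact: bL2_L2 (bL2_restr (measurableC (measurable_two_intervals _ _)) bkc).
  move=> x; have [bx|/restr_out nb] := pselect (box r x); last first.
    by rewrite (le_trans (norm_restr_le _ _ _))// nb normr0 mulr_ge0.
  have [Wx|nW] := pselect (two_intervals y rho x).
    by rewrite restr_out ?normr0 ?mulr_ge0//; move=> /(_ Wx).
  rewrite (restr_in _ (nW : (~` two_intervals y rho) x)) (restr_in _ bx) /k normrM.
  rewrite ler_wpM2r//.
  have xr : `|x| <= r by move/boxE: bx => bx; rewrite ler_norml; move: bx; clear; lra.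
  have /andP[p0 p1] := bump01 d0 r0 xr yr'.
  rewrite ger0_norm ?exprn_ge0//.
  rewrite -etaD; exact: (bump_far d0 r0 dr N0 rho0 xr yr (two_intervals_out nW)).
have {}tb := tb h k bh bk hS kS.
have cf := core_form_le (ltW r0) (ltW rho0) eta0 nu0 rrho bh bk kW.
(* On the chosen annulus [p] is at least [1 / 2], so [k] retains half of [u] there. *)
have nE : nrm (restr E (restr (box r) u)) <= 2 * nrm k.
  apply: nrm_le => //.
    exact: bL2_L2 (bL2_restr (measurable_annulus _ _) buc).
  move=> x; have [bx|/restr_out nb] := pselect (box r x); last first.
    by rewrite (le_trans (norm_restr_le _ _ _))// nb normr0 mulr_ge0.
  have [Ex|nEx] := pselect (E x); last by rewrite restr_out// normr0 mulr_ge0.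
  rewrite (restr_in _ Ex) (restr_in _ bx) /k normrM mulrA ler_peMl//.
  have xr : `|x| <= r by move/boxE: bx => bx; rewrite ler_norml; move: bx; clear; lra.
  have xy : 0 <= `|x| - y <= r / m%:R.
    move: Ex; rewrite /E /annulus /= -natr1 mulrDl mul1r -/y => /andP[+ +].
    by clear => ? ?; apply/andP; split; lra.
  have := bump_near d0 r0 m0 mN xr yr xy.
  by have := ler_norm (p x); rewrite /p; clear; lra.
apply: (@norms_vanish (nrm h) (nrm k) (nrm u) r m%:R (c ^+ 2 * tau) eta);
  rewrite ?nrm_ge0 ?(ltW r0)//.
- have := ler_norm (B - dot (restr (box r) h) (trans cos (restr (box r) k))).
  have := ler_norm (dot (restr (box r) h) (trans cos (restr (box r) k))).
  by move: tb cf Bh Bk; rewrite -/B; clear; lra.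
(* The mass of [u] passes to [k] with the factors [4 * r] (core), [m] (annulus) and [4] (bump). *)
- have := nrm_ge0 (restr E (restr (box r) u)); move: Ei nE mass.
  set s := nrm (restr E _); set t := nrm (restr _ u) => Ei nE mass s0.
  have : s ^+ 2 <= 4 * nrm k ^+ 2 by have := nrm_ge0 k; move: nE s0; clear; nra.
  move=> /(ler_wpM2l (ltW mR)) s4; have /(ler_wpM2l (ltW r0)) := le_trans Ei s4; move: mass; clear; lra.
Qed.

Lemma core_argument kap j0 S Z d : (4 <= j0)%N ->
    0 <= kap -> 36 * kap <= (1 / 32) ^+ 2 -> thin kap j0 S ->
    0 < d -> 2 * pi * d * quad j0 <= 1 ->
    (forall x (i : int), `|i| <= (npow j0 * 2)%N%:Z -> Z (x + i%:~R * d) -> S x) ->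
  exists2 tau, 0 < tau & forall u, bL2 u -> (forall x, ~ Z x -> u x = 0) ->
    L2 (fun x => trans cos u x - u x) ->
    nrm (fun x => trans cos u x - u x) <= tau * nrm u -> nrm u = 0.
Proof.
move=> j04 kap0 kap36 tS d0 dr ZS.
have m0 : (0 < ncells j0)%N by rewrite expn_gt0.
have [rho [eta [rho0 rrho eta0 etaD etale]]] :=
  core_constants (quad_ge1 j0) (ncells_quad j0) (ncells_npow j0).
exact: core_step j04 kap0 kap36 tS d0 dr m0 (ncells_npow j0) rho0 rrho eta0 etaD etale ZS.
Qed.

End CoreArgument.

(** * The set *)

Section TheSet.
Context {R : realType}.
Notation mu := (@lebesgue_measure R).

(* Chosen so that [36 * (16 * frac) <= (1 / 32) ^+ 2], see [sparse_thin] and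
   [thin_bound]. *)
Definition frac : R := (2 ^+ 20)^-1.

Lemma frac_gt0 : 0 < frac. Proof. by rewrite invr_gt0 exprn_gt0. Qed.

Lemma frac_le1 : frac <= 1.
Proof. by rewrite invf_le1 ?exprn_gt0// exprn_ege1// ler1n. Qed.

Definition near_int (t : R) := exists i : int, i%:~R <= t < i%:~R + frac.

(* On [[n, n + 1)] the set has period [2 ^ - |n|] and density [frac]. *)
Definition sparse_set : set R := [set x | exists n : int,
  n%:~R <= x < n%:~R + 1 /\ near_int (2 ^+ `|n|%N * x)].

Lemma mu_bigU_le (K : nat) (I : nat -> set R) (c : R) :
    (forall i, measurable (I i)) -> (forall i, (mu (I i) <= c%:E)%E) ->
  measurable (\big[setU/set0]_(i < K) I i) /\
  (mu (\big[setU/set0]_(i < K) I i) <= (K%:R * c)%:E)%E.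
Proof.
move=> mI Ic; elim: K => [|K [mK IHK]].
  rewrite big_ord0 mul0r; split; first exact: measurable0.
  by rewrite measure0.
rewrite big_ord_recr /=; split; first exact: measurableU.
have U2 := @measureU2 _ _ _ mu _ _ mK (mI K).
by apply: (le_trans U2); rewrite -natr1 mulrDl mul1r EFinD;
  apply: leeD; [exact: IHK|exact: Ic].
Qed.

(** With [L = |al| * l], at most [2 * L + 2] integers are relevant, each contributing an interval of
    length [frac / |al|]; [1 <= L] bounds their number by [4 * L]. *)
Lemma cover_near_int (al be s l : R) : 0 <= l -> 1 <= `|al| * l ->
  exists W : set R, [/\ measurable W,
    forall x, s <= x < s + l -> near_int (al * x + be) -> W x &
    (mu W <= (4 * frac * l)%:E)%E].
Proof.
move=> l0 all; set L := `|al| * l in all.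
have f0 := frac_gt0; have f1 := frac_le1.
have al0 : 0 < `|al| by rewrite normr_gt0; apply: contraTneq all; rewrite /L => ->; rewrite normr0 mul0r -ltNge.
have aln : al != 0 by rewrite -normr_gt0.
pose v := al * s + be; pose i0 := Num.floor (v - L).
(* Centres and radii, rather than endpoints, treat both signs of [al] at once. *)
pose ctr (i : nat) := (i0%:~R + i%:R + frac / 2 - be) / al.
pose I (i : nat) : set R := [set` `[ctr i - frac / 2 / `|al|, ctr i + frac / 2 / `|al|]].
pose K := (Num.truncn (2 * L + 1)).+1.
have mI i : measurable (I i) by exact: measurable_itv.
have rad0 : 0 <= frac / 2 / `|al| by rewrite !divr_ge0// ltW.
have muI i : (mu (I i) <= (frac / `|al|)%:E)%E.
  by rewrite /I mu_itv; [rewrite lee_fin; lra|lra].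
have [mU muU] := mu_bigU_le K mI muI.
exists (\big[setU/set0]_(i < K) I i); split => //; last first.
  apply: le_trans muU _; rewrite lee_fin.
  have Kle : K%:R <= 4 * L.
    rewrite /K -natr1; have : (Num.truncn (2 * L + 1))%:R <= 2 * L + 1.
      by rewrite truncn_le; lra.
    by lra.
  apply: (@le_trans _ _ (4 * L * (frac / `|al|))).
    by rewrite ler_wpM2r// divr_ge0// ltW.
  rewrite /L le_eqVlt; apply/orP; left; apply/eqP; field.
  by rewrite gt_eqF.
move=> x sx [i /andP[i1 i2]].
have xv : `|al * x + be - v| <= L.
  rewrite /v (_ : _ - _ = al * (x - s)); last by ring.
  by rewrite normrM ler_wpM2l ?(ltW al0)// ger0_norm; lra.
move: xv; rewrite ler_norml => /andP[xv1 xv2].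
have /andP[fl1 fl2] := floor_itv (v - L); rewrite -/i0 in fl1 fl2.
have ii0 : (i0 <= i)%R.
  rewrite -ltzD1 -(ltr_int R) intrD; lra.
have [k kE] : exists k : nat, i = i0 + k%:Z.
  by exists (absz (i - i0)); rewrite gez0_abs ?subr_ge0// addrCA subrr addr0.
have iR : i%:~R = i0%:~R + k%:R :> R by rewrite kE intrD.
have kK : (k < K)%N.
  rewrite /K ltnS truncn_ge_nat; last by lra.
  by rewrite intrD in fl2; lra.
rewrite -bigcup_mkord; exists k => //.
rewrite /I /= in_itv /=.
have : `|x - ctr k| <= frac / 2 / `|al|.
  rewrite ler_pdivlMr// -normrM.
  have -> : (x - ctr k) * al = al * x + be - (i0%:~R + k%:R + frac / 2).
    by rewrite /ctr; field.
  by rewrite ler_norml; apply/andP; split; lra.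
by rewrite ler_norml => /andP[? ?]; apply/andP; split; lra.
Qed.

Lemma near_int_shift (t : R) (i : int) : near_int (t + i%:~R) -> near_int t.
Proof.
by move=> [k /andP[k1 k2]]; exists (k - i); rewrite intrB; apply/andP; split; lra.
Qed.

End TheSet.

(** * Thinness of similar images and their shifts *)

Section SparseThin.
Context {R : realType}.
Notation mu := (@lebesgue_measure R).

Lemma quad_dominates (C : R) : exists j0 : nat, [/\ (4 <= j0)%N, C <= j0%:R &
  forall j, (j0 <= j)%N -> C * (1 + j%:R) <= quad j].
Proof.
pose n := (Num.truncn C).+1; have Cn : C < n%:R by exact: truncnS_gt.
exists (4 + n)%N; split; first by rewrite leq_addr.
  by rewrite natrD; have : 0 <= 4%:R :> R by []; lra.
move=> j nj; have -> : quad j = 2 ^+ j * 2 ^+ j :> R.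
  by rewrite /quad -exprMn; congr (_ ^+ _); ring.
have p2 : 1 + j%:R <= 2 ^+ j :> R.
  by rewrite -natrX nat1r ler_nat ltn_expl.
have j0 : 0 <= j%:R :> R by [].
have nj' : n%:R <= j%:R :> R by rewrite ler_nat; lia.
apply: (@le_trans _ _ (2 ^+ j * (1 + j%:R))); last by rewrite ler_wpM2l// exprn_ge0.
by rewrite ler_wpM2r//; lra.
Qed.

(** The image [r1 * X + r2] together with its reflection, which supports the even part of a function
    living on the image. *)
Definition sym_image (r1 r2 : R) : set R :=
  [set x | exists b : bool, sparse_set (((-1) ^+ b * x - r2) / r1)].

Lemma near_int_dyadic_shift (t : R) (q : int) (N n : nat) : (N <= n)%N ->
  near_int (2 ^+ n * (t + q%:~R / 2 ^+ N)) -> near_int (2 ^+ n * t).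
Proof.
move=> Nn; rewrite mulrDr (_ : 2 ^+ n * (_ / _) = (q * 2 ^+ (n - N))%:~R).
  exact: near_int_shift.
rewrite intrM rmorphXn /= -{1}(subnK Nn) exprD; field.
by rewrite expf_neq0.
Qed.

(** [S] is a union of very many translates, so counting them is hopeless. Pulled back by the
    similarity, however, a shift by a multiple of [d] is a multiple of [2 ^- N0], hence of the
    period at every level [n] with [N0 <= |n|], and leaves the condition [near_int] unchanged. Only
    the level can change, between two neighbours; two levels and two signs at [4 * frac] each give
    [16 * frac]. *)
Lemma sparse_thin (r1 r2 : R) : r1 != 0 -> exists j0 (d : R) (S : set R),
  [/\ (4 <= j0)%N, 0 < d, 2 * pi * d * quad j0 <= 1, thin (16 * frac) j0 S &
   forall x (i : int), `|i| <= (npow j0 * 2)%N%:Z -> sym_image r1 r2 (x + i%:~R * d) -> S x].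
Proof.
move=> r10; have a0 : 0 < `|r1| by rewrite normr_gt0.
pose K0 := (Num.truncn `|r1|).+1.
have K0r : `|r1| <= 2 ^+ K0.
  have h1 : `|r1| < K0%:R by exact: truncnS_gt.
  have h2 : K0%:R <= 2 ^+ K0 :> R by rewrite -natrX ler_nat ltnW// ltn_expl.
  by lra.
(* The bound [C * (1 + j) <= quad j] forces the high levels stated in [nlarge]; the last summand
   makes the mesh at most [|r1| / 4]. *)
pose C := `|r1| * (97 + K0%:R) + `|r2| + 4 / `|r1|.
have [j0 [j04 Cj0 Cquad]] := quad_dominates C.
clearbody K0.
have K00 : 0 <= K0%:R :> R by [].
have r20 := normr_ge0 r2.
have q0 : 0 < 4 / `|r1| by rewrite divr_gt0.
(* The multipliers of [d] are bounded by [npow j0 * 2 = 2 ^ (64 + 28 * j0)]; two more binary digits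
   keep every displacement within [|r1| / 4], and [K0] absorbs [|r1|] in the bound on [d]. *)
pose N0 := (66 + K0 + 28 * j0)%N.
pose d := `|r1| / 2 ^+ N0.
have p0 n : 0 < 2 ^+ n :> R by rewrite exprn_gt0.
have d0 : 0 < d by rewrite divr_gt0.
have le2 (a b : nat) : (a <= b)%N -> 2 ^+ a <= 2 ^+ b :> R.
  by move=> ab; rewrite ler_weXn2l// ler1n.
exists j0, d.
exists [set x | exists2 i : int, `|i| <= (npow j0 * 2)%N%:Z & sym_image r1 r2 (x + i%:~R * d)].
split => //; [|move=> j m j0j cs|by move=> x i iP Zx; exists i].
- rewrite /d /quad; have := @pi_lt4 R; have := @pi_ge0 R => pi0 pi4.
  have h : 2 ^+ 3 * 2 ^+ K0 * 4 ^+ j0 <= 2 ^+ N0 :> R.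
    rewrite (_ : 4 = 2 ^+ 2); last by rewrite expr2; ring.
    rewrite -exprM -!exprD; apply: le2; rewrite /N0; clear; lia.
  have -> : 2 * pi * (`|r1| / 2 ^+ N0) * 4 ^+ j0 = 2 * pi * `|r1| * 4 ^+ j0 / 2 ^+ N0 by ring.
  rewrite ler_pdivrMr// mul1r (le_trans _ h)// ler_wpM2r ?exprn_ge0//.
  apply: (@le_trans _ _ (8 * `|r1|)); first by nra.
  by have -> : 2 ^+ 3 = 8 :> R; [rewrite -natrX|rewrite ler_wpM2l].
- set l := mesh j; have l0 : 0 < l by exact: mesh_gt0.
  set a := m%:~R * l.
  have j0R : j0%:R <= j%:R :> R by rewrite ler_nat.
  have jR : 0 <= j%:R :> R by [].
  have lr : l <= `|r1| / 4.
    have h1 : 4 / `|r1| <= 4 ^+ (4 * j).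
      apply: (@le_trans _ _ j0%:R); first by rewrite (le_trans _ Cj0)// /C; nra.
      apply: (le_trans j0R); rewrite -natrX ler_nat.
      rewrite (leq_trans (ltnW (ltn_expl j (isT : 1 < 4)%N)))//.
      by rewrite leq_exp2l// leq_pmull.
    by rewrite /l /mesh -invf_div lef_pV2// posrE ?exprn_gt0.
  (* A cell and a shift each move the pulled back point by at most [1 / 4]. It stays within [1 / 2]
     of the preimage of the end [a] of the cell, so its level is [fl b] or [fl b - 1]. *)
  pose fl b := Num.floor ((((-1) ^+ b * a - r2) / r1) + 1 / 2).
  (* Only at high levels is the period known to be finer than the mesh; low levels receive the empty
     set and are ruled out by [nlarge]. *)
  have cov (b : bool) (n : int) : exists W : set R, [/\ measurable W,
     (66 + K0 + 28 * j <= `|n|)%N -> forall x, a <= x < a + l ->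
       near_int (2 ^+ `|n|%N * (((-1) ^+ b * x - r2) / r1)) -> W x &
     (mu W <= (4 * frac * l)%:E)%E].
    have [big|small] := leqP (66 + K0 + 28 * j)%N `|n|%N; last first.
      exists set0; split; [exact: measurable0|by []|].
      by rewrite measure0 lee_fin !mulr_ge0 ?(ltW l0)// ltW// frac_gt0.
    have al1 : 1 <= `|(-1) ^+ b * 2 ^+ `|n|%N / r1| * l.
      rewrite !normrM normrX normrN1 expr1n mul1r normfV (ger0_norm (ltW (p0 _))).
      rewrite mulrAC ler_pdivlMr// mul1r /l /mesh ler_pdivlMr ?exprn_gt0//.
      apply: (@le_trans _ _ (2 ^+ K0 * 4 ^+ (4 * j))).
        by rewrite ler_wpM2r// exprn_ge0.
      rewrite (_ : 4 = 2 ^+ 2); last by rewrite expr2; ring.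
      by rewrite -exprM -exprD; apply: le2; move: big; clear; lia.
    have [W [mW Wc muW]] := cover_near_int (- (2 ^+ `|n|%N * r2 / r1)) a (ltW l0) al1.
    exists W; split => // _ x xa nx; apply: Wc => //.
    by move: nx; congr near_int; field.
  have {}cov b n := cid (cov b n).
  pose W b n := sval (cov b n).
  have mW b n : measurable (W b n) by case: (svalP (cov b n)).
  have muW b n : (mu (W b n) <= (4 * frac * l)%:E)%E by case: (svalP (cov b n)).
  pose V b := W b (fl b - 1) `|` W b (fl b).
  have mV b : measurable (V b) by apply: measurableU.
  have muV b : (mu (V b) <= (8 * frac * l)%:E)%E.
    apply: (le_trans (@measureU2 _ _ _ mu _ _ (mW b _) (mW b _))).
    apply: (le_trans (leeD (muW b _) (muW b _))).
    by rewrite -EFinD lee_fin; lra.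
  exists (V true `|` V false); split; first exact: measurableU; last first.
    apply: (le_trans (@measureU2 _ _ _ mu _ _ (mV true) (mV false))).
    apply: (le_trans (leeD (muV true) (muV false))).
    by rewrite -EFinD lee_fin; lra.
  move=> x [[i iP [b [n [nx nearx]]]] xcell].
  have [_ xq] := cs x xcell.
  have /cellE := xcell; rewrite -/l -/a => /andP[ax xal].
  suff : V b x by case: (b); [left|right].
  move: nx nearx; set x' := (_ / r1) => /andP[nx xn] nearx.
  have xqj : quad j <= `|x|.
    rewrite leNgt; apply/negP => /ltr_normlP[h1 h2]; apply: xq; apply/boxE; lra.
  have iR : `|i%:~R : R| <= 2 ^+ (64 + 28 * j0).
    have : (`|i|%:~R : R) <= (npow j0 * 2)%N%:Z%:~R by rewrite ler_int.
    rewrite intr_norm => /le_trans; apply.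
    by rewrite /npow -expnSr -pmulrn natrX.
  have N0E : 2 ^+ N0 = 4 * (2 ^+ K0 * 2 ^+ (64 + 28 * j0)) :> R.
    rewrite -exprD (_ : 4 = 2 ^+ 2); last by rewrite expr2; ring.
    by rewrite -exprD; congr (_ ^+ _); rewrite /N0; clear; lia.
  have K01 : 1 <= 2 ^+ K0 :> R by rewrite exprn_ege1// ler1n.
  have iN : `|i%:~R : R| / 2 ^+ N0 <= 1 / 4.
    rewrite ler_pdivrMr// N0E.
    by have := p0 (64 + 28 * j0)%N; move: iR K01; nra.
  have idr : `|i%:~R * d| <= `|r1| / 4.
    rewrite normrM (gtr0_norm d0) /d mulrCA ler_wpM2l ?(ltW a0)//; lra.
  pose x'' := ((-1) ^+ b * x - r2) / r1.
  pose q : int := (-1) ^+ b * (if 0 < r1 then 1 else -1) * i.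
  have dr1 : d / r1 = (if 0 < r1 then 1 else -1) / 2 ^+ N0.
    rewrite /d; case: ifP => [r1p|/negbT]; first by rewrite gtr0_norm//; field; rewrite r10 expf_neq0.
    by rewrite -leNgt => r1n; rewrite ler0_norm//; field; rewrite r10 expf_neq0.
  have x'E : x' = x'' + q%:~R / 2 ^+ N0.
    rewrite /x' /x'' mulrDr /q !intrM rmorphXn /= rmorphN1.
    have -> : ((if 0 < r1 then 1 else -1) : int)%:~R = (if 0 < r1 then 1 else -1) :> R.
      by case: ifP; rewrite ?rmorphN1.
    have -> : ((-1) ^+ b * x + (-1) ^+ b * (i%:~R * d) - r2) / r1 =
       ((-1) ^+ b * x - r2) / r1 + (-1) ^+ b * i%:~R * (d / r1) by field.
    rewrite dr1; congr (_ + _); case: ifP => _; move: ((-1) ^+ b : R) => e; ring.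
  have qn : `|q| = `|i|.
    rewrite /q !normrM normrX normrN1 expr1n mul1r.
    by case: (0 < r1); rewrite ?normrN1 ?normr1 mul1r.
  have qi : `|q%:~R / 2 ^+ N0 : R| <= 1 / 4.
    by rewrite normrM normfV (gtr0_norm (p0 _)) -intr_norm qn intr_norm.
  have nlarge : (66 + K0 + 28 * j <= `|n|)%N.
    have x'r1 : `|x'| * `|r1| = `|(-1) ^+ b * (x + i%:~R * d) - r2|.
      by rewrite -normrM /x' divfK.
    have h1 : `|x| - `|i%:~R * d| - `|r2| <= `|x'| * `|r1|.
      rewrite x'r1; apply: le_trans (lerB_dist _ _).
      rewrite [`|_ * (x + _)|]normrM normrX normrN1 expr1n mul1r lerD2r.
      by have := lerB_dist x (- (i%:~R * d)); rewrite normrN opprK.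
    have h2 := Cquad j j0j.
    have h3 : `|r1| * (67 + K0%:R + 28 * j%:R) <= `|x'| * `|r1|.
      apply: le_trans h1; rewrite /C in h2.
      have := mulr_ge0 jR (mulr_ge0 (ltW a0) K00); have := mulr_ge0 jR r20.
      have := mulr_ge0 jR (ltW q0); have := mulr_ge0 jR (ltW a0).
      by move: h2 idr xqj q0 a0; clear; lra.
    have h4 : 67 + K0%:R + 28 * j%:R <= `|x'|.
      by rewrite -(ler_pM2r a0) mulrC.
    have h5 : `|x'| <= `|n|%N%:R + 1.
      have nR : `|n%:~R : R| = `|n|%N%:R by rewrite -intr_norm -abszE.
      have := ler_norm (n%:~R : R); have := ler_norm (- n%:~R : R); rewrite normrN nR.
      by rewrite ler_norml; move: nx xn; clear => *; apply/andP; split; lra.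
    by rewrite -(ler_nat R) natrD (natrD R 66) (natrM R 28); move: h4 h5; clear; lra.
  have nearx'' : near_int (2 ^+ `|n|%N * x'').
    by rewrite x'E in nearx; apply: near_int_dyadic_shift nearx; rewrite /N0;
      move: nlarge j0j; clear; lia.
  have Wn : W b n x.
    have [_ Wc _] := svalP (cov b n).
    by apply: (Wc nlarge x _ nearx''); rewrite ax xal.
  have xv : `|x'' - ((-1) ^+ b * a - r2) / r1| <= 1 / 4.
    have -> : x'' - ((-1) ^+ b * a - r2) / r1 = (-1) ^+ b * (x - a) / r1.
      by rewrite /x''; field.
    rewrite !normrM normrX normrN1 expr1n mul1r normfV ler_pdivrMr// ger0_norm; move: ax xal lr; clear; lra.
  have /andP[f1 f2] := floor_itv (((-1) ^+ b * a - r2) / r1 + 1 / 2).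
  rewrite -/(fl b) in f1 f2; rewrite intrD in f2.
  have hq : `|x' - ((-1) ^+ b * a - r2) / r1| <= 1 / 2.
    rewrite x'E addrAC (le_trans (ler_normD _ _))//; move: xv qi; clear; lra.
  move: hq; rewrite ler_norml => /andP[hq1 hq2].
  have n1 : (n <= fl b)%R by rewrite -ltzD1 -(ltr_int R) intrD; move: nx hq2 f2; clear; lra.
  have n2 : (fl b - 1 <= n)%R.
    by rewrite -ltzD1 -(ltr_int R) !intrD; move: xn hq1 f1; clear; lra.
  have [nE|nE] : n = fl b \/ n = fl b - 1 by move: n1 n2; clear; lia.
    by right; rewrite -nE.
  by left; rewrite -nE.
Qed.

End SparseThin.

(** * Measurability and constant density of the set *)

Section SparseDensity.
Context {R : realType}.
Notation mu := (@lebesgue_measure R).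

Lemma measurable_sparse_set : measurable (@sparse_set R).
Proof.
pose F (p : int * int) : set R := [set` `[p.1%:~R, p.1%:~R + 1[] `&`
  [set` `[p.2%:~R / 2 ^+ `|p.1|%N, (p.2%:~R + frac) / 2 ^+ `|p.1|%N[].
have -> : @sparse_set R = \bigcup_p F p.
  apply/seteqP; split => x.
    move=> [n [nx [i /andP[i1 i2]]]]; exists (n, i) => //; split; rewrite /= in_itv //=.
    by rewrite ler_pdivrMr ?exprn_gt0// ltr_pdivlMr ?exprn_gt0// mulrC i1 i2.
  move=> [[n i] _ [/=]]; rewrite !in_itv /= => nx.
  rewrite ler_pdivrMr ?exprn_gt0// ltr_pdivlMr ?exprn_gt0// => xi.
  by exists n; split => //; exists i; rewrite mulrC.
apply: countable_bigcupT_measurable => // p.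
by apply: measurableI; exact: measurable_itv.
Qed.

(** The unit interval contains [2 ^ |n|] disjoint pieces of length [frac / 2 ^ |n|]. Disjointness
    enters through indicators: a point lies in at most one piece, so their sum is at most the
    indicator of the set. *)
Lemma mu_sparse_ge (n : int) :
  (frac%:E <= mu (@sparse_set R `&` [set` `[n%:~R%R, (n%:~R + 1)%R]]))%E.
Proof.
set A := _ `&` _.
have mA : measurable A.
  by apply: measurableI; [exact: measurable_sparse_set|exact: measurable_itv].
have Alty : (mu A < +oo)%E.
  have h : (mu A <= mu [set` `[n%:~R%R, (n%:~R + 1)%R]])%E.
    by apply: le_measure; rewrite ?inE//; exact: subIsetr.
  by apply: (le_lt_trans h); rewrite mu_itv ?ltry//; lra.
pose K := (2 ^ `|n|)%N; have K0 : 0 < K%:R :> R by rewrite ltr0n expn_gt0.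
have KE : 2 ^+ `|n|%N = K%:R :> R by rewrite natrX.
have f0 := @frac_gt0 R; have f1 := @frac_le1 R.
pose a (i : nat) : R := n%:~R + i%:R / K%:R.
pose I (i : nat) : set R := [set` `[a i, a i + frac / K%:R[].
have fK : 0 < frac / K%:R :> R by rewrite divr_gt0.
have mI i : measurable (I i) by exact: measurable_itv.
have muI i : mu (I i) = (frac / K%:R)%:E.
  by rewrite /I mu_itv; [congr (_%:E); ring|lra].
have LI i : L1 (\1_(I i) : R -> R) by apply: L1_indic => //; rewrite muI ltry.
have xI i x : (x \in I i) = (i%:R <= K%:R * (x - n%:~R) < i%:R + frac).
  have iE : i%:R = K%:R * (i%:R / K%:R) :> R by field; rewrite gt_eqF.
  have fE : frac = K%:R * (frac / K%:R) :> R by field; rewrite gt_eqF.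
  rewrite /I /a; move: iE fE.
  move: (i%:R / K%:R) (frac / K%:R) => p w -> ->.
  rewrite -mulrDr ler_pM2l// ltr_pM2l//.
  apply/idP/idP => [/set_mem|h]; first by rewrite /= in_itv /=; lra.
  by apply/mem_set; rewrite /= in_itv /=; lra.
have sumI : \int[mu]_x (\sum_(i < K) (\1_(I i) x : R)) = frac.
  rewrite int_sum// (eq_bigr (fun=> frac / K%:R)); last first.
    by move=> i _; rewrite int_indic// muI.
  by rewrite sumr_const card_ord -mulr_natr; field; rewrite gt_eqF.
have : \int[mu]_x (\sum_(i < K) (\1_(I i) x : R)) <= \int[mu]_x (\1_A x : R).
  apply: le_int; [by apply: L1_sum|exact: L1_indic|move=> x].
  have [[i xi]|no] := pselect (exists i : 'I_K, x \in I i); last first.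
    by rewrite big1// => i _; rewrite indicE; case: (boolP (x \in I i)) => // xi; case: no; exists i.
  rewrite (bigD1 i)//= big1 ?addr0; last first.
    move=> l li; rewrite indicE; case: (boolP (x \in I l)) => // xl.
    move: xi xl; rewrite !xI => /andP[i1 i2] /andP[l1 l2].
    have il1 : ((i : nat) < l.+1)%N by rewrite -(ltr_nat R) -natr1; lra.
    have il2 : ((l : nat) < i.+1)%N by rewrite -(ltr_nat R) -natr1; lra.
    by case/eqP: li; apply/val_inj/anti_leq/andP; split; rewrite -ltnS.
  rewrite !indicE xi mem_set//.
  move: xi; rewrite xI => /andP[i1 i2].
  have iK : (i : nat)%:R + 1 <= K%:R :> R by rewrite natr1 ler_nat ltn_ord.
  have h0 : 0 <= x - n%:~R.
    by rewrite -(pmulr_rge0 _ K0); apply: le_trans i1.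
  have h1 : x - n%:~R < 1 by rewrite -(ltr_pM2l K0) mulr1; lra.
  split; last by rewrite /= in_itv /=; apply/andP; split; lra.
  exists n; split; first by apply/andP; split; lra.
  (* Scaling by [K] sends the left end of the unit interval to the integer [K * n]. *)
  exists (i%:Z + (K%:Z * n)); rewrite KE intrD intrM; apply/andP; split; lra.
rewrite sumI int_indic// -lee_fin fineK// ge0_fin_numE//.
Qed.

(** A window of length 2 contains a unit interval with integral ends, so its density is at least
    [frac / 2]; [frac / 4] makes the inequality strict. *)
Lemma sparse_constant_density : constant_density (@sparse_set R).
Proof.
have f0 := @frac_gt0 R.
exists 2, (frac / 4); split => //; first by rewrite divr_gt0.
move=> r; pose n := Num.ceil r.
have /andP[n1 n2] := ceil_itv r; rewrite -/n in n1 n2.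
set A := _ `&` _.
have mA : measurable A.
  by apply: measurableI; [exact: measurable_sparse_set|exact: measurable_itv].
have Age : (frac%:E <= mu A)%E.
  apply: (le_trans (mu_sparse_ge n)); apply: le_measure; rewrite ?inE//.
    by apply: measurableI; [exact: measurable_sparse_set|exact: measurable_itv].
  apply: setIS => x /=; rewrite !in_itv /=; rewrite intrB in n1; lra.
have Alty : (mu A < +oo)%E.
  have h : (mu A <= mu [set` `[r, (r + 2)%R]])%E.
    by apply: le_measure; rewrite ?inE//; exact: subIsetr.
  by apply: (le_lt_trans h); rewrite mu_itv ?ltry//; lra.
have Afin : mu A \is a fin_num by rewrite ge0_fin_numE.
rewrite -(fineK Afin) in Age *; rewrite inver pnatr_eq0 /= -EFinM lte_fin.
rewrite lee_fin in Age; lra.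
Qed.

End SparseDensity.

(** * Reduction to the cosine transform *)

Section Reduction.
Context {R : realType}.
Notation mu := (@lebesgue_measure R).
Notation ReC := (@complex.Re R).
Notation ImC := (@complex.Im R).

(** Closed at both ends, to agree with [truncate]. *)
Definition ball_set (n : nat) : set R := [set x | `|x| <= n%:R].

Lemma measurable_ball_set n : measurable (ball_set n).
Proof.
have -> : ball_set n = [set` `[(- n%:R), n%:R]].
  by apply/seteqP; split=> x; rewrite /ball_set /= in_itv /= ler_norml.
exact: measurable_itv.
Qed.

Lemma tail_small (w : R -> R) (sg : R) : L2 w -> 0 < sg ->
  exists N : nat, forall n, (N <= n)%N ->
    nrm (fun x => w x - restr (ball_set n) w x) <= sg.
Proof.
move=> Lw sg0; have [mw w2] := Lw.
have Lr n : L2 (restr (ball_set n) w) by exact: L2_restr (measurable_ball_set n) Lw.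
pose F x := (w x ^+ 2)%:E.
have mF : measurable_fun setT F by apply/measurable_EFinP; exact: measurable_funX.
have cvgF : (\int[mu]_(x in ball_set n) F x @[n --> \oo] -->
    \int[mu]_(x in \bigcup_n ball_set n) F x)%E.
  apply: ge0_nondecreasing_set_cvg_integral.
  - move=> m n mn; apply/subsetPset => x; rewrite /ball_set /= => /le_trans; apply.
    by rewrite ler_nat.
  - by move=> n; exact: measurable_ball_set.
  - by move=> n; exact: measurable_funTS.
  - by move=> n x _; rewrite lee_fin sqr_ge0.
have UT : \bigcup_n ball_set n = setT.
  apply/seteqP; split => // x _; exists (Num.truncn `|x|).+1 => //.
  by rewrite /ball_set /= ltW// truncnS_gt.
rewrite UT (intE w2) in cvgF.
have FnE n : (\int[mu]_(x in ball_set n) F x = (dot (restr (ball_set n) w) w)%:E)%E.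
  rewrite integral_mkcond -intE; last exact: L2M.
  apply: eq_integral => x _; rewrite patchE /restr indicM.
  by case: ifP => //; rewrite ?mul0r.
have FE : (fun n => \int[mu]_(x in ball_set n) F x)%E =
    (fun n => (dot (restr (ball_set n) w) w)%:E) by apply/funext.
rewrite FE in cvgF.
move/fine_cvgP : cvgF => [_] /cvgrPdist_lt /(_ (sg ^+ 2)).
rewrite exprn_gt0// => /(_ isT) [N _ NP].
exists N => n Nn; have /= := NP n Nn.
have -> : \int[mu]_x w x ^+ 2 = dot w w by [].
move=> lt; rewrite -(@ler_pXn2r _ 2)// ?nnegrE ?nrm_ge0 ?(ltW sg0)// nrm2.
(* Restriction is an orthogonal projection, so the squared norm of the tail is a difference of two
   integrals. *)
have rr : dot (restr (ball_set n) w) (restr (ball_set n) w) = dot (restr (ball_set n) w) w.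
  by apply: eq_int => x; rewrite /restr !indicM; case: ifP; rewrite ?mul0r.
rewrite (dotBl Lw (Lr n) (L2B Lw (Lr n))) !(dotBr Lw (Lr n))// rr subrr subr0.
rewrite (dotC w (restr _ _)); apply: le_trans (ltW lt); exact: ler_norm.
Qed.

Lemma normc_sqr (z : R[i]) : ComplexField.Normc.normc z ^+ 2 = ReC z ^+ 2 + ImC z ^+ 2.
Proof. by case: z => a b /=; rewrite sqr_sqrtr// addr_ge0 ?sqr_ge0. Qed.

Lemma L2norm_sqr (f : R -> R[i]) :
  (L2norm f `^ 2 = \int[mu]_x (ReC (f x) ^+ 2 + ImC (f x) ^+ 2)%:E)%E.
Proof.
rewrite /L2norm poweR_Lnorm//; apply: eq_integral => x _ /=.
have n0 : 0 <= ComplexField.Normc.normc (f x).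
  by case: (f x) => a b /=; exact: sqrtr_ge0.
by rewrite -normc_sqr -(powR_mulrn 2 n0) -{2}(ger0_norm n0).
Qed.

Lemma L2norm_lt (f : R -> R[i]) (c : R) : measurable_cfun f -> 0 <= c ->
    (L2norm f < c%:E)%E ->
  [/\ L2 (ReC \o f), L2 (ImC \o f), nrm (ReC \o f) <= c & nrm (ImC \o f) <= c].
Proof.
move=> [mr mi] c0 fc.
have h : (\int[mu]_x (ReC (f x) ^+ 2 + ImC (f x) ^+ 2)%:E <= (c ^+ 2)%:E)%E.
  rewrite -L2norm_sqr -(@powR_mulrn _ c 2)// -poweR_EFin.
  apply: gt0_ler_poweR => //; rewrite ?in_itv /= ?leey ?andbT ?lee_fin//.
    exact: Lnorm_ge0.
  exact: ltW.
have part (g : R -> R) : measurable_fun setT g ->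
    (forall x, g x ^+ 2 <= ReC (f x) ^+ 2 + ImC (f x) ^+ 2) -> L2 g /\ nrm g <= c.
  move=> mg gle.
  have hg : (\int[mu]_x (g x ^+ 2)%:E <= (c ^+ 2)%:E)%E.
    apply: le_trans h; apply: ge0_le_integral => //.
    - by move=> x _; rewrite lee_fin sqr_ge0.
    - by apply/measurable_EFinP; exact: measurable_funX.
    - by apply/measurable_EFinP; apply: measurable_funD; exact: measurable_funX.
    - by move=> x _; rewrite lee_fin.
  have Lg : L2 g.
    split => //; apply/integrableP; split.
      by apply/measurable_EFinP; exact: measurable_funX.
    apply: (@le_lt_trans _ _ (c ^+ 2)%:E); last exact: ltry.
    apply: le_trans hg; rewrite le_eqVlt; apply/orP; left; apply/eqP.
    by apply: eq_integral => x _ /=; rewrite ger0_norm// sqr_ge0.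
  split => //; rewrite -(@ler_pXn2r _ 2)// ?nnegrE ?nrm_ge0// nrm2 -lee_fin.
  by rewrite (intE Lg.2) in hg.
have [L1r n1] := part _ mr (fun x => ltac:(by rewrite lerDl sqr_ge0)).
have [L1i n2] := part _ mi (fun x => ltac:(by rewrite lerDr sqr_ge0)).
by [].
Qed.

Lemma L2norm_eq1 (f : R -> R[i]) : measurable_cfun f -> L2norm f = 1%E ->
  [/\ L2 (ReC \o f), L2 (ImC \o f) & nrm (ReC \o f) ^+ 2 + nrm (ImC \o f) ^+ 2 = 1].
Proof.
move=> mf f1; have [Lr Li _ _] := @L2norm_lt f 2 mf ltac:(by []) ltac:(by rewrite f1 lte_fin ltr1n).
split => //; have := L2norm_sqr f; rewrite f1 poweR1r => h.
apply: EFin_inj; rewrite [RHS]h !nrm2 /dot -intD; [|exact: L2M..].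
by rewrite -intE//; apply: L1D; exact: L2M.
Qed.

Lemma truncate_Re n (f : R -> R[i]) : ReC \o truncate n f = restr (ball_set n) (ReC \o f).
Proof.
apply/funext => x; rewrite /truncate /restr indicM /=.
case: ifP => xn; first by rewrite mem_set.
by rewrite memNset// /ball_set /= xn.
Qed.

Lemma truncate_Im n (f : R -> R[i]) : ImC \o truncate n f = restr (ball_set n) (ImC \o f).
Proof.
apply/funext => x; rewrite /truncate /restr indicM /=.
case: ifP => xn; first by rewrite mem_set.
by rewrite memNset// /ball_set /= xn.
Qed.

Lemma bL2_restr_ball n (w : R -> R) : L2 w -> bL2 (restr (ball_set n) w).
Proof.
move=> Lw; split; first exact: L2_restr (measurable_ball_set n) Lw.
exists (n%:R + 1) => // x xn; apply: restr_out; rewrite /ball_set /=.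
by apply: contra_not xn; rewrite ler_norml => xn; apply/boxE; lra.
Qed.

Lemma fourier_Re (f : R -> R[i]) x : L1 (ReC \o f) -> L1 (ImC \o f) ->
  ReC (fourier_integral f x) = trans cos (ReC \o f) x + trans sin (ImC \o f) x.
Proof.
move=> Ir Ii; rewrite /trans -intD; [|exact: trans_L1 kern_cos Ir|exact: trans_L1 kern_sin Ii].
apply: eq_int => y; rewrite /expi /=; case: (f y) => a b /=.
by rewrite cosN sinN; ring.
Qed.

Lemma fourier_Im (f : R -> R[i]) x : L1 (ReC \o f) -> L1 (ImC \o f) ->
  ImC (fourier_integral f x) = trans cos (ImC \o f) x - trans sin (ReC \o f) x.
Proof.
move=> Ir Ii; rewrite /trans -intB; [|exact: trans_L1 kern_cos Ii|exact: trans_L1 kern_sin Ir].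
apply: eq_int => y; rewrite /expi /=; case: (f y) => a b /=.
by rewrite cosN sinN; ring.
Qed.

End Reduction.

(** * Even parts and fixed points of the cosine transform *)

Section EvenPart.
Context {R : realType}.
Implicit Types (a b u v : R -> R).

Definition even_part v : R -> R := fun x => 2^-1 * (v x + v (- x)).

Lemma even_part_bL2 v : bL2 v -> bL2 (even_part v).
Proof. by move=> bv; apply/bL2Z/bL2D => //; exact: bL2_opp. Qed.

Lemma even_part_L2 v : L2 v -> L2 (even_part v).
Proof. by move=> Lv; apply/L2Z/L2D => //; exact: L2_opp. Qed.

Lemma nrm_even_part v : L2 v -> nrm (even_part v) <= nrm v.
Proof.
move=> Lv; have Lo := L2_opp Lv; rewrite nrmZ; last exact: L2D.
by have := nrmD Lv Lo; rewrite nrm_opp// [`|2^-1|]ger0_norm ?invr_ge0//; lra.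
Qed.

Lemma trans_cosN v x : trans cos v (- x) = trans cos v x.
Proof. by apply: eq_int => y; rewrite mulrN mulNr cosN. Qed.

Lemma trans_sinN v x : L1 v -> trans sin v (- x) = - trans sin v x.
Proof.
move=> Iv; rewrite -[RHS]mulN1r /trans -intZ; last exact: trans_L1 kern_sin Iv.
by apply: eq_int => y; rewrite mulrN mulNr sinN mulN1r mulNr.
Qed.

Lemma trans_cos_opp v x : L1 v -> trans cos (fun y => v (- y)) x = trans cos v x.
Proof.
move=> Iv; rewrite -[RHS]trans_cosN.
apply: etrans (L1_int_opp (trans_L1 (- x) kern_cos Iv)).2; apply: eq_int => y.
by rewrite !mulrN !mulNr opprK.
Qed.

Lemma trans_cos_even_part v : bL2 v -> trans cos (even_part v) = trans cos v.
Proof.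
move=> bv; have bo := bL2_opp bv; apply/funext => x.
rewrite (transZ _ _ kern_cos (bL2_L1 (bL2D bv bo))).
rewrite (transD _ kern_cos (bL2_L1 bv) (bL2_L1 bo)) trans_cos_opp; last exact: bL2_L1.
by field.
Qed.

(* The transform [a + i b -> a + i b] reads [a = Ca + Sb], [b = Cb - Sa], where
   [C], [S] are the cosine and sine transforms. As [S] is symmetric, the cross
   terms of the pairing with [(a, b)] cancel, so that [C] alone nearly preserves
   the norm of [(a, b)]; and [Ca] only depends on the even part of [a]. *)
Lemma even_part_fixed a b (sg : R) : bL2 a -> bL2 b -> 0 <= sg -> sg <= 1 / 32 ->
    nrm a <= 1 -> nrm b <= 1 -> 3 / 8 <= nrm a ^+ 2 + nrm b ^+ 2 ->
    L2 (fun x => a x - (trans cos a x + trans sin b x)) ->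
    L2 (fun x => b x - (trans cos b x - trans sin a x)) ->
    nrm (fun x => a x - (trans cos a x + trans sin b x)) <= sg ->
    nrm (fun x => b x - (trans cos b x - trans sin a x)) <= sg ->
  exists2 u, u = even_part a \/ u = even_part b &
    [/\ L2 (fun x => trans cos u x - u x), nrm (fun x => trans cos u x - u x) <= sg &
        1 / 16 <= nrm u].
Proof.
move=> ba bb sg0 sg1 na nb nab; set v1 := (fun x => a x - _); set v2 := (fun x => b x - _).
move=> L1v L2v n1 n2.
have [La Lb] := (bL2_L2 ba, bL2_L2 bb).
have [Ia Ib] := (bL2_L1 ba, bL2_L1 bb).
have dotT (phi f g : R -> R) : kern phi -> L1 f -> bL2 g -> L1 (fun x => trans phi f x * g x).
  by move=> kphi If bg; exact: L1_trans kphi If (bL2_L1 bg).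
(* Taking even parts removes the sine transform, which is odd, and keeps the cosine transform. *)
have e1 : even_part v1 = (fun x => even_part a x - trans cos a x).
  by apply/funext => x; rewrite /even_part /v1 trans_cosN (trans_sinN _ Ib); field.
have e2 : even_part v2 = (fun x => even_part b x - trans cos b x).
  by apply/funext => x; rewrite /even_part /v2 trans_cosN (trans_sinN _ Ia); field.
have close w v : bL2 w -> L2 v -> nrm v <= sg ->
    even_part v = (fun x => even_part w x - trans cos w x) ->
    L2 (fun x => trans cos (even_part w) x - even_part w x) /\
    nrm (fun x => trans cos (even_part w) x - even_part w x) <= sg.
  move=> bw Lv nv eE.
  have -> : (fun x => trans cos (even_part w) x - even_part w x) =
      (fun x => - even_part v x).
    by rewrite eE trans_cos_even_part//; apply/funext => x; rewrite opprB.
  split; first exact/L2N/even_part_L2.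
  by rewrite nrmN (le_trans (nrm_even_part Lv)).
have dot1 : dot v1 a = dot a a - (dot (trans cos a) a + dot (trans sin b) a).
  rewrite /dot -(intD (dotT _ _ _ kern_cos Ia ba) (dotT _ _ _ kern_sin Ib ba)).
  rewrite -(intB (L2M La La)); last exact: L1D (dotT _ _ _ kern_cos Ia ba) (dotT _ _ _ kern_sin Ib ba).
  by apply: eq_int => x; rewrite /v1; ring.
have dot2 : dot v2 b = dot b b - (dot (trans cos b) b - dot (trans sin a) b).
  rewrite /dot -(intB (dotT _ _ _ kern_cos Ib bb) (dotT _ _ _ kern_sin Ia bb)).
  rewrite -(intB (L2M Lb Lb)); last exact: L1B (dotT _ _ _ kern_cos Ib bb) (dotT _ _ _ kern_sin Ia bb).
  by apply: eq_int => x; rewrite /v2; ring.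
have cross : dot (trans sin b) a = dot (trans sin a) b.
  by rewrite (trans_sym kern_sin Ib Ia) dotC.
have evenC w v : bL2 w -> even_part v = (fun x => even_part w x - trans cos w x) -> L2 v ->
    dot (even_part v) w = dot (even_part w) w - dot (trans cos w) w.
  move=> bw eE Lv; rewrite eE /dot -intB; [|exact: L2M (even_part_L2 (bL2_L2 bw)) (bL2_L2 bw)|].
    by apply: eq_int => x; rewrite mulrBl.
  exact: dotT kern_cos (bL2_L1 bw) bw.
have small w v : L2 w -> L2 v -> nrm w <= 1 -> nrm v <= sg -> `|dot v w| <= sg.
  move=> Lw Lv nw nv; rewrite (le_trans (dot_le Lv Lw))//.
  by rewrite -[leRHS]mulr1 ler_pM ?nrm_ge0.
have s1 := small _ _ La L1v na n1; have s2 := small _ _ Lb L2v nb n2.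
have s3 := small _ _ La (even_part_L2 L1v) na (le_trans (nrm_even_part L1v) n1).
have s4 := small _ _ Lb (even_part_L2 L2v) nb (le_trans (nrm_even_part L2v) n2).
rewrite (evenC _ _ ba e1 L1v) in s3; rewrite (evenC _ _ bb e2 L2v) in s4.
rewrite dot1 -nrm2 in s1; rewrite dot2 -nrm2 in s2; rewrite cross in s1.
(* Adding the four estimates gives at least [3 / 8 - 4 * sg], whence the hypothesis
   [sg <= 1 / 32]. *)
have big : 1 / 4 <= dot (even_part a) a + dot (even_part b) b.
  move: s1 s2 s3 s4 nab sg1; clear; rewrite !ler_norml.
  move: (nrm a ^+ 2) (nrm b ^+ 2) (dot (trans cos a) a) (dot (trans cos b) b)
    (dot (trans sin a) b) (dot (even_part a) a) (dot (even_part b) b) => A B C D E F G.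
  by move=> /andP[? ?] /andP[? ?] /andP[? ?] /andP[? ?] ? ?; lra.
have up w : L2 w -> nrm w <= 1 -> dot (even_part w) w <= nrm (even_part w).
  move=> Lw nw; rewrite (le_trans (ler_norm _))// (le_trans (dot_le (even_part_L2 Lw) Lw))//.
  by rewrite ler_piMr ?nrm_ge0.
have ua := up _ La na; have ub := up _ Lb nb.
have [ha|ha] := leP (1 / 16) (nrm (even_part a)).
  by exists (even_part a); [left|have [? ?] := close _ _ ba L1v n1 e1].
exists (even_part b); first by right.
have hb : 1 / 16 <= nrm (even_part b).
  move: ha big ua ub; clear; move: (nrm _) (nrm _) (dot _ a) (dot _ b) => A B C D; lra.
by have [? ?] := close _ _ bb L2v n2 e2.
Qed.

End EvenPart.

(** * Truncation of almost invariant functions and conclusion *)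

Section Conclusion.
Context {R : realType}.
Notation ReC := (@complex.Re R).
Notation ImC := (@complex.Im R).

Lemma measurable_fourier (f : R -> R[i]) : bL2 (ReC \o f) -> bL2 (ImC \o f) ->
  measurable_cfun (fourier_integral f).
Proof.
move=> br bi; have [Ir Ii] := (bL2_L1 br, bL2_L1 bi).
have [mr mi] := (L1_measurable Ir, L1_measurable Ii).
split.
- rewrite (_ : (fun x => _) = (fun x => trans cos (ReC \o f) x + trans sin (ImC \o f) x)).
    by apply: measurable_funD; apply: trans_measurable => //; [exact: kern_cos|exact: kern_sin].
  by apply/funext => x; rewrite fourier_Re.
- rewrite (_ : (fun x => _) = (fun x => trans cos (ImC \o f) x - trans sin (ReC \o f) x)).
    by apply: measurable_funB; apply: trans_measurable => //; [exact: kern_cos|exact: kern_sin].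
  by apply/funext => x; rewrite fourier_Im.
Qed.

Lemma measurable_cfunB (f g : R -> R[i]) : measurable_cfun f -> measurable_cfun g ->
  measurable_cfun (fun x => f x - g x).
Proof.
move=> [fr fi] [gr gi]; split.
- rewrite (_ : (fun x => _) = (fun x => ReC (f x) - ReC (g x))).
    exact: measurable_funB.
  by apply/funext => x; case: (f x) => ? ?; case: (g x).
- rewrite (_ : (fun x => _) = (fun x => ImC (f x) - ImC (g x))).
    exact: measurable_funB.
  by apply/funext => x; case: (f x) => ? ?; case: (g x).
Qed.

Lemma ReB (z w : R[i]) : ReC (z - w) = ReC z - ReC w.
Proof. by case: z => ? ?; case: w. Qed.

Lemma ImB (z w : R[i]) : ImC (z - w) = ImC z - ImC w.
Proof. by case: z => ? ?; case: w. Qed.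

Lemma cvg_lt_eventually (s : nat -> \bar R) (c : R) : 0 < c ->
  s i @[i --> \oo] --> 0%E -> exists N, forall i, (N <= i)%N -> (s i < c%:E)%E.
Proof.
move=> c0 /fine_cvgP[sfin] /cvgrPdist_lt /(_ c c0) sc.
have [N _ NP] : \forall i \near \oo, (s i < c%:E)%E.
  near=> i; have fi : s i \is a fin_num by near: i.
  rewrite -(fineK fi) lte_fin (le_lt_trans (ler_norm _))//.
  rewrite -normrN -[X in `|X|]add0r; near: i; exact: sc.
by exists N => i Ni; exact: NP.
Unshelve. all: by end_near. Qed.

(** Three errors of size [sg] add up: from the truncation to [f], from [f] to its transform [g], and
    from [g] to the Fourier integral of the truncation. *)
Lemma approx_fixed_even (Y : set R) (sg : R) : 0 < sg -> sg <= 1 / 96 ->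
    supports_almost_invariant_functions Y ->
  exists u, [/\ bL2 u, forall x, ~ Y x -> ~ Y (- x) -> u x = 0,
    L2 (fun x => trans cos u x - u x), nrm (fun x => trans cos u x - u x) <= 3 * sg &
    1 / 16 <= nrm u].
Proof.
move=> sg0 sg1 [f [g [fL fY fg fgcvg]]].
have sg3 : 0 <= 3 * sg by lra.
have sg32 : 3 * sg <= 1 / 32 by lra.
have [i0 i0P] := cvg_lt_eventually sg0 fgcvg.
have fgi := i0P i0 (leqnn _); move: (fL i0) (fY i0) (fg i0) fgi.
move: (f i0) (g i0); clear f g fL fY fg fgcvg i0 i0P => f g [[mf _] f1] fY [[mg _] gcvg] fgsg.
have [n0 n0P] := cvg_lt_eventually sg0 gcvg.
have [Lr Li fri] := L2norm_eq1 mf f1.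
have [n1 n1P] := tail_small Lr sg0; have [n2 n2P] := tail_small Li sg0.
pose n := (n0 + n1 + n2)%N.
have gn := n0P n ltac:(by rewrite /n -addnA leq_addr).
have tr := n1P n ltac:(by rewrite /n addnAC leq_addl).
have ti := n2P n ltac:(by rewrite /n leq_addl).
pose a := restr (ball_set n) (ReC \o f); pose b := restr (ball_set n) (ImC \o f).
have ba : bL2 a by exact: bL2_restr_ball.
have bb : bL2 b by exact: bL2_restr_ball.
have aE : ReC \o truncate n f = a by exact: truncate_Re.
have bE : ImC \o truncate n f = b by exact: truncate_Im.
have mF : measurable_cfun (fourier_integral (truncate n f)).
  by apply: measurable_fourier; rewrite ?aE ?bE.
have [Ia Ib] := (bL2_L1 ba, bL2_L1 bb).
have [Lfgr Lfgi nfgr nfgi] := L2norm_lt (measurable_cfunB mf mg) (ltW sg0) fgsg.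
have [Lgr Lgi ngr ngi] := L2norm_lt (measurable_cfunB mg mF) (ltW sg0) gn.
have [La Lb] := (bL2_L2 ba, bL2_L2 bb).
have na : nrm a <= nrm (ReC \o f) by exact: nrm_restr (measurable_ball_set n) Lr.
have nb : nrm b <= nrm (ImC \o f) by exact: nrm_restr (measurable_ball_set n) Li.
have na' : nrm (ReC \o f) <= nrm a + sg.
  have := nrmD La (L2B Lr La); rewrite (_ : (fun x => _) = ReC \o f).
    by move=> /le_trans; apply; rewrite lerD2l.
  by apply/funext => x; rewrite addrC subrK.
have nb' : nrm (ImC \o f) <= nrm b + sg.
  have := nrmD Lb (L2B Li Lb); rewrite (_ : (fun x => _) = ImC \o f).
    by move=> /le_trans; apply; rewrite lerD2l.
  by apply/funext => x; rewrite addrC subrK.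
have nr0 := nrm_ge0 (ReC \o f); have ni0 := nrm_ge0 (ImC \o f).
have a0 := nrm_ge0 a; have b0 := nrm_ge0 b.
have nr1 : nrm (ReC \o f) <= 1 by move: nr0 ni0 fri; clear; nra.
have ni1 : nrm (ImC \o f) <= 1 by move: nr0 ni0 fri; clear; nra.
have three (v1 v2 v3 : R -> R) : L2 v1 -> L2 v2 -> L2 v3 ->
    nrm v1 <= sg -> nrm v2 <= sg -> nrm v3 <= sg ->
    L2 (fun x => v1 x + v2 x - v3 x) /\ nrm (fun x => v1 x + v2 x - v3 x) <= 3 * sg.
  move=> l1 l2 l3 h1 h2 h3; split; first by apply: L2B => //; exact: L2D.
  have := nrmB (L2D l1 l2) l3; have := nrmD l1 l2; move: h1 h2 h3; clear; lra.
have [LA nA] := three _ _ _ Lfgr Lgr (L2B Lr La) nfgr ngr tr.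
have [LB nB] := three _ _ _ Lfgi Lgi (L2B Li Lb) nfgi ngi ti.
have EA : (fun x => (ReC \o (fun x => f x - g x)%R) x +
    (ReC \o (fun x => g x - fourier_integral (truncate n f) x)%R) x -
    ((ReC \o f) x - a x)) = (fun x => a x - (trans cos a x + trans sin b x)).
  by apply/funext => x /=; rewrite !ReB fourier_Re ?aE ?bE//; ring.
have EB : (fun x => (ImC \o (fun x => f x - g x)%R) x +
    (ImC \o (fun x => g x - fourier_integral (truncate n f) x)%R) x -
    ((ImC \o f) x - b x)) = (fun x => b x - (trans cos b x - trans sin a x)).
  by apply/funext => x /=; rewrite !ImB fourier_Im ?aE ?bE//; ring.
rewrite EA in LA nA; rewrite EB in LB nB.
have nab : 3 / 8 <= nrm a ^+ 2 + nrm b ^+ 2.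
  (* Equivalent to [r ^+ 2 - 2 * sg * r <= s ^+ 2]; as both norms are at most 1, truncation costs at
     most [4 * sg] of the total mass. *)
  have sqr_ge (r s : R) : 0 <= r -> 0 <= s -> r <= s + sg -> r ^+ 2 - 2 * sg <= s ^+ 2 + 2 * sg * (r - 1).
    move=> r0 s0 rs; case: (lerP r sg) => rsg; first by move: r0 s0 rsg; clear; nra.
    have : (r - sg) * (r - sg) <= s * s by apply: ler_pM; move: rs rsg; clear; lra.
    by move: sg0; clear; nra.
  have := sqr_ge _ _ nr0 a0 na'; have := sqr_ge _ _ ni0 b0 nb'.
  have : 2 * sg * (nrm (ReC \o f) - 1) <= 0 by rewrite mulr_ge0_le0 ?subr_le0// mulr_ge0// ltW.
  have : 2 * sg * (nrm (ImC \o f) - 1) <= 0 by rewrite mulr_ge0_le0 ?subr_le0// mulr_ge0// ltW.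
  by move: fri sg1; clear; lra.
have [u uE [Lu nu u16]] := even_part_fixed ba bb sg3 sg32 (le_trans na nr1)
  (le_trans nb ni1) nab LA LB nA nB.
exists u; split => //; first by case: uE => ->; exact: even_part_bL2.
move=> x nY nYN; have za y : ~ Y y -> a y = 0.
  by move=> nYy; rewrite /a /restr /= (fY _ nYy) /= mulr0.
have zb y : ~ Y y -> b y = 0.
  by move=> nYy; rewrite /b /restr /= (fY _ nYy) /= mulr0.
by case: uE => ->; rewrite /even_part ?(za _ nY) ?(za _ nYN) ?(zb _ nY) ?(zb _ nYN) addr0 mulr0.
Qed.

End Conclusion.

Theorem theorem5 (R : realType) :
  exists X : set R,
    [/\ measurable X,
        constant_density X &
        forall Y : set R,
          similar X Y -> ~ supports_almost_invariant_functions Y].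
Proof.
exists sparse_set; split.
- exact: measurable_sparse_set.
- exact: sparse_constant_density.
move=> Y [r1 [r2 [r10 ->]]] aif.
have [j0 [d [S [j04 d0 dr tS ZS]]]] := sparse_thin r2 r10.
have f0 := @frac_gt0 R.
have kap0 : 0 <= 16 * frac :> R by rewrite mulr_ge0// ltW.
have kap36 : 36 * (16 * frac) <= (1 / 32) ^+ 2 :> R.
  by rewrite /frac; lra.
have [tau tau0 core] := core_argument j04 kap0 kap36 tS d0 dr ZS.
(* As [nrm u] is at least [1 / 16], the error [3 * sg <= tau / 16] is within the tolerance
   [tau * nrm u] of the core argument. *)
pose sg := Num.min (1 / 96) (tau / 48).
have sg0 : 0 < sg by rewrite lt_min !divr_gt0.
have sg1 : sg <= 1 / 96 by rewrite ge_min lexx.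
have sg2 : sg <= tau / 48 by rewrite ge_min lexx orbT.
have [u [bu uY Lu nu u16]] := approx_fixed_even sg0 sg1 aif.
have img x : [set r1 * x + r2 | x in sparse_set] x -> sparse_set ((x - r2) / r1).
  by move=> [y ys <-]; rewrite addrK mulrAC divff// mul1r.
have /(core u bu) : forall x, ~ sym_image r1 r2 x -> u x = 0.
  move=> x nx; apply: uY => [/img h|/img h]; apply: nx.
    by exists false; rewrite expr0 mul1r.
  by exists true; rewrite expr1 mulN1r.
move=> /(_ Lu); rewrite (le_trans nu) => [/(_ isT) u0|].
  by rewrite u0 in u16; lra.
by nra.
Qed.
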